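(* For any connected planar graph $\Gamma$ with $n$ vertices and any real number $t>4.63$ one has $$|\Gamma(t)|\le t(t-1)^{n-1},$$ where $\Gamma(t)$ denotes the chromatic polynomial of $\Gamma$ evaluated at $t$. Moreover, the inequality is strict if $\Gamma$ is not a tree, and consequently the stabilizer subgroup $F_\Omega(t)<F$ of the vacuum vector is trivial for any $t>4.63$.
   Context: Graphs are finite and loopless, and parallel edges are identified (so ''tree'' means tree up to parallel edges). Thompson's group $F$: a binary forest with $n$ roots and $m$ leaves is a planar forest, drawn with roots at the bottom and leaves at the top (numbered from left to right), all of whose branchings are binary; $f\circ g$ is $f$ stacked on top of $g$ (roots of $f$ glued to leaves of $g$); a tree is a forest with one root; $|$ is the trivial tree, $Y$ the tree with two leaves, $\bullet$ is horizontal concatenation. $F$ is the set of classes $\frac ts$ of pairs $(t,s)$ of trees with the same number of leaves, modulo $(t,s)\sim(f\circ t,f\circ s)$, with product $\frac ts\cdot\frac{t'}{s'}=\frac{p\circ t}{q\circ s'}$ whenever $p\circ s=q\circ t'$. Temperley-Lieb-Jones category with loop parameter $\delta$: for $m+n$ even, $\mathrm{Rec}(m,n)$ is the complex span of non-crossing pairings of $m$ points on the bottom and $n$ points on the top of a rectangle; composition is vertical concatenation, each closed loop being replaced by the factor $\delta$; $\dagger$ is the antilinear reflection in a horizontal line; $\bullet$ is horizontal concatenation. One takes the quotient by the kernel of the positive semidefinite forms, so that $\mathrm{Rec}(1,n)$ is a Hilbert space with $\langle x,y\rangle=y^\dagger\circ x\in \mathrm{Rec}(1,1)=\mathbb C$.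 Jones representation for the chromatic choice: let $\delta\in\{2\cos(\pi/k):k\ge4\}\cup[2,\infty)$, $t=\delta^2$, $a=(\delta/(\delta^2-1))^{1/2}$, $b=-(1/(\delta^3-\delta))^{1/2}$, and $R=aR_1+bR_2$ with $R_1=|\,|$, $R_2={}^{\cup}_{\cap}$. Bending the bottom right string of $R$ up to the top right gives the isometry $\rho=a(|\bullet\cup)+b(\cup\bullet|)\in\mathrm{Rec}(1,3)$. For the forest $f$ with $n$ roots whose only branching is one $Y$ at the $k$-th root set $\Phi(f)=\mathrm{id}_{2k-2}\bullet\rho\bullet\mathrm{id}_{2n-2k}$, and extend by $\Phi(f\circ g)=\Phi(f)\circ\Phi(g)$. For a tree $s$ with $n$ leaves let $\mathfrak H_s$ be a copy, indexed by $s$, of the span in $\mathrm{Rec}(1,2n-1)$ of all $\Phi(r)$, $r$ a tree with $n$ leaves. $\mathscr H$ is the completion of the inductive limit of the $\mathfrak H_s$ along the isometries $(s,\xi)\mapsto(f\circ s,\Phi(f)\circ\xi)$, the vacuum vector is $\Omega=(|,1)$, and $\pi$ is the unitary representation of $F$ on $\mathscr H$ determined by $\pi(\frac rs)(v,\xi)=(p\circ r,\Phi(q)\circ\xi)$ where $p\circ s=q\circ v$. Then $F_\Omega(t)=\{g\in F:\pi(g)\Omega=\Omega\}$. *)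

(* Defs.v *)
From HB Require Import structures.
From Stdlib Require Import Relation_Operators.
From mathcomp Require Import all_boot all_order all_algebra.
From mathcomp Require Import generic_quotient complex boolp reals zify.

Set Implicit Arguments.
Unset Strict Implicit.
Unset Printing Implicit Defensive.

Import Order.TTheory GRing.Theory Num.Theory.

Local Open Scope ring_scope.
Local Open Scope quotient_scope.

(* Finite loopless graphs with parallel edges identified. *)
Record sgraph := SGraph {
  vertex :> finType;
  adj : rel vertex;
  adj_sym : symmetric adj;
  adj_irrefl : irreflexive adj
}.

Definition connected_graph (G : sgraph) : Prop :=
  (0 < #|G|)%N /\ forall x y : G, connect (@adj G) x y.

Definition is_tree (G : sgraph) : Prop :=
  connected_graph G /\
  forall c : seq G, ucycle (@adj G) c -> (size c <= 2)%N.

Definition proper_coloring (G : sgraph) (k : nat) (f : {ffun G -> 'I_k}) : bool :=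
  [forall x, forall y, adj x y ==> (f x != f y)].

Definition independent (G : sgraph) (B : {set G}) : bool :=
  [forall x in B, forall y in B, ~~ adj x y].

(* Sum over the partitions of the vertex set into independent sets of the
   falling factorials; see [chromatic_polyP]. *)
Definition chromatic_poly (R : comNzRingType) (G : sgraph) : {poly R} :=
  \sum_(P : {set {set G}} | partition P [set: G]%SET &&
                            [forall B in P, independent B])
    \prod_(i < #|P|) ('X - (i%:R)%:P).

Lemma card_kernel (V : finType) (k : nat) (P : {set {set V}}) :
  partition P [set: V]%SET ->
  #|[set f : {ffun V -> 'I_k} | preim_partition f [set: V]%SET == P]| = k ^_ #|P|.
Proof.
move=> pP; have /and3P[/eqP cP tP P0] := pP.
have blkP x : pblock P x \in P by rewrite pblock_mem // cP inE.
pose blk x : {B : {set V} | B \in P} := exist _ (pblock P x) (blkP x).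
have blk_surj B : exists x, blk x == B.
  have /set0Pn[x xB] : val B != set0.
    by apply: contra P0 => /eqP <-; exact: valP B.
  by exists x; apply/eqP; apply: val_inj => /=; rewrite (def_pblock tP (valP B) xB).
have -> : #|P| = #|{: {B : {set V} | B \in P}}| by rewrite card_sig.
rewrite -[in RHS](card_ord k) -card_inj_ffuns.
rewrite -(card_in_imset (f := fun g : {ffun {B : {set V} | B \in P} -> 'I_k} =>
    [ffun x => g (blk x)])); last first.
  move=> g h _ _ /ffunP gh; apply/ffunP => B; have [x /eqP <-] := blk_surj B.
  by have := gh x; rewrite !ffunE.
apply: eq_card => f; rewrite inE; apply/eqP/imsetP.
- move=> Pf.
  have fblk x y : (f x == f y) = (pblock P x == pblock P y).
    rewrite eq_pblock ?cP ?inE // -Pf /preim_partition.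
    by rewrite (pblock_equivalence_partition) ?inE // => a b c _ _ _; split=> // /eqP ->.
  exists [ffun B => f (xchoose (blk_surj B))]; last first.
    apply/ffunP => x; rewrite !ffunE; apply/eqP; rewrite fblk.
    by have /eqP := congr1 val (eqP (xchooseP (blk_surj (blk x)))); rewrite eq_sym.
  rewrite inE; apply/injectiveP => B C; rewrite !ffunE => /eqP.
  rewrite fblk => /eqP BC; apply: val_inj.
  have hB := congr1 val (eqP (xchooseP (blk_surj B))).
  have hC := congr1 val (eqP (xchooseP (blk_surj C))).
  by rewrite -hB -hC.
- move=> [g]; rewrite inE => /injectiveP gi ->.
  rewrite -[RHS](equivalence_partition_pblock pP).
  apply: eq_imset => x; apply/setP => y; rewrite !inE /= !ffunE.
  rewrite -eq_pblock ?cP ?inE //.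
  by apply/eqP/eqP => [/gi /(congr1 val) //|xy]; congr (g _); apply: val_inj.
Qed.

Lemma chromatic_polyP (R : comNzRingType) (G : sgraph) (k : nat) :
  (chromatic_poly R G).[k%:R] = #|[set f : {ffun G -> 'I_k} | proper_coloring f]|%:R.
Proof.
rewrite /chromatic_poly horner_sum.
have ffactE j : (\prod_(i < j) ('X - (i%:R)%:P)).[k%:R] = (k ^_ j)%:R :> R.
  elim: j => [|j IHj]; first by rewrite big_ord0 hornerC.
  rewrite big_ord_recr /= hornerM IHj ffactnSr natrM hornerXsubC.
  have [jk|kj] := leqP j k; first by rewrite natrB.
  by rewrite ffact_small // !mul0r.
under eq_bigr => P _ do rewrite ffactE.
rewrite -natr_sum; congr (_%:R).
rewrite -sum1_card.
rewrite (partition_big (fun f : {ffun G -> 'I_k} => preim_partition f [set: G]%SET)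
  (fun P => partition P [set: G]%SET && [forall B in P, independent B])) /=.
  apply: eq_bigr => P /andP[pP /forall_inP iP]; rewrite -(card_kernel k pP) sum1_card.
  apply: eq_card => f; rewrite !inE unfold_in /= inE.
  apply/eqP/andP=> [fP|[_ /eqP//]]; split; last by rewrite fP.
  apply/forallP => x; apply/forallP => y; apply/implyP => xy; apply/eqP => fxy.
  have /iP/forall_inP/(_ x) : [set z | f x == f z]%SET \in P.
    rewrite -fP; apply/imsetP; exists x; first by rewrite inE.
    by apply/setP => z; rewrite !inE.
  by rewrite inE eqxx => /(_ isT)/forall_inP/(_ y); rewrite inE fxy eqxx xy => /(_ isT).
move=> f; rewrite inE => fp; rewrite preim_partitionP /=.
apply/forall_inP => B /imsetP[x _ ->].
apply/forall_inP => y; rewrite !inE /= => /eqP xy.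
apply/forall_inP => z; rewrite !inE /= => /eqP xz.
apply/negP => yz; have /forallP/(_ y)/forallP/(_ z) := fp.
by rewrite yz -xy -xz eqxx.
Qed.

Definition gen_equiv (T : Type) (E : T -> T -> Prop) : rel T :=
  fun x y => `[< clos_refl_sym_trans T E x y >].

Lemma gen_equiv_refl T E : reflexive (@gen_equiv T E).
Proof. by move=> x; apply/asboolP; exact: rst_refl. Qed.

Lemma gen_equiv_sym T E : symmetric (@gen_equiv T E).
Proof. by move=> x y; apply/asboolP/asboolP => h; exact: rst_sym h. Qed.

Lemma gen_equiv_trans T E : transitive (@gen_equiv T E).
Proof. by move=> y x z /asboolP xy /asboolP yz; apply/asboolP; exact: rst_trans xy yz. Qed.

Canonical gen_equiv_rel (T : choiceType) (E : T -> T -> Prop) :=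
  EquivRel (gen_equiv E) (gen_equiv_refl E) (gen_equiv_sym E) (@gen_equiv_trans T E).

Lemma gen_equivP (T : choiceType) (E : T -> T -> Prop) (x y : T) :
  E x y -> x = y %[mod {eq_quot gen_equiv E}].
Proof. by move=> Exy; apply/eqmodP/asboolP; exact: rst_step. Qed.

Lemma gen_equiv_ind (T : choiceType) (U : Type) (E : T -> T -> Prop) (h : T -> U) :
  (forall x y, E x y -> h x = h y) ->
  forall x y, x = y %[mod {eq_quot gen_equiv E}] -> h x = h y.
Proof.
move=> hE x y /eqmodP/asboolP; elim=> {x y} //.
  by move=> x y z _ -> _ ->.
Qed.

Inductive btree := Leaf | Node of btree & btree.

Fixpoint btree_code (t : btree) : GenTree.tree unit :=
  if t is Node l r then GenTree.Node 0 [:: btree_code l; btree_code r]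
  else GenTree.Leaf tt.

Fixpoint btree_decode (c : GenTree.tree unit) : option btree :=
  match c with
  | GenTree.Leaf _ => Some Leaf
  | GenTree.Node _ [:: c1; c2] =>
      if (btree_decode c1, btree_decode c2) is (Some l, Some r)
      then Some (Node l r) else None
  | _ => None
  end.

Lemma btree_codeK : pcancel btree_code btree_decode.
Proof. by elim=> //= l -> r ->. Qed.

HB.instance Definition _ := Countable.copy btree (pcan_type btree_codeK).

Fixpoint nleaves (t : btree) : nat :=
  if t is Node l r then (nleaves l + nleaves r)%N else 1%N.

Definition nleavesf (f : seq btree) : nat := sumn [seq nleaves t | t <- f].

(* [graft t f]: the trees of [f], from left to right, are stacked on the
   leaves of [t]. *)
Fixpoint graft (t : btree) (f : seq btree) : btree :=
  if t is Node l r then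
    Node (graft l (take (nleaves l) f)) (graft r (drop (nleaves l) f))
  else head Leaf f.

Fixpoint graftf (g f : seq btree) : seq btree :=
  if g is t :: g' then
    graft t (take (nleaves t) f) :: graftf g' (drop (nleaves t) f)
  else [::].

Lemma nleaves_gt0 t : (0 < nleaves t)%N.
Proof. by elim: t => //= l; case: (nleaves l). Qed.

Lemma nleavesf_cat f g : nleavesf (f ++ g) = (nleavesf f + nleavesf g)%N.
Proof. by rewrite /nleavesf map_cat sumn_cat. Qed.

Lemma nleavesf_nseq n : nleavesf (nseq n Leaf) = n.
Proof. by rewrite /nleavesf map_nseq sumn_nseq mul1n. Qed.

Lemma nleavesf_ge f : (size f <= nleavesf f)%N.
Proof.
elim: f => //= t f IHf; rewrite /nleavesf /= -/(nleavesf f).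
by rewrite -add1n leq_add // nleaves_gt0.
Qed.

Lemma size_graftf g f : size (graftf g f) = size g.
Proof. by elim: g f => //= t g IHg f; rewrite IHg. Qed.

Lemma nleaves_graft t f : size f = nleaves t -> nleaves (graft t f) = nleavesf f.
Proof.
elim: t f => [|l IHl r IHr] f /=; first by case: f => [|? []] //= _; rewrite /nleavesf /= addn0.
move=> sf; rewrite IHl ?IHr ?size_drop ?sf ?addKn //; last first.
  by rewrite size_takel // sf leq_addr.
by rewrite -nleavesf_cat cat_take_drop.
Qed.

Lemma nleavesf_graftf g f : size f = nleavesf g -> nleavesf (graftf g f) = nleavesf f.
Proof.
elim: g f => [|t g IHg] f /=; first by move/size0nil => ->.
rewrite {1 2}/nleavesf /= -!/(nleavesf _) => sf.
rewrite nleaves_graft ?IHg ?size_drop ?sf ?addKn //; last first.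
  by rewrite size_takel // sf leq_addr.
by rewrite -nleavesf_cat cat_take_drop.
Qed.

Lemma graft_cat l r f g : size f = nleaves l ->
  graft (Node l r) (f ++ g) = Node (graft l f) (graft r g).
Proof. by move=> sf /=; rewrite -sf take_size_cat // drop_size_cat. Qed.

Lemma graft_leaf t : graft t (nseq (nleaves t) Leaf) = t.
Proof.
elim: t => //= l IHl r IHr; rewrite take_nseq ?leq_addr // drop_nseq addKn.
by rewrite IHl IHr.
Qed.

Lemma graftf_leaf g : graftf g (nseq (nleavesf g) Leaf) = g.
Proof.
elim: g => //= t g IHg; rewrite /nleavesf /= -/(nleavesf g).
by rewrite take_nseq ?leq_addr // drop_nseq addKn graft_leaf IHg.
Qed.

Lemma graft_nseq n f : size f = n -> graftf (nseq n Leaf) f = f.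
Proof. by elim: n f => [|n IHn] [|t f] //= [sf]; rewrite ?take0 ?drop0 IHn. Qed.

Lemma take_graftf n g f :
  take n (graftf g f) = graftf (take n g) (take (nleavesf (take n g)) f).
Proof.
elim: g n f => [|t g IHg] [|n] f //=.
rewrite IHg /nleavesf /= -!/(nleavesf _); congr (graft _ _ :: graftf _ _).
  by rewrite take_takel // leq_addr.
by rewrite take_drop addnC.
Qed.

Lemma drop_graftf n g f :
  drop n (graftf g f) = graftf (drop n g) (drop (nleavesf (take n g)) f).
Proof.
elim: g n f => [|t g IHg] [|n] f //=; first by rewrite drop0.
by rewrite IHg /nleavesf /= -!/(nleavesf _) drop_drop addnC.
Qed.

Lemma graftA t g f : size g = nleaves t -> size f = nleavesf g ->
  graft t (graftf g f) = graft (graft t g) f.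
Proof.
elim: t g f => [|l IHl r IHr] g f /=.
  case: g => [|t [|? ?]] //= _; rewrite /nleavesf /= addn0 => sf.
  by rewrite -sf take_size.
move=> sg sf; rewrite take_graftf drop_graftf.
have sl : size (take (nleaves l) g) = nleaves l by rewrite size_takel // sg leq_addr.
have sr : size (drop (nleaves l) g) = nleaves r by rewrite size_drop sg addKn.
have gE : (nleavesf (take (nleaves l) g) + nleavesf (drop (nleaves l) g) = nleavesf g)%N.
  by rewrite -nleavesf_cat cat_take_drop.
rewrite IHl ?IHr // ?(nleaves_graft sl) //.
- by rewrite size_drop sf -gE addKn.
- by rewrite size_takel // sf -gE leq_addr.
Qed.

Lemma graftfA h g f : size g = nleavesf h -> size f = nleavesf g ->
  graftf h (graftf g f) = graftf (graftf h g) f.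
Proof.
elim: h g f => [|t h IHh] g f //=; rewrite {1}/nleavesf /= -/(nleavesf h) => sg sf.
have sl : size (take (nleaves t) g) = nleaves t by rewrite size_takel // sg leq_addr.
have sr : size (drop (nleaves t) g) = nleavesf h by rewrite size_drop sg addKn.
have gE : (nleavesf (take (nleaves t) g) + nleavesf (drop (nleaves t) g) = nleavesf g)%N.
  by rewrite -nleavesf_cat cat_take_drop.
rewrite take_graftf drop_graftf IHh ?graftA ?(nleaves_graft sl) //.
- by rewrite size_takel // sf -gE leq_addr.
- by rewrite size_drop sf -gE addKn.
Qed.

Lemma graft_inj t f g : size f = nleaves t -> size g = nleaves t ->
  graft t f = graft t g -> f = g.
Proof.
elim: t f g => [|l IHl r IHr] f g /=.
  by case: f g => [|? [|? ?]] // [|? [|? ?]] //= _ _ ->.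
move=> sf sg [fl fr].
rewrite -[LHS](cat_take_drop (nleaves l)) -[RHS](cat_take_drop (nleaves l)).
congr (_ ++ _).
  by apply: IHl fl; rewrite size_takel // ?sf ?sg leq_addr.
by apply: IHr fr; rewrite size_drop ?sf ?sg addKn.
Qed.

Lemma common_graft s t : exists f g,
  [/\ size f = nleaves s, size g = nleaves t & graft s f = graft t g].
Proof.
elim: s t => [|l IHl r IHr] t.
  exists [:: t], (nseq (nleaves t) Leaf); rewrite size_nseq graft_leaf; by split.
case: t => [|l' r'].
  exists (nseq (nleaves (Node l r)) Leaf), [:: Node l r].
  by rewrite size_nseq graft_leaf; split.
have [fl [gl [sfl sgl El]]] := IHl l'; have [fr [gr [sfr sgr Er]]] := IHr r'.
exists (fl ++ fr), (gl ++ gr); rewrite !graft_cat // El Er.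
by rewrite !size_cat sfl sfr sgl sgr.
Qed.

Definition forest (n m : nat) :=
  {f : seq btree | (size f == n) && (nleavesf f == m)}.

Definition tree (n : nat) := forest 1 n.

Lemma forestP n m (f : forest n m) : size (val f) = n /\ nleavesf (val f) = m.
Proof. by case/andP: (valP f) => /eqP-> /eqP->. Qed.

Lemma fcomp_subproof n m p (f : forest m p) (g : forest n m) :
  (size (graftf (val g) (val f)) == n) && (nleavesf (graftf (val g) (val f)) == p).
Proof.
have [sf lf] := forestP f; have [sg lg] := forestP g.
by rewrite size_graftf nleavesf_graftf ?sg ?lf ?sf ?lg ?eqxx.
Qed.

(* [f \oF g] is [f] stacked on top of [g]. *)
Definition fcomp n m p (f : forest m p) (g : forest n m) : forest n p :=
  exist _ (graftf (val g) (val f)) (fcomp_subproof f g).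

Notation "f \oF g" := (fcomp f g) (at level 50, left associativity).

Lemma fid_subproof n : (size (nseq n Leaf) == n) && (nleavesf (nseq n Leaf) == n).
Proof. by rewrite size_nseq nleavesf_nseq !eqxx. Qed.

Definition fid n : forest n n := exist _ (nseq n Leaf) (fid_subproof n).

Lemma elem_subproof n (k : 'I_n) :
  let f := nseq k Leaf ++ Node Leaf Leaf :: nseq (n - k.+1) Leaf in
  (size f == n) && (nleavesf f == n.+1).
Proof.
have kn := ltn_ord k; rewrite /= size_cat /= !size_nseq -cat1s !nleavesf_cat.
by rewrite !nleavesf_nseq {1}/nleavesf /=; apply/andP; split; lia.
Qed.

(* The forest with [n] roots whose only branching is a caret at root [k]
   (counted from 0). *)
Definition felem n (k : 'I_n) : forest n n.+1 :=
  exist _ (nseq k Leaf ++ Node Leaf Leaf :: nseq (n - k.+1) Leaf) (elem_subproof k).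

Lemma fcompA n m p q (f : forest p q) (g : forest m p) (h : forest n m) :
  f \oF (g \oF h) = f \oF g \oF h.
Proof.
apply: val_inj => /=; have [sf _] := forestP f.
have [sg lg] := forestP g; have [_ lh] := forestP h.
by rewrite graftfA // ?sg ?lh ?sf ?lg.
Qed.

Lemma fcomp1f n m (f : forest n m) : fid m \oF f = f.
Proof. by apply: val_inj => /=; have [_ lf] := forestP f; have := graftf_leaf (val f); rewrite lf. Qed.

Lemma fcompf1 n m (f : forest n m) : f \oF fid n = f.
Proof. by apply: val_inj => /=; have [sf _] := forestP f; rewrite graft_nseq. Qed.

Lemma graftf_inj g f f' : size f = nleavesf g -> size f' = nleavesf g ->
  graftf g f = graftf g f' -> f = f'.
Proof.
elim: g f f' => [|t g IHg] f f' /=.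
  by move=> /size0nil -> /size0nil ->.
rewrite {1 2}/nleavesf /= -/(nleavesf g) => sf sf' [fl fr].
rewrite -[LHS](cat_take_drop (nleaves t)) -[RHS](cat_take_drop (nleaves t)).
congr (_ ++ _).
  by apply: graft_inj fl; rewrite size_takel // ?sf ?sf' leq_addr.
by apply: IHg fr; rewrite size_drop ?sf ?sf' addKn.
Qed.

Lemma fcompI n m p (s : forest n m) : injective (fun f : forest m p => f \oF s).
Proof.
move=> f g /(congr1 val) /= /graftf_inj fg; apply: val_inj; apply: fg.
all: by have [_ ->] := forestP s; rewrite ?(forestP f).1 ?(forestP g).1.
Qed.

Lemma completion_exists n m (s : tree n) (t : tree m) :
  exists pq : {k : nat & (forest n k * forest m k)%type},
    (tagged pq).1 \oF s == (tagged pq).2 \oF t.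
Proof.
case: s => [s ps]; case: t => [t pt].
case: s ps => [|s [|? ?]] ps //; case: t pt => [|t [|? ?]] pt //.
have ls : nleaves s = n by case/andP: (ps) => _ /eqP <-; rewrite /nleavesf /= addn0.
have lt : nleaves t = m by case/andP: (pt) => _ /eqP <-; rewrite /nleavesf /= addn0.
have [f [g [sf sg E]]] := common_graft s t.
have fP : (size f == n) && (nleavesf f == nleavesf f) by rewrite sf ls !eqxx.
have gP : (size g == m) && (nleavesf g == nleavesf f).
  by rewrite sg lt eqxx -(nleaves_graft sg) -E nleaves_graft ?eqxx.
exists (Tagged (fun k => (forest n k * forest m k)%type)
  (exist _ f fP : forest n (nleavesf f), exist _ g gP : forest m (nleavesf f))).
apply/eqP/val_inj => /=; congr [:: _].
by rewrite -sf -sg !take_size.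
Qed.

Definition complete n m (s : tree n) (t : tree m) :
    {k : nat & (forest n k * forest m k)%type} :=
  xchoose (completion_exists s t).

Lemma completeP n m (s : tree n) (t : tree m) :
  (tagged (complete s t)).1 \oF s = (tagged (complete s t)).2 \oF t.
Proof. exact/eqP/(xchooseP (completion_exists s t)). Qed.

Definition tree_pair := {n : nat & (tree n * tree n)%type}.

Definition mkpair n (t s : tree n) : tree_pair :=
  Tagged (fun n => (tree n * tree n)%type) (t, s).

Inductive pair_step : tree_pair -> tree_pair -> Prop :=
  PairStep n m (t s : tree n) (f : forest n m) :
    pair_step (mkpair t s) (mkpair (f \oF t) (f \oF s)).

Definition thompson := {eq_quot gen_equiv pair_step}.

HB.instance Definition _ : EqQuotient _ (gen_equiv pair_step) thompson :=
  EqQuotient.on thompson.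
HB.instance Definition _ := Choice.on thompson.

Definition frac n (t s : tree n) : thompson := \pi_thompson (mkpair t s).

Definition mul_pair (x y : tree_pair) : thompson :=
  let: existT n (t, s) := x in
  let: existT m (t', s') := y in
  let: existT k (p, q) := complete s t' in
  frac (p \oF t) (q \oF s').

Definition mulF (g h : thompson) : thompson := mul_pair (repr g) (repr h).

Definition invF (g : thompson) : thompson :=
  let: existT n (t, s) := repr g in frac s t.

Definition oneF : thompson := frac (fid 1) (fid 1).

Lemma frac_step n m (t s : tree n) (f : forest n m) :
  frac (f \oF t) (f \oF s) = frac t s.
Proof. by symmetry; apply: gen_equivP; constructor. Qed.

Lemma fracP (g : thompson) : exists n (t s : tree n), g = frac t s.
Proof. by rewrite -[g]reprK; case: (repr g) => n [t s]; exists n, t, s. Qed.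

Lemma mul_pairE n m k (t s : tree n) (t' s' : tree m) (p : forest n k) (q : forest m k) :
  p \oF s = q \oF t' -> mul_pair (mkpair t s) (mkpair t' s') = frac (p \oF t) (q \oF s').
Proof.
move=> pq; rewrite /mul_pair /=.
have := completeP s t'; case: (complete s t') => k' [p' q'] /= pq'.
have := completeP (p \oF s) (p' \oF s).
case: (complete _ _) => j [x y] /=; rewrite !fcompA => xy.
have xyp := fcompI xy.
have xyq : x \oF q = y \oF q'.
  by apply: (@fcompI _ _ _ t'); rewrite -!fcompA -pq -pq' !fcompA.
rewrite -(frac_step (p' \oF t) _ y) -(frac_step (p \oF t) _ x) !fcompA.
by rewrite xyp xyq.
Qed.

Lemma mul_pairl y x x' : x = x' %[mod {eq_quot gen_equiv pair_step}] ->
  mul_pair x y = mul_pair x' y.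
Proof.
move: x x'; apply: (gen_equiv_ind (h := fun x => mul_pair x y)).
move=> _ _ [n m t s f]; case: y => k [t' s'].
have := completeP (f \oF s) t'; case: (complete _ _) => j [p q] /= pq.
rewrite -[LHS]/(mul_pair (mkpair t s) (mkpair t' s')).
rewrite -[RHS]/(mul_pair (mkpair (f \oF t) (f \oF s)) (mkpair t' s')).
rewrite (mul_pairE _ _ pq).
by rewrite fcompA in pq; rewrite (mul_pairE _ _ pq) fcompA.
Qed.

Lemma mul_pairr x y y' : y = y' %[mod {eq_quot gen_equiv pair_step}] ->
  mul_pair x y = mul_pair x y'.
Proof.
move: y y'; apply: (gen_equiv_ind (h := fun y => mul_pair x y)).
move=> _ _ [n m t' s' f]; case: x => k [t s].
have := completeP s (f \oF t'); case: (complete _ _) => j [p q] /= pq.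
rewrite -[LHS]/(mul_pair (mkpair t s) (mkpair t' s')).
rewrite -[RHS]/(mul_pair (mkpair t s) (mkpair (f \oF t') (f \oF s'))).
rewrite (mul_pairE _ _ pq).
by rewrite fcompA in pq; rewrite (mul_pairE _ _ pq) fcompA.
Qed.

Lemma mul_frac n m k (t s : tree n) (t' s' : tree m) (p : forest n k) (q : forest m k) :
  p \oF s = q \oF t' -> mulF (frac t s) (frac t' s') = frac (p \oF t) (q \oF s').
Proof.
move=> pq; rewrite -[LHS]/(mul_pair (repr (frac t s)) (repr (frac t' s'))).
rewrite -(mul_pairE _ _ pq) (@mul_pairl _ _ (mkpair t s)) ?reprK //.
by rewrite (@mul_pairr _ _ (mkpair t' s')) ?reprK.
Qed.

Lemma inv_frac n (t s : tree n) : invF (frac t s) = frac s t.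
Proof.
pose h (x : tree_pair) := let: existT n (t, s) := x in frac s t.
rewrite -[LHS]/(h (repr (frac t s))) -[RHS]/(h (mkpair t s)).
apply: (gen_equiv_ind (E := pair_step)); last by rewrite reprK.
by move=> _ _ [k m a b f] /=; rewrite frac_step.
Qed.

Lemma frac_id n (t : tree n) : frac t t = oneF.
Proof. by rewrite -[t]fcompf1 frac_step. Qed.

Lemma mulFA : associative mulF.
Proof.
move=> g1 g2 g3.
have [n1 [t1 [s1 ->]]] := fracP g1; have [n2 [t2 [s2 ->]]] := fracP g2.
have [n3 [t3 [s3 ->]]] := fracP g3.
have := completeP s1 t2; case: (complete _ _) => a [p q] /= pq.
have := completeP (q \oF s2) t3; case: (complete _ _) => b [u v] /= uv.
rewrite (mul_frac _ _ pq) (mul_frac _ _ uv).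
have uv' : (u \oF q) \oF s2 = v \oF t3 by rewrite -fcompA.
rewrite (mul_frac _ _ uv').
have pq' : (u \oF p) \oF s1 = fid b \oF ((u \oF q) \oF t2).
  by rewrite fcomp1f -!fcompA pq.
by rewrite (mul_frac _ _ pq') fcomp1f fcompA.
Qed.

Lemma mul1F : left_id oneF mulF.
Proof.
move=> g; have [n [t [s ->]]] := fracP g.
have E : t \oF fid 1 = fid n \oF t by rewrite fcompf1 fcomp1f.
by rewrite (mul_frac _ _ E) fcompf1 fcomp1f.
Qed.

Lemma mulF1 : right_id oneF mulF.
Proof.
move=> g; have [n [t [s ->]]] := fracP g.
have E : fid n \oF s = s \oF fid 1 by rewrite fcompf1 fcomp1f.
by rewrite (mul_frac _ _ E) fcompf1 fcomp1f.
Qed.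

Lemma mulVF : left_inverse oneF invF mulF.
Proof.
move=> g; have [n [t [s ->]]] := fracP g.
by rewrite inv_frac (mul_frac _ _ (erefl (fid n \oF t))) frac_id.
Qed.

Lemma mulFV : right_inverse oneF invF mulF.
Proof.
move=> g; have [n [t [s ->]]] := fracP g.
by rewrite inv_frac (mul_frac _ _ (erefl (fid n \oF s))) frac_id.
Qed.

HB.instance Definition _ := isGroup.Build thompson mulFA mul1F mulF1 mulVF mulFV.

(* Boundary points of a rectangle: [inl i] is the [i]-th bottom point and
   [inr j] the [j]-th top point, both numbered from left to right. *)
Definition bpoint (m n : nat) : finType := ('I_m + 'I_n)%type.

(* Position when walking counterclockwise around the boundary from the lower
   left corner. *)
Definition rim (m n : nat) (p : bpoint m n) : nat :=
  match p with inl i => i | inr j => (m + (n - j.+1))%N end.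

Definition noncrossing (m n : nat) (d : bpoint m n -> bpoint m n) : bool :=
  [forall p, forall q,
     ~~ [&& rim p < rim q, rim q < rim (d p) & rim (d p) < rim (d q)]%N].

(* A pairing of the points is encoded by the map sending a point to its
   partner. *)
Definition tldiag (m n : nat) :=
  {d : {ffun bpoint m n -> bpoint m n} |
     [forall p, (d p != p) && (d (d p) == p)] && noncrossing d}.

Definition diag_fun (m n : nat) (d : tldiag m n) : bpoint m n -> bpoint m n := val d.
Coercion diag_fun : tldiag >-> Funclass.

(* Stacking [d1] on top of [d2]; the points of the glued picture are
    [(bottom + middle) + top]. *)

Definition glue_point (m n p : nat) : finType := (('I_m + 'I_n) + 'I_p)%type.

Definition glue_low m n p (q : bpoint m n) : glue_point m n p := inl q.

Definition glue_high m n p (q : bpoint n p) : glue_point m n p :=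
  match q with inl j => inl (inr j) | inr k => inr k end.

Definition glue_outer m n p (q : bpoint m p) : glue_point m n p :=
  match q with inl i => inl (inl i) | inr k => inr k end.

Definition glue_adj m n p (d1 : tldiag n p) (d2 : tldiag m n) : rel (glue_point m n p) :=
  fun x y =>
    [exists q, (x == glue_low p q) && (y == glue_low p (d2 q))] ||
    [exists q, (x == glue_high m q) && (y == glue_high m (d1 q))].

Definition is_stack m n p (d1 : tldiag n p) (d2 : tldiag m n) (d : tldiag m p) : bool :=
  [forall q, connect (glue_adj d1 d2) (glue_outer n q) (glue_outer n (d q))].

Definition nloops m n p (d1 : tldiag n p) (d2 : tldiag m n) : nat :=
  n_comp (glue_adj d1 d2)
    [pred x | [forall q, ~~ connect (glue_adj d1 d2) (glue_outer n q) x]].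

Definition left_point m n m' n' (q : bpoint m n) : bpoint (m + m') (n + n') :=
  match q with inl i => inl (lshift m' i) | inr j => inr (lshift n' j) end.

Definition right_point m n m' n' (q : bpoint m' n') : bpoint (m + m') (n + n') :=
  match q with inl i => inl (rshift m i) | inr j => inr (rshift n j) end.

Definition is_juxt m n m' n' (d1 : tldiag m n) (d2 : tldiag m' n')
    (d : tldiag (m + m') (n + n')) : bool :=
  [forall q, d (left_point m' n' q) == left_point m' n' (d1 q)] &&
  [forall q, d (right_point m n q) == right_point m n (d2 q)].

Definition flip_point m n (q : bpoint m n) : bpoint n m :=
  match q with inl i => inr i | inr j => inl j end.

Definition is_flip m n (d : tldiag m n) (d' : tldiag n m) : bool :=
  [forall q, d' (flip_point q) == flip_point (d q)].

Section TemperleyLiebJones.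
Variables (R : realType) (delta : R).

Local Notation C := R[i].

(* Formal linear combinations of diagrams, before dividing out the kernel of
   the inner product (see [lim_step]). The operations below are the
   (sesqui)linear extensions of the operations on diagrams. *)
Definition Rec (m n : nat) := {ffun tldiag m n -> C^o}.

Definition rcomp m n p (x : Rec n p) (y : Rec m n) : Rec m p :=
  [ffun d => \sum_(d1 : tldiag n p) \sum_(d2 : tldiag m n | is_stack d1 d2 d)
     (delta%:C)%C ^+ nloops d1 d2 * (x d1 : C) * (y d2 : C)].

Definition rjuxt m n m' n' (x : Rec m n) (y : Rec m' n') : Rec (m + m') (n + n') :=
  [ffun d => \sum_(d1 : tldiag m n) \sum_(d2 : tldiag m' n' | is_juxt d1 d2 d)
     (x d1 : C) * (y d2 : C)].

Definition rdagger m n (x : Rec m n) : Rec n m :=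
  [ffun d' => \sum_(d : tldiag m n | is_flip d d') (x d : C)^*].

Definition rid n : Rec n n :=
  [ffun d : tldiag n n => ([forall i : 'I_n, d (inl i) == inr i])%:R].

Definition rcup : Rec 0 2 :=
  [ffun d : tldiag 0 2 => (d (inr ord0) == inr ord_max)%:R].

Definition recast m n m' n' (em : m = m') (en : n = n') (x : Rec m n) : Rec m' n' :=
  ecast k (Rec m' k) en (ecast k (Rec k n) em x).

(* The identification of Rec(1,1) with the complex numbers: there is a single
   diagram from 1 to 1. *)
Definition rscalar (x : Rec 1 1) : C := \sum_(d : tldiag 1 1) (x d : C).

Definition rinner n (x y : Rec 1 n) : C := rscalar (rcomp (rdagger y) x).

Definition rnorm n (x : Rec 1 n) : R := Num.sqrt (complex.Re (rinner x x)).

Definition coef_a : R := Num.sqrt (delta / (delta ^+ 2 - 1)).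
Definition coef_b : R := - Num.sqrt (1 / (delta ^+ 3 - delta)).

Definition rho : Rec 1 3 :=
  (coef_a%:C)%C *: (rjuxt (rid 1) rcup : Rec 1 3) +
  (coef_b%:C)%C *: (rjuxt rcup (rid 1) : Rec 1 3).

Definition strands (n : nat) : nat := n.*2.-1.

Lemma elem_dom n (k : 'I_n) : (k.*2 + 1 + (n - k.+1).*2)%N = strands n.
Proof. by rewrite /strands; have := ltn_ord k; lia. Qed.

Lemma elem_cod n (k : 'I_n) : (k.*2 + 3 + (n - k.+1).*2)%N = strands n.+1.
Proof. by rewrite /strands; have := ltn_ord k; lia. Qed.

Definition Phi_elem n (k : 'I_n) : Rec (strands n) (strands n.+1) :=
  recast (elem_dom k) (elem_cod k)
    (rjuxt (rjuxt (rid k.*2) rho) (rid (n - k.+1).*2)).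

End TemperleyLiebJones.

(* Sequences of elementary forests, listed from bottom to top. *)
Inductive word : nat -> nat -> Type :=
| wnil n : word n n
| wcons n m (k : 'I_n) (w : word n.+1 m) : word n m.

Fixpoint word_forest n m (w : word n m) : forest n m :=
  match w in word n m return forest n m with
  | wnil n => fid n
  | wcons _ _ k w' => word_forest w' \oF felem k
  end.

Fixpoint Phi_word (R : realType) (delta : R) n m (w : word n m) :
    Rec R (strands n) (strands m) :=
  match w in word n m return Rec R (strands n) (strands m) with
  | wnil n => rid R (strands n)
  | wcons _ _ k w' => rcomp delta (Phi_word delta w') (Phi_elem delta k)
  end.

Lemma word_le n m (w : word n m) : (n <= m)%N.
Proof. by elim: w => // {}n {}m _ _ /ltnW. Qed.

Lemma nleavesf_size f : nleavesf f = size f -> f = nseq (size f) Leaf.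
Proof.
elim: f => //= t f IHf; rewrite /nleavesf /= -/(nleavesf f) => E.
have := nleavesf_ge f; have := nleaves_gt0 t => t0 fs.
have tE : nleaves t = 1%N by lia.
rewrite -IHf; last by lia.
by case: t tE {E t0} => //= l r; have := nleaves_gt0 l; have := nleaves_gt0 r; lia.
Qed.

Lemma graftf_cat g1 g2 f1 f2 : size f1 = nleavesf g1 ->
  graftf (g1 ++ g2) (f1 ++ f2) = graftf g1 f1 ++ graftf g2 f2.
Proof.
elim: g1 f1 => [|t g1 IHg] f1 /=; first by move/size0nil ->.
rewrite {1}/nleavesf /= -/(nleavesf g1) => sf.
have tf : (nleaves t <= size f1)%N by rewrite sf leq_addr.
rewrite take_cat drop_cat; congr (_ :: _).
  by case: ltngtP tf => // E _; rewrite E subnn take0 cats0 take_size.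
case: ltngtP tf => // [_ _|E _]; first by rewrite IHg // size_drop sf addKn.
by rewrite E subnn drop0 drop_size -IHg //; move: sf; rewrite -E /=; lia.
Qed.

Lemma first_caret f : (size f < nleavesf f)%N ->
  exists k l r g, f = nseq k Leaf ++ Node l r :: g.
Proof.
elim: f => //= -[|l r] f IHf; rewrite /nleavesf /= -/(nleavesf f) => lt_f.
  by have [//|k [l [r [g ->]]]] := IHf; exists k.+1, l, r, g.
by exists 0%N, l, r, f.
Qed.

Lemma forest_word n m (f : forest n m) : exists w : word n m, word_forest w == f.
Proof.
suff H c f' n' : size f' = n' -> nleavesf f' = (n' + c)%N ->
    exists w : word n' (n' + c)%N, val (word_forest w) = f'.
  have [sf lf] := forestP f.
  have nm : (n <= m)%N by have := nleavesf_ge (val f); rewrite sf lf.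
  have := H (m - n)%N (val f) n sf; rewrite subnKC // => /(_ lf)[w wf].
  by exists w; apply/eqP/val_inj.
elim: c n' f' => [|c IHc] n' f' sf' lf'.
  rewrite addn0 in lf' *; exists (wnil n').
  by rewrite /= [RHS]nleavesf_size sf'.
have [|k [l [r [g E]]]] := @first_caret f'; first by rewrite sf' lf'; lia.
have kn : (k < n')%N by rewrite -sf' E size_cat size_nseq /=; lia.
have sg : size g = (n' - k.+1)%N by rewrite -sf' E size_cat size_nseq /=; lia.
pose f2 := nseq k Leaf ++ [:: l; r] ++ g.
have lf2 : nleavesf f2 = (n'.+1 + c)%N.
  rewrite addSnnS -lf' E /f2 !nleavesf_cat !nleavesf_nseq /nleavesf /=; lia.
have [|w wf2] := IHc n'.+1 f2 _ lf2; first by rewrite /f2 !size_cat size_nseq /= sg; lia.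
rewrite -addSnnS; exists (wcons (Ordinal kn) w).
rewrite /= -[sval _]/(val (word_forest w)) wf2 E /f2.
rewrite graftf_cat ?size_nseq ?nleavesf_nseq // graft_nseq ?size_nseq //=.
by rewrite drop0 -sg graft_nseq.
Qed.

Definition factorization n m (f : forest n m) : word n m :=
  projT1 (cid (forest_word f)).

Lemma factorizationK n m : cancel (@factorization n m) (@word_forest n m).
Proof. by move=> f; exact/eqP/(projT2 (cid (forest_word f))). Qed.

(* By functoriality the value does not depend on the factorization of [f]
   into elementary forests. *)
Definition Phi (R : realType) (delta : R) n m (f : forest n m) :
    Rec R (strands n) (strands m) :=
  Phi_word delta (factorization f).

Lemma Phi_word_id (R : realType) (delta : R) n m (w : word n m) (e : n = m) :
  Phi_word delta w = ecast k (Rec R (strands n) (strands k)) e (rid R (strands n)).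
Proof.
case: n m / w e => [n|n m k w] e; first by rewrite eq_axiomK.
by exfalso; have := word_le w; rewrite -[X in (_ < X)%N]e ltnn.
Qed.

Section JonesRepresentation.
Variables (R : realType) (delta : R).

Definition in_span n (x : Rec R 1 (strands n)) : Prop :=
  exists k (c : 'I_k -> R[i]) (r : 'I_k -> tree n),
    x = \sum_(i < k) c i *: (Phi delta (r i) : Rec R 1 (strands n)).

(* The copy of this space indexed by [s : tree n] is obtained by pairing its
   elements with [s]; see [lim_raw]. *)
Definition tree_span n := {x : Rec R 1 (strands n) | `[< in_span x >]}.

Lemma in_span0 n : `[< in_span (0 : Rec R 1 (strands n)) >].
Proof.
apply/asboolP; exists 0%N, (fun=> 0), (fun i : 'I_0 => False_rect _ (notF (ltn_ord i))).
by rewrite big_ord0.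
Qed.

Definition tree_span0 n : tree_span n := exist _ 0 (in_span0 n).

(* [Phi f] maps [tree_span n] to [tree_span m] since Phi is a functor, so the
   default value of [insubd] is never used. *)
Definition Phi_act n m (f : forest n m) (xi : tree_span n) : tree_span m :=
  insubd (tree_span0 m)
    (rcomp delta (Phi delta f) (val xi : Rec R (strands 1) (strands n))).

Definition lim_raw := {n : nat & (tree n * tree_span n)%type}.

Definition mkvec n (s : tree n) (xi : tree_span n) : lim_raw :=
  Tagged (fun n => (tree n * tree_span n)%type) (s, xi).

Inductive lim_step : lim_raw -> lim_raw -> Prop :=
| lim_kernel n (s : tree n) (xi eta : tree_span n) :
    (forall z : Rec R 1 (strands n), rinner delta (val xi - val eta) z = 0) ->
    lim_step (mkvec s xi) (mkvec s eta)
| lim_incl n m (s : tree n) (f : forest n m) (xi : tree_span n) :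
    lim_step (mkvec s xi) (mkvec (f \oF s) (Phi_act f xi)).

Definition jones_lim := {eq_quot gen_equiv lim_step}.

HB.instance Definition _ : EqQuotient _ (gen_equiv lim_step) jones_lim :=
  EqQuotient.on jones_lim.

Definition vec n (s : tree n) (xi : tree_span n) : jones_lim :=
  \pi_jones_lim (mkvec s xi).

Definition lim_dist (u v : jones_lim) : R :=
  let: existT n (s, xi) := repr u in
  let: existT m (t, eta) := repr v in
  let: existT k (p, q) := complete s t in
  rnorm delta (val (Phi_act p xi) - val (Phi_act q eta)).

Definition pi_lim (g : thompson) (u : jones_lim) : jones_lim :=
  let: existT n (r, s) := repr g in
  let: existT m (v, xi) := repr u in
  let: existT k (p, q) := complete s v in
  vec (p \oF r) (Phi_act q xi).

(* The distance of the inductive limit determines its completion, built below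
   from Cauchy sequences; the linear structure is not needed to state when a
   vector is fixed. *)

Definition is_cauchy (u : nat -> jones_lim) : Prop :=
  forall e : R, 0 < e ->
    exists N, forall i j, (N <= i)%N -> (N <= j)%N -> lim_dist (u i) (u j) < e.

Definition cauchy_seq := {u : nat -> jones_lim | `[< is_cauchy u >]}.

Definition cauchy_equiv (u v : cauchy_seq) : Prop :=
  forall e : R, 0 < e ->
    exists N, forall i, (N <= i)%N -> lim_dist (val u i) (val v i) < e.

Definition jones_space := {eq_quot gen_equiv cauchy_equiv}.

HB.instance Definition _ : EqQuotient _ (gen_equiv cauchy_equiv) jones_space :=
  EqQuotient.on jones_space.

Lemma rnorm0 n : rnorm delta (0 : Rec R 1 n) = 0.
Proof.
rewrite /rnorm /rinner /rscalar big1 ?sqrtr0 // => d _; rewrite ffunE.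
apply: big1 => d1 _; apply: big1 => d2 _.
by rewrite [X in _ * X](_ : _ = 0) ?mulr0 // ffunE.
Qed.

Lemma lim_distxx u : lim_dist u u = 0.
Proof.
rewrite /lim_dist; case: (repr u) => n [s xi].
have := completeP s s; case: (complete s s) => k [p q] /= /fcompI ->.
by rewrite subrr rnorm0.
Qed.

Lemma cauchy_cst u : `[< is_cauchy (fun=> u) >].
Proof. by apply/asboolP => e e0; exists 0%N => i j _ _; rewrite lim_distxx. Qed.

Definition cst_seq (u : jones_lim) : cauchy_seq := exist _ (fun=> u) (cauchy_cst u).

Lemma in_span1 : `[< in_span (rid R 1 : Rec R 1 (strands 1)) >].
Proof.
apply/asboolP; exists 1%N, (fun=> 1), (fun=> fid 1).
by rewrite big_ord1 scale1r /Phi (Phi_word_id _ _ (erefl 1%N)).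
Qed.

Definition Omega_lim : jones_lim := vec (fid 1) (exist _ (rid R 1) in_span1).

Definition Omega : jones_space := \pi_jones_space (cst_seq Omega_lim).

(* The continuous extension of the isometry [pi_lim g]; as it maps Cauchy
   sequences to Cauchy sequences, the default value of [insubd] is never
   used. *)
Definition jones_pi (g : thompson) (x : jones_space) : jones_space :=
  \pi_jones_space (insubd (cst_seq Omega_lim)
    (fun k => pi_lim g (val (repr x) k))).

End JonesRepresentation.

From mathcomp Require Import classical_sets set_interval topology normedtype.
Import numFieldNormedType.Exports.
Local Open Scope classical_set_scope.

(* A drawing in the plane: [arc x y] is only meaningful for adjacent x, y; the
   arcs [arc x y] and [arc y x] represent the same edge and are unrelated. *)
Definition is_drawing (R : realType) (G : sgraph)
    (pos : G -> R * R) (arc : G -> G -> R -> R * R) : Prop :=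
  [/\ injective pos,
      forall x y, adj x y ->
        [/\ {within `[0, 1], continuous (arc x y)},
            {in `[0, 1] &, injective (arc x y)},
            arc x y 0 = pos x & arc x y 1 = pos y],
      forall x y z s, adj x y -> 0 < s < 1 -> arc x y s <> pos z &
      forall x y u v s r, adj x y -> adj u v ->
        (x, y) <> (u, v) -> (x, y) <> (v, u) ->
        0 < s < 1 -> 0 < r < 1 -> arc x y s <> arc u v r].

Definition planar (R : realType) (G : sgraph) : Prop :=
  exists pos arc, @is_drawing R G pos arc.

(* The stabilizer of the vacuum vector at t = delta^2. *)
Definition F_Omega (R : realType) (t : R) : set thompson :=
  [set g | jones_pi g (Omega (Num.sqrt t)) = Omega (Num.sqrt t)].

(* Main.v *)
(*
A planar graph has no K5 minor: along closely sampled arcs, crossing a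
horizontal ray is counted mod 2, and the number of crossings of disjoint edges
of K5 would be both odd and zero. By Mader's argument (contract an edge with
few common neighbours, or find a K4 minor in the neighbourhood of a vertex of
degree at most 5) a graph without K5 minor on n >= 3 vertices has at most
3n - 6 edges, hence a vertex v of degree d <= 5, which can be chosen such that
the rest stays connected. Deletion-contraction of the edges at v gives
P(t) = (t - d) P'(t) + error, the error being a sum of d(d-1)/2 values for
connected graphs with n - 2 vertices; as |t - d| + d(d-1)/(2(t-1)) < t - 1 for
2 <= d <= 5 and t > 4.63, the bound follows by induction, with equality only
for trees.

For the stabilizer, the Temperley-Lieb category is represented faithfully on
tensor powers of C^2, the cup being w e1 e2 + w^-1 e2 e1 with
delta = w^2 + w^-2. There the inner product becomes the l2 product and Phi f
a tensor network, so that Phi is a functor into isometries. The vector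
Phi(s) determines the tree s: its coordinate at the state with all leaves up
but leaf i and all gaps down but gap j is nonzero exactly when the branching at
gap j is an ancestor of leaf i. Since pi(r/s) sends Omega to the vector
Phi(s) in the copy indexed by r, where Omega itself is Phi(r), an element r/s
fixes Omega only if r = s.
*)
Require Import Defs.
From Stdlib Require Import Btauto.
From mathcomp Require Import generic_quotient complex boolp zify ring lra reals.
From mathcomp Require Import interval_inference classical_sets set_interval topology normedtype.
From mathcomp Require Import all_boot all_order all_algebra.
Import numFieldNormedType.Exports.
Import Order.TTheory GRing.Theory Num.Theory.
Set Implicit Arguments.
Unset Strict Implicit.
Unset Printing Implicit Defensive.
Local Open Scope ring_scope.

(** * Planar graphs have no K5 minor *)

(** [is_stack] and [nloops] are defined by connectivity in a glued picture, whereas spin weights are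
    local products. The bridge is to glue matchings once for an arbitrary [model]: the composite
    diagram and the loop exponent are then the same for all weights, and both can be read off in the
    model that merely counts two-colourings. [Phi] goes through an arbitrarily chosen factorization
    and the operations on formal combinations are sums over relations, so functoriality and
    associativity do not come for free. They are checked on matrix entries, which suffices because
    the spin picture is injective on formal combinations, even before the kernel is divided out. For
    delta >= 2 the parameter w can be taken real and positive, so the weights are real and the
    dagger is the conjugate transpose. On the graph side every deletion and contraction stays on one
    vertex type, merged vertices being left behind as isolated points; this is why identities
    between chromatic polynomials carry a spare factor X. *)

Ltac xor_atom a :=
  lazymatch a with
  | addb _ _ => fail | true => fail | false => fail | negb _ => fail
  | _ => let x := fresh in generalize a; intro x; destruct x
  end.

Ltac xor_cases :=
  repeat match goal with
  | |- context [addb ?a ?b] => first [xor_atom a | xor_atom b]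
  end; simpl; try done.

(** * Crossing parities of discrete walks in the plane *)

Section DiscreteWalks.
Variable R : realDomainType.
Implicit Types (p q u v : R * R) (s : seq (R * R)).

(* Does the step from [p] to [q] cross the horizontal ray issued from [u] to
   the right, respectively to the left? The two conventions for points at the
   height of [u] are chosen so that no general position is needed below. *)
Definition hopr p q u := ((p.2 <= u.2) (+) (q.2 <= u.2)) && (u.1 < p.1).
Definition hopl p q u := ((p.2 < u.2) (+) (q.2 < u.2)) && (p.1 < u.1).

(** A horizontal or vertical line strictly separates the two steps. This is the only geometric input
    of the parity argument. *)
Definition separated p q u v :=
  [|| [&& p.1 < u.1, p.1 < v.1, q.1 < u.1 & q.1 < v.1],
      [&& u.1 < p.1, v.1 < p.1, u.1 < q.1 & v.1 < q.1],
      [&& p.2 < u.2, p.2 < v.2, q.2 < u.2 & q.2 < v.2] |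
      [&& u.2 < p.2, v.2 < p.2, u.2 < q.2 & v.2 < q.2]].

(** If a vertical line has p and q on its right, both sides consist of the same four height
    comparisons, the conventions [<=] and [<] being complementary. In the other three positions no
    crossing occurs on either side. *)
Lemma hop_separated p q u v : separated p q u v ->
  hopr p q u (+) hopr p q v = hopl u v p (+) hopl u v q.
Proof.
rewrite /separated /hopr /hopl => /or4P[] /and4P[h1 h2 h3 h4].
- by rewrite (lt_gtF h1) (lt_gtF h2) (lt_gtF h3) !andbF.
- rewrite h1 h2 h3 !andbT !ltNge.
  by case: (p.2 <= u.2); case: (q.2 <= u.2); case: (p.2 <= v.2); case: (q.2 <= v.2).
- by rewrite !ltW // (lt_gtF h1) (lt_gtF h2) (lt_gtF h3) (lt_gtF h4).
- by rewrite h1 h2 h3 h4 !leNgt h1 h2 h3 h4.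
Qed.

(** Ties in height are broken by calling the point further to the right the lower one, so that
    distinct points are always comparable. *)
Definition lower p u := (p.2 < u.2) || (p.2 == u.2) && (u.1 < p.1).

Lemma lower_asym p u : p != u -> lower u p = ~~ lower p u.
Proof.
rewrite /lower -pair_eqE negb_and /= (eq_sym u.2).
by case: (ltgtP p.2 u.2); case: (ltgtP p.1 u.1).
Qed.

(** A step that changes sides of the horizontal line through u passes either left or right of u. *)
Lemma hop_lower p q u v : separated p q u v ->
  hopl p q u = hopr p q u (+) (lower p u (+) lower q u).
Proof.
rewrite /separated /hopr /hopl /lower !le_eqVlt => /or4P[] /and4P[h1 h2 h3 h4].
- by rewrite h1 (lt_gtF h1) (lt_gtF h3) !andbF !orbF andbT.
- rewrite h1 h3 (lt_gtF h1) !andbF !andbT.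
  by rewrite ![in RHS](orbC (_ == _)) addbb.
- by rewrite h1 h3 !orbT.
- by rewrite (lt_gtF h1) (lt_gtF h3) !gt_eqF.
Qed.

Definition steps p s := pairmap pair p s.

Fixpoint windr p s u := if s is q :: s' then hopr p q u (+) windr q s' u else false.
Fixpoint windl p s u := if s is q :: s' then hopl p q u (+) windl q s' u else false.

Definition far p s u s' :=
  allrel (fun a b => separated a.1 a.2 b.1 b.2) (steps p s) (steps u s').

(** Summing [hop_separated] over all pairs of steps cancels every intermediate point of both
    walks. *)
Lemma wind_far p s u s' : far p s u s' ->
  windr p s u (+) windr p s (last u s') = windl u s' p (+) windl u s' (last p s).
Proof.
rewrite /far; elim: s p => [|q s IHs] p /=; first by rewrite addbb.
rewrite allrel_consl => /andP[hq /IHs{}IHs].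
have: hopr p q u (+) hopr p q (last u s') = windl u s' p (+) windl u s' q.
  elim: s' u hq {IHs} => [|v s' IHs'] u /=; first by rewrite addbb.
  by move=> /andP[/hop_separated /= hq /IHs']; move: hq; xor_cases.
by move: IHs; xor_cases.
Qed.

(** The walk issued from u must have a first step: separation from it keeps the other walk away from
    u. *)
Lemma windl_lower p s u s' : s' != [::] -> far p s u s' ->
  windl p s u = windr p s u (+) (lower p u (+) lower (last p s) u).
Proof.
case: s' => // v s' _; rewrite /far; elim: s p => [|q s IHs] p /=; first by rewrite addbb.
rewrite allrel_consl => /andP[/andP[/hop_lower /= -> _] /IHs ->].
by xor_cases.
Qed.

(** The relation [E] is added over the fifteen pairs of disjoint edges. Each [w i j k] occurs once
    for each of the two remaining vertices, hence cancels. After orienting the order terms by [loN],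
    each pair of vertices occurs six times and cancels too, but each of the five quadruples leaves
    nine negations, so the total is [true]. This is the odd crossing parity of K5. *)
Lemma far_K5 (x : 'I_5 -> R * R) (L : 'I_5 -> 'I_5 -> seq (R * R)) :
  injective x ->
  (forall i j, i != j -> L i j != [::] /\ last (x i) (L i j) = x j) ->
  (forall i j k l, uniq [:: i; j; k; l] -> far (x i) (L i j) (x k) (L k l)) ->
  False.
Proof.
move=> xI Lxy Lfar.
pose w i j k := windr (x i) (L i j) (x k).
pose lo i j := lower (x i) (x j).
have loN i j : i != j -> lo j i = ~~ lo i j.
  by move=> ij; rewrite /lo lower_asym // (inj_eq xI).
have E i j k l : uniq [:: i; j; k; l] ->
    addb (addb (addb (w i j k) (w i j l)) (addb (w k l i) (w k l j)))
      (addb (addb (lo k i) (lo l i)) (addb (lo k j) (lo l j))) = false.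
  move=> u4; have fij := Lfar _ _ _ _ u4.
  have u4' : uniq [:: k; l; i; j] by rewrite (uniq_catC [:: k; l] [:: i; j]).
  have fkl := Lfar _ _ _ _ u4'.
  have u4'' : uniq [:: k; l; j; i].
    by move: u4'; rewrite /= !inE !negb_or => /and4P[/and3P[-> -> ->] /andP[-> ->] ij _]; rewrite eq_sym ij.
  have fkl' := Lfar _ _ _ _ u4''.
  have ij : i != j by case/and4P: u4; rewrite !inE !negb_or => /andP[].
  have ji : j != i by rewrite eq_sym.
  have kl : k != l by case/and4P: u4'; rewrite !inE !negb_or => /andP[].
  have [L0 Lj] := Lxy _ _ ij; have [_ Ll] := Lxy _ _ kl.
  have [L0' _] := Lxy _ _ ji.
  have := wind_far fij; rewrite Lj Ll.
  rewrite (windl_lower L0 fkl) (windl_lower L0' fkl') Ll /w /lo.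
  by xor_cases.
pose o m (h : (m < 5)%N) : 'I_5 := Ordinal h.
have e0 := E (o 0 isT) (o 1 isT) (o 2 isT) (o 3 isT) isT.
have e1 := E (o 0 isT) (o 2 isT) (o 1 isT) (o 3 isT) isT.
have e2 := E (o 0 isT) (o 3 isT) (o 1 isT) (o 2 isT) isT.
have e3 := E (o 0 isT) (o 1 isT) (o 2 isT) (o 4 isT) isT.
have e4 := E (o 0 isT) (o 2 isT) (o 1 isT) (o 4 isT) isT.
have e5 := E (o 0 isT) (o 4 isT) (o 1 isT) (o 2 isT) isT.
have e6 := E (o 0 isT) (o 1 isT) (o 3 isT) (o 4 isT) isT.
have e7 := E (o 0 isT) (o 3 isT) (o 1 isT) (o 4 isT) isT.
have e8 := E (o 0 isT) (o 4 isT) (o 1 isT) (o 3 isT) isT.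
have e9 := E (o 0 isT) (o 2 isT) (o 3 isT) (o 4 isT) isT.
have e10 := E (o 0 isT) (o 3 isT) (o 2 isT) (o 4 isT) isT.
have e11 := E (o 0 isT) (o 4 isT) (o 2 isT) (o 3 isT) isT.
have e12 := E (o 1 isT) (o 2 isT) (o 3 isT) (o 4 isT) isT.
have e13 := E (o 1 isT) (o 3 isT) (o 2 isT) (o 4 isT) isT.
have e14 := E (o 1 isT) (o 4 isT) (o 2 isT) (o 3 isT) isT.
have addF a b : a = false -> b = false -> a (+) b = false by move=> -> ->.
have := (addF _ _ e0 (addF _ _ e1 (addF _ _ e2 (addF _ _ e3 (addF _ _ e4 (addF _ _ e5 (addF _ _ e6 (addF _ _ e7 (addF _ _ e8 (addF _ _ e9 (addF _ _ e10 (addF _ _ e11 (addF _ _ e12 (addF _ _ e13 e14)))))))))))))).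
rewrite (@loN (o 0 isT) (o 1 isT)) //.
rewrite (@loN (o 0 isT) (o 2 isT)) //.
rewrite (@loN (o 0 isT) (o 3 isT)) //.
rewrite (@loN (o 0 isT) (o 4 isT)) //.
rewrite (@loN (o 1 isT) (o 2 isT)) //.
rewrite (@loN (o 1 isT) (o 3 isT)) //.
rewrite (@loN (o 1 isT) (o 4 isT)) //.
rewrite (@loN (o 2 isT) (o 3 isT)) //.
rewrite (@loN (o 2 isT) (o 4 isT)) //.
rewrite (@loN (o 3 isT) (o 4 isT)) //.
match goal with |- ?B = false -> _ => have -> : B = true; last by [] end.
have addE (a b : bool) : a (+) b = xorb a b by case: a; case: b.
by rewrite !addE; clear; btauto.
Qed.
End DiscreteWalks.

(** * Uniform separation of disjoint arcs *)

Section Arcs.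
Local Open Scope classical_set_scope.
Variable R : realType.
Implicit Types g h : R -> R * R.

Lemma within_continuous_lt (f : R -> R) (s m : R) :
  {within `[0, 1], continuous f} -> s \in `[0, 1]%R -> f s < m ->
  exists2 e, 0 < e & forall r, r \in `[0, 1]%R -> `|s - r| < e -> f r < m.
Proof.
move=> /subspace_continuousP cf sI fm.
have /= := cf s sI [set y | y < m].
have nb : nbhs (f s) [set y | y < m] by exact: lt_nbhsl.
move=> /(_ nb); rewrite /nbhs /= => /nbhs_ballP[e /= e0 he].
by exists e => // r rI sr; apply: he.
Qed.

Lemma within_continuous_gt (f : R -> R) (s m : R) :
  {within `[0, 1], continuous f} -> s \in `[0, 1]%R -> m < f s ->
  exists2 e, 0 < e & forall r, r \in `[0, 1]%R -> `|s - r| < e -> m < f r.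
Proof.
move=> /subspace_continuousP cf sI fm.
have /= := cf s sI [set y | m < y].
have nb : nbhs (f s) [set y | m < y] by exact: lt_nbhsr.
move=> /(_ nb); rewrite /nbhs /= => /nbhs_ballP[e /= e0 he].
by exists e => // r rI sr; apply: he.
Qed.

Lemma within_continuous_fst g : {within `[0, 1], continuous g} ->
  {within `[0, 1], continuous (fun s => (g s).1)}.
Proof.
by move=> cg s; apply: continuous_comp; [exact: cg|exact: cvg_fst].
Qed.

Lemma within_continuous_snd g : {within `[0, 1], continuous g} ->
  {within `[0, 1], continuous (fun s => (g s).2)}.
Proof.
by move=> cg s; apply: continuous_comp; [exact: cg|exact: cvg_snd].
Qed.

Lemma continuous_separated (f k : R -> R) (s r : R) :
  {within `[0, 1], continuous f} -> {within `[0, 1], continuous k} ->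
  s \in `[0, 1]%R -> r \in `[0, 1]%R -> f s < k r ->
  exists2 e, 0 < e & forall s' r', s' \in `[0, 1]%R -> r' \in `[0, 1]%R ->
    `|s - s'| < e -> `|r - r'| < e -> f s' < k r'.
Proof.
move=> cf ck sI rI /midf_lt [fm mk].
have [e e0 fe] := within_continuous_lt cf sI fm.
have [e' e'0 ke] := within_continuous_gt ck rI mk.
exists (Num.min e e'); first by rewrite lt_min e0 e'0.
move=> s' r' s'I r'I; rewrite !lt_min => /andP[se _] /andP[_ re].
exact: lt_trans (fe _ s'I se) (ke _ r'I re).
Qed.

(** Distinct points differ in a coordinate, and by continuity that strict inequality persists
    nearby. *)
Lemma arcs_locally_separated g h s r :
  {within `[0, 1], continuous g} -> {within `[0, 1], continuous h} ->
  s \in `[0, 1]%R -> r \in `[0, 1]%R -> g s <> h r ->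
  exists2 e, 0 < e & forall s1 s2 r1 r2,
    s1 \in `[0, 1]%R -> s2 \in `[0, 1]%R -> r1 \in `[0, 1]%R -> r2 \in `[0, 1]%R ->
    `|s - s1| < e -> `|s - s2| < e -> `|r - r1| < e -> `|r - r2| < e ->
    separated (g s1) (g s2) (h r1) (h r2).
Proof.
move=> cg ch sI rI /eqP; rewrite -pair_eqE negb_and => gh.
have cg1 := within_continuous_fst cg; have cg2 := within_continuous_snd cg.
have ch1 := within_continuous_fst ch; have ch2 := within_continuous_snd ch.
have [D|D|D|D] : [\/ (g s).1 < (h r).1, (h r).1 < (g s).1,
                     (g s).2 < (h r).2 | (h r).2 < (g s).2].
- by case/orP: gh; rewrite neq_lt => /orP[]; [exact: Or41|exact: Or42|exact: Or43|exact: Or44].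
- have [e e0 He] := continuous_separated cg1 ch1 sI rI D.
  by exists e => // *; apply/or4P/Or41; rewrite !He.
- have [e e0 He] := continuous_separated ch1 cg1 rI sI D.
  by exists e => // *; apply/or4P/Or42; rewrite !He.
- have [e e0 He] := continuous_separated cg2 ch2 sI rI D.
  by exists e => // *; apply/or4P/Or43; rewrite !He.
- have [e e0 He] := continuous_separated ch2 cg2 rI sI D.
  by exists e => // *; apply/or4P/Or44; rewrite !He.
Qed.

Lemma arcs_separated g h :
  {within `[0, 1], continuous g} -> {within `[0, 1], continuous h} ->
  (forall s r, s \in `[0, 1]%R -> r \in `[0, 1]%R -> g s <> h r) ->
  exists N0, forall N, (N0 <= N)%N -> forall s s' r r',
    s \in `[0, 1]%R -> s' \in `[0, 1]%R -> r \in `[0, 1]%R -> r' \in `[0, 1]%R ->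
    `|s - s'| <= N.+1%:R^-1 -> `|r - r'| <= N.+1%:R^-1 ->
    separated (g s) (g s') (h r) (h r').
Proof.
move=> cg ch gh.
pose P (N : nat) (x : R * R) := forall s' r',
  x.1 \in `[0, 1]%R -> x.2 \in `[0, 1]%R -> s' \in `[0, 1]%R -> r' \in `[0, 1]%R ->
    `|x.1 - s'| <= N.+1%:R^-1 -> `|x.2 - r'| <= N.+1%:R^-1 ->
  separated (g x.1) (g s') (h x.2) (h r').
have cI : compact ([set` `[0, 1]%R] : set R) by exact: segment_compact.
(* The near-covering form of compactness turns separation near each parameter pair, for all large N,
   into one N for the whole square. The radius e is halved to leave room for a step of length at
   most 1/(N+1). *)
have := compact_setX cI cI => /compact_near_coveringP/(_ nat \oo P) [].
  move=> [s r] [/= sI rI].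
  have [e e0 He] := arcs_locally_separated cg ch sI rI (gh s r sI rI).
  have e20 : 0 < e / 2 by rewrite divr_gt0.
  have [N0 _ HN] := near_infty_natSinv_lt (PosNum e20).
  exists (ball (s, r) (e / 2), [set N | (N0 <= N)%N]) => /=.
    by split; [exact: nbhsx_ballx|exists N0].
  move=> [[s1 r1] N] /= [[/= bs br] NN0] s2 r2 /= s1I r1I s2I r2I s12 r12.
  have /= HN2 := HN N NN0; move: bs br; rewrite /ball /= => bs br.
  have triv (x y z : R) : `|x - y| < e / 2 -> `|y - z| <= N.+1%:R^-1 ->
      `|x - z| < e /\ `|x - y| < e.
    by move=> h1 h2; rewrite -(subrKA y x); split;
      [rewrite [e]splitr (le_lt_trans (ler_normD _ _)) // ltrD // (le_lt_trans h2)
      |rewrite (lt_trans h1) // ltr_pdivrMr // ltr_pMr // ltr1n].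
  have [h1 h2] := triv _ _ _ bs s12; have [h3 h4] := triv _ _ _ br r12.
  exact: He.
move=> N0 _ HN; exists N0 => N NN s s' r r' sI s'I rI r'I ss rr.
by apply: (HN N NN (s, r)).
Qed.

End Arcs.

(** * Minor models and sampled drawings *)

Definition restrict (T : finType) (B : pred T) (e : rel T) : rel T :=
  [rel x y | [&& B x, B y & e x y]].

(* [psi] maps the vertices of the branch set of [w] to [Some w], the vertices
   deleted from [e] to [None]. *)
Definition minor_model (V W : finType) (e : rel V) (f : rel W) (psi : V -> option W) :=
  (forall w z1 z2, psi z1 = Some w -> psi z2 = Some w ->
     connect (restrict (fun z => psi z == Some w) e) z1 z2) /\
  (forall x y, f x y -> exists a b, [/\ psi a = Some x, psi b = Some y & e a b]).

Definition has_minor (V W : finType) (e : rel V) (f : rel W) :=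
  exists psi, minor_model e f psi.

Definition K5 : rel 'I_5 := fun i j => i != j.

Section PlanarNoK5.
Variables (R : realType) (G : sgraph) (pos : G -> R * R) (arc : G -> G -> R -> R * R).
Hypothesis drawing : is_drawing pos arc.

Definition disjoint_edges (x y u v : G) := [&& x != u, x != v, y != u & y != v].

Lemma arc_disjoint x y u v : adj x y -> adj u v -> disjoint_edges x y u v ->
  forall s r : R, s \in `[0, 1] -> r \in `[0, 1] -> arc x y s <> arc u v r.
Proof.
case: drawing => posI arcs arcV arcE xy uv /and4P[xu xv yu yv] s r sI rI.
have [_ _ x0 y1] := arcs _ _ xy; have [_ _ u0 v1] := arcs _ _ uv.
have ends (z : R) : z \in `[0, 1] -> [\/ z = 0, z = 1 | 0 < z < 1].
  rewrite in_itv /= !le_eqVlt => /andP[/orP[/eqP->|z0]]; first by constructor 1.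
  by case/orP => [/eqP->|z1]; [constructor 2|constructor 3; rewrite z0].
have pI a b : a != b -> pos a <> pos b by move=> /eqP ab /posI.
have [->|->|s01] := ends s sI; have [->|->|r01] := ends r rI;
  rewrite ?x0 ?y1 ?u0 ?v1; try exact: pI.
- by move/esym; exact: arcV.
- by move/esym; exact: arcV.
- exact: arcV.
- exact: arcV.
- by apply: arcE => // -[? ?]; subst; [rewrite eqxx in xu|rewrite eqxx in xv].
Qed.

Lemma arcs_common_separation : exists N, forall x y u v,
  adj x y -> adj u v -> disjoint_edges x y u v ->
  forall s s' r r' : R, s \in `[0, 1] -> s' \in `[0, 1] -> r \in `[0, 1] -> r' \in `[0, 1] ->
    `|s - s'| <= N.+1%:R^-1 -> `|r - r'| <= N.+1%:R^-1 ->
    separated (arc x y s) (arc x y s') (arc u v r) (arc u v r').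
Proof.
pose good (p : (G * G) * (G * G)) N := adj p.1.1 p.1.2 -> adj p.2.1 p.2.2 ->
  disjoint_edges p.1.1 p.1.2 p.2.1 p.2.2 ->
  forall s s' r r' : R, s \in `[0, 1] -> s' \in `[0, 1] -> r \in `[0, 1] -> r' \in `[0, 1] ->
    `|s - s'| <= N.+1%:R^-1 -> `|r - r'| <= N.+1%:R^-1 ->
    separated (arc p.1.1 p.1.2 s) (arc p.1.1 p.1.2 s') (arc p.2.1 p.2.2 r) (arc p.2.1 p.2.2 r').
have /choice[N0 HN0] p : exists N0, forall N, (N0 <= N)%N -> good p N.
  case: p => [[x y] [u v]].
  have [/and3P[/= xy uv d]|] := boolP [&& adj x y, adj u v & disjoint_edges x y u v]; last first.
    by move=> nh; exists 0%N => N _ /= xy uv d; rewrite xy uv d in nh.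
  have [_ arcs _ _] := drawing.
  have [cg _ _ _] := arcs _ _ xy; have [ch _ _ _] := arcs _ _ uv.
  have [N0 HN0] := arcs_separated cg ch (arc_disjoint xy uv d).
  by exists N0 => N /HN0 HN _ _ _.
exists (\max_p N0 p)%N => x y u v.
exact: (HN0 ((x, y), (u, v)) _ (leq_bigmax ((x, y), (u, v)))).
Qed.

(** The starting point is left out, so that samples of consecutive edges concatenate to a walk. *)
Definition samples N x y : seq (R * R) := [seq arc x y (k.+1%:R / N.+1%:R) | k <- iota 0 N.+1].

Fixpoint polyline N x (P : seq G) : seq (R * R) :=
  if P is y :: P' then samples N x y ++ polyline N y P' else [::].

Lemma polyline_cons N x y P : polyline N x (y :: P) = samples N x y ++ polyline N y P.
Proof. by []. Qed.

Lemma last_samples N p x y : adj x y -> last p (samples N x y) = pos y.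
Proof.
case: drawing => _ arcs _ _ /arcs[_ _ _ y1].
by rewrite /samples -[X in iota _ X]addn1 iotaD map_cat last_cat /= add0n divff ?pnatr_eq0.
Qed.

Lemma last_polyline N x P : path (@adj G) x P -> last (pos x) (polyline N x P) = pos (last x P).
Proof.
elim: P x => [//|y P IHP] x /andP[xy yP].
by rewrite polyline_cons last_cat last_samples // IHP.
Qed.

Lemma steps_samples N x y : adj x y ->
  steps (pos x) (samples N x y) =
  [seq (arc x y (k%:R / N.+1%:R), arc x y (k.+1%:R / N.+1%:R)) | k <- iota 0 N.+1].
Proof.
case: drawing => _ arcs _ _ /arcs[_ _ x0 _].
rewrite -x0 -(mul0r N.+1%:R^-1) /samples; set M := N.+1%:R.
rewrite -[0 in LHS]/(0%:R); elim: N.+1 0%N => [|m IHm] i //=.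
by congr (_ :: _); rewrite -IHm.
Qed.

(** Each step of a polyline is a sampling step of one edge with both ends on the path, so
    vertex-disjoint paths only require separation of disjoint edges. *)
Lemma far_polyline N x P u Q :
  (forall x y u v, adj x y -> adj u v -> disjoint_edges x y u v ->
   forall s s' r r' : R, s \in `[0, 1] -> s' \in `[0, 1] -> r \in `[0, 1] -> r' \in `[0, 1] ->
    `|s - s'| <= N.+1%:R^-1 -> `|r - r'| <= N.+1%:R^-1 ->
    separated (arc x y s) (arc x y s') (arc u v r) (arc u v r')) ->
  path (@adj G) x P -> path (@adj G) u Q -> ~~ has [in x :: P] (u :: Q) ->
  far (pos x) (polyline N x P) (pos u) (polyline N u Q).
Proof.
move=> HN.
have stepE y w : path (@adj G) y w -> forall b, b \in steps (pos y) (polyline N y w) ->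
   exists c d k, [/\ adj c d, c \in y :: w, d \in y :: w, (k <= N)%N &
     b = (arc c d (k%:R / N.+1%:R), arc c d (k.+1%:R / N.+1%:R))].
  elim: w y => [//|z w IHw] y /andP[yz /IHw{}IHw] b.
  rewrite polyline_cons /steps pairmap_cat mem_cat -!/(steps _ _) last_samples // => /orP[|/IHw].
    rewrite steps_samples // => /mapP[k]; rewrite mem_iota => /andP[_ kN] ->.
    by exists y, z, k; split; rewrite ?inE ?eqxx ?orbT.
  by case=> c [d [k [cd cw dw kN ->]]]; exists c, d, k; split; rewrite // inE (cw, dw) orbT.
move=> xP uQ dPQ; apply/allrelP => a b.
move=> /(stepE _ _ xP)[c [d [k [cd cP dP kN ->]]]] /(stepE _ _ uQ)[c' [d' [k' [cd' cQ dQ kN' ->]]]] /=.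
have I i : (i <= N.+1)%N -> i%:R / N.+1%:R \in (`[0, 1] : interval R).
  by move=> iN; rewrite in_itv /= divr_ge0 ?ler0n //= ler_pdivrMr ?ltr0n // mul1r ler_nat.
have D i : `|i%:R / N.+1%:R - i.+1%:R / N.+1%:R| <= N.+1%:R^-1 :> R.
  by rewrite -mulrBl -natr1 opprD addNKr normrM normrN1 mul1r ger0_norm ?invr_ge0.
have neq z w : z \in x :: P -> w \in u :: Q -> z != w.
  by move=> zP wQ; apply: contraNneq dPQ => zw; apply/hasP; exists w; rewrite // -zw.
by apply: HN => //; rewrite /disjoint_edges ?neq ?I // ltnW.
Qed.

End PlanarNoK5.

Lemma path_restrict (T : finType) (B : pred T) (e : rel T) x p :
  path (restrict B e) x p -> path e x p && all B p.
Proof. by elim: p x => //= y p IHp x /andP[/and3P[_ -> ->] /IHp]. Qed.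

Lemma planar_no_K5 (R : realType) (G : sgraph) : planar R G -> ~ has_minor (@adj G) K5.
Proof.
move=> [pos [arc drawing]] [psi [conn edge]].
have [posI _ _ _] := drawing.
have /choice[c cP] (i : 'I_5) : exists c, psi c = Some i.
  (* A model does not ask for non-empty branch sets; non-emptiness comes from an edge of K5 at i. *)
  pose j : 'I_5 := if i == ord0 then ord_max else ord0.
  have [|a [_ [aP _ _]]] := edge i j; last by exists a.
  by rewrite /K5 /j; case: (altP (i =P ord0)) => [->|].
(* The path for ij stays in the branch sets of i and j. Paths sharing an index may overlap, and
   those for ij and ji are unrelated; only disjoint index pairs will be compared. *)
have /choice[P HP] (ij : 'I_5 * 'I_5) : exists P, ij.1 != ij.2 ->
    [/\ path (@adj G) (c ij.1) P, P != [::], last (c ij.1) P = c ij.2 &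
        all (fun z => (psi z == Some ij.1) || (psi z == Some ij.2)) (c ij.1 :: P)].
  case: ij => i j /=; have [_|ij] := eqVneq i j; first by exists [::].
  have [a [b [ai bj ab]]] := edge i j ij.
  have /connectP[p1 /path_restrict/andP[p1p p1B] p1l] := conn i (c i) a (cP i) ai.
  have /connectP[p2 /path_restrict/andP[p2p p2B] p2l] := conn j b (c j) bj (cP j).
  exists (p1 ++ b :: p2) => _; split.
  - by rewrite cat_path p1p /= -p1l ab.
  - by case: p1 {p1p p1B p1l}.
  - by rewrite last_cat.
  - rewrite /= cP eqxx /= all_cat /= bj eqxx orbT /=; apply/andP; split.
      by apply: sub_all p1B => z ->.
    by apply: sub_all p2B => z ->; rewrite orbT.
have [N HN] := arcs_common_separation drawing.
apply: (@far_K5 _ (fun i => pos (c i)) (fun i j => polyline arc N (c i) (P (i, j)))).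
- by move=> i j /posI cij; have := cP i; rewrite cij cP => -[].
- move=> i j ij; have [Pp P0 Pl _] := HP (i, j) ij; split; last by rewrite last_polyline ?Pl.
  by move: P0; case: (P (i, j)).
- move=> i j k l; rewrite /= !inE !negb_or => /and4P[/and3P[ij ik il] /andP[jk jl] kl _].
  have [Pp _ _ PB] := HP (i, j) ij; have [Qp _ _ QB] := HP (k, l) kl.
  apply: far_polyline => //; apply/hasPn => z /(allP QB) zQ.
  apply/negP => /(allP PB) zP; move: zP zQ => /= /orP[] /eqP ->;
    by rewrite !(inj_eq (@Some_inj _)) (negPf ik, negPf jk) (negPf il, negPf jl).
Qed.

(** * Edges of graphs without K5 minor *)

Section Minors.
Local Open Scope nat_scope.

Lemma connect_restrict_sub (T : finType) (B B' : pred T) (e e' : rel T) x y :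
  subpred B B' -> subrel e e' ->
  connect (restrict B e) x y -> connect (restrict B' e') x y.
Proof.
move=> BB ee; apply: connect_sub => a b /and3P[Ba Bb ab].
by apply: connect1; apply/and3P; split; [exact: BB|exact: BB|exact: ee].
Qed.

(** Composed branch sets are connected because a walk in f lifts to e, each edge of f being realized
    by an edge of e between two connected sets. *)
Lemma has_minor_trans (U V W : finType) (e : rel U) (f : rel V) (g : rel W) :
  has_minor e f -> has_minor f g -> has_minor e g.
Proof.
move=> [psi [psiC psiE]] [phi [phiC phiE]].
have branch w a b x y : phi x = Some w -> psi a = Some x -> psi b = Some y ->
    connect (restrict (fun z => phi z == Some w) f) x y ->
    connect (restrict (fun z => obind phi (psi z) == Some w) e) a b.
  move=> + + yb /connectP[p]; elim: p x a => [|z p IHp] x a /= xw xa.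
    move=> _ yx; rewrite yx in yb.
    apply: connect_restrict_sub (psiC _ _ _ xa yb) => // c /eqP -> /=.
    by rewrite xw.
  move=> /andP[/and3P[_ zw xz] zp] yl.
  have [c [d [cx dz cd]]] := psiE _ _ xz.
  apply: connect_trans (IHp z d (eqP zw) dz zp yl).
  apply: (@connect_trans _ _ c).
    apply: connect_restrict_sub (psiC _ _ _ xa cx) => // c' /eqP -> /=.
    by rewrite xw.
  by apply: connect1; rewrite /restrict /= cx dz /= xw eqxx zw.
exists (fun z => obind phi (psi z)); split=> [w a b|x y xy].
  case Ea: (psi a) => [x|] //= xw; case Eb: (psi b) => [y|] //= yw.
  exact: branch xw Ea Eb (phiC _ _ _ xw yw).
have [c [d [cx dy cd]]] := phiE _ _ xy; have [a [b [ac bd ab]]] := psiE _ _ cd.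
by exists a, b; rewrite ac bd.
Qed.

Lemma has_minor_sub (V : finType) (e f : rel V) : subrel f e -> has_minor e f.
Proof.
move=> fe; exists Some; split=> [w a b [->] [->] //|x y /fe xy].
by exists x, y.
Qed.

Variable V : finType.
Implicit Types (e : rel V) (A : {set V}).

(* The vertex [w] is merged into [u] and becomes isolated. *)
Definition contract e u w : rel V := fun x y =>
  [&& x != w, y != w, x != y & [|| e x y, (x == u) && e w y | (y == u) && e x w]].

Lemma contract_sym e u w : symmetric e -> symmetric (contract e u w).
Proof.
move=> es x y; rewrite /contract (eq_sym y x) (es y x) (es w x) (es y w) andbCA.
by rewrite [(y == u) && _ || _]orbC.
Qed.

Lemma contract_irr e u w : irreflexive (contract e u w).
Proof. by move=> x; rewrite /contract eqxx !andbF. Qed.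

(** The branch set of u is {u, w} and that of w is empty, which is allowed because w is isolated in
    the contraction. *)
Lemma contract_minor e u w : symmetric e -> e u w -> has_minor e (contract e u w).
Proof.
move=> es uw; exists (fun z => Some (if z == w then u else z)); split.
  move=> z a b [az] [bz].
  pose B := fun c : V => Some (if c == w then u else c) == Some z.
  have step c : Some (if c == w then u else c) = Some z -> connect (restrict B e) c z.
    move=> [cz]; case: (c =P w) cz => [-> uz|_ -> //].
    by apply: connect1; rewrite /restrict /= /B eqxx -uz es uw eqxx if_same eqxx.
  have cs : connect_sym (restrict B e).
    by apply: sym_connect_sym => c d; rewrite /restrict /= es andbCA.
  apply: (@connect_trans _ _ z); first by apply: step; rewrite az.
  by rewrite cs; apply: step; rewrite bz.
move=> x y /and4P[/negPf xw /negPf yw _] /or3P[xy|/andP[/eqP -> wy]|/andP[/eqP -> xw']].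
- by exists x, y; rewrite xw yw.
- by exists w, y; rewrite eqxx yw.
- by exists x, w; rewrite eqxx xw.
Qed.

Definition edges e := [set p : V * V | e p.1 p.2].
Definition nbr e v := [set u | e v u].

Lemma card_edges e : #|edges e| = \sum_v #|nbr e v|.
Proof.
rewrite -sum1_card; under [RHS]eq_bigr => v _ do rewrite -sum1_card.
rewrite pair_big_dep; apply: eq_bigl => -[x y] /=; by rewrite !inE.
Qed.

(** Only the edge uw and the edges from w to common neighbours can be lost; all others embed by
    renaming w to u. Edges are ordered pairs, so each loss counts twice. *)
Lemma card_edges_contract e u w : irreflexive e -> e u w -> symmetric e ->
  #|edges e| <= #|edges (contract e u w)| + (2 * #|nbr e u :&: nbr e w|).+2.
Proof.
move=> ei uw es.
have unw : u != w by apply: contraTneq uw => ->; rewrite ei.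
pose C := u |: (nbr e u :&: nbr e w).
pose D := setX [set w] C :|: setX C [set w].
pose g (p : V * V) := (if p.1 == w then u else p.1, if p.2 == w then u else p.2).
have cD : #|D| <= (2 * #|nbr e u :&: nbr e w|).+2.
  apply: leq_trans (leq_card_setU _ _) _; rewrite !cardsX cards1.
  have : #|C| <= #|nbr e u :&: nbr e w|.+1 by rewrite cardsU1; case: (_ \in _) => //=; lia.
  lia.
rewrite -(cardsID D (edges e)) addnC; apply: leq_add; last first.
  by apply: leq_trans cD; apply: subset_leq_card; rewrite subsetIr.
rewrite -(@card_in_imset _ _ g).
  apply: subset_leq_card; apply/subsetP => _ /imsetP[[x y] + ->]; rewrite !inE /=.
  move=> /andP[]; rewrite !negb_or !negb_and /g /contract /= => xyD xy.
  move: xyD; case: (x =P w) => [xw|/eqP xw]; case: (y =P w) => [yw|/eqP yw] /=.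
  - by move: xy; rewrite xw yw ei.
  - rewrite xw in xy; rewrite orbT andbT negb_or negb_and xy orbF => /andP[yu uy].
    by rewrite unw yw (eq_sym u) yu eqxx orbT.
  - rewrite yw in xy; rewrite orbF negb_or negb_and (es w x) xy /= orbF => /andP[xu ux].
    by rewrite unw xw xu eqxx !orbT.
  - by move=> _; rewrite xw yw xy andbT /=; apply: contraTneq xy => ->; rewrite ei.
have prep x y : (x, y) \in edges e :\: D ->
    [/\ e x y, x = w -> y <> u /\ ~~ e u y & y = w -> x <> u /\ ~~ e u x].
  rewrite !inE /= => /andP[]; rewrite !negb_or !negb_and => /andP[D1 D2] xy.
  split=> //.
    move=> xw; move: D1 xy; rewrite xw eqxx !negb_or !negb_and => /andP[/eqP ? h] wy.
    by move: h; rewrite wy orbF.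
  move=> yw; move: D2 xy; rewrite yw eqxx orbF !negb_or !negb_and => /andP[/eqP ? h].
  by rewrite es => wx; move: h; rewrite wx orbF.
move=> [x y] [x' y'] /prep[xy xw yw] /prep[xy' xw' yw'] []; rewrite /g /=.
have no (P : Prop) z : e z z -> P by rewrite ei.
case: (x =P w) xw => [Ex /(_ Ex)[yu uy]|xnw _]; case: (x' =P w) xw' => [Ex' /(_ Ex')[yu' uy']|xnw' _];
  case: (y =P w) yw => [Ey /(_ Ey)[xu ux]|ynw _]; case: (y' =P w) yw' => [Ey' /(_ Ey')[xu' ux']|ynw' _];
  move=> *; subst => //; try by [exact: no xy|exact: no xy'|rewrite xy' in uy|rewrite xy in uy'|
    rewrite es xy' in ux|rewrite es xy in ux'].
Qed.

End Minors.

(** * The edge bound by Mader's argument *)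

Section EdgeBound.
Local Open Scope nat_scope.
Variable V : finType.
Implicit Types (e : rel V) (A : {set V}).

(* A vertex adjacent to all of a [K_4] minor, one of whose branch sets has the
   two (possibly equal) elements [p] and [q]. *)
Lemma K5_minor_intro e v p q a b c : symmetric e -> irreflexive e ->
  all (e v) [:: p; a; b; c] -> (p == q) || e p q ->
  uniq [:: p; a; b; c] -> q \notin [:: v; a; b; c] ->
  [&& e a b, e b c & e a c] ->
  all (fun z => e p z || e q z) [:: a; b; c] -> has_minor e K5.
Proof.
move=> es ei /and5P[vp va vb vc _] pq.
rewrite /= !inE !negb_or => /and4P[/and3P[pa pb pc] /andP[ab ac] bc _].
move=> /and4P[qv qa qb qc] /and3P[eab ebc eac] /and4P[pqa pqb pqc _].
pose psi z : option 'I_5 :=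
  if z == v then Some (inord 0) else
  if (z == p) || (z == q) then Some (inord 1) else
  if z == a then Some (inord 2) else
  if z == b then Some (inord 3) else
  if z == c then Some (inord 4) else None.
have neq z : e v z -> (z == v) = false by move=> vz; apply: contraTF vz => /eqP ->; rewrite ei.
have Pv : psi v = Some (inord 0) by rewrite /psi eqxx.
have Pp : psi p = Some (inord 1) by rewrite /psi (neq _ vp) eqxx.
have Pq : psi q = Some (inord 1) by rewrite /psi (negPf qv) eqxx orbT.
have Pa : psi a = Some (inord 2).
  by rewrite /psi (neq _ va) (eq_sym a p) (eq_sym a q) (negPf pa) (negPf qa) eqxx.
have Pb : psi b = Some (inord 3).
  rewrite /psi (neq _ vb) (eq_sym b p) (eq_sym b q) (negPf pb) (negPf qb).
  by rewrite (eq_sym b a) (negPf ab) eqxx.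
have Pc : psi c = Some (inord 4).
  rewrite /psi (neq _ vc) (eq_sym c p) (eq_sym c q) (negPf pc) (negPf qc).
  by rewrite (eq_sym c a) (negPf ac) (eq_sym c b) (negPf bc) eqxx.
exists psi; split=> [w z1 z2|].
  have H z : psi z = Some w ->
      (z = p \/ z = q) /\ w = inord 1 \/ z = nth v [:: v; p; a; b; c] w /\ w != inord 1.
    have o1 k : k < 5 -> k != 1 -> (inord k : 'I_5) != inord 1 by move=> *; rewrite -val_eqE /= !inordK.
    rewrite /psi; case: eqP => [-> [<-]|_]; first by right; rewrite inordK ?o1.
    case: eqP => [-> [<-]|_] /=; first by left; split; [left|].
    case: eqP => [-> [<-]|_] /=; first by left; split; [right|].
    case: eqP => [-> [<-]|_]; first by right; rewrite inordK ?o1.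
    case: eqP => [-> [<-]|_]; first by right; rewrite inordK ?o1.
    by case: eqP => [-> [<-]|_] //; right; rewrite inordK ?o1.
  move=> /H[[h1 w1]|[-> w1]] /H[[h2 w2]|[-> w2]] //; rewrite ?w1 ?eqxx // in w2 *.
    case/orP: pq => [/eqP pq|pq]; first by move: h1 h2; rewrite -pq => -[->|->] [->|->].
    by case: h1 h2 => [->|->] [->|->] //; apply: connect1; rewrite /restrict /= Pp Pq eqxx // es.
  by rewrite w2 eqxx in w1.
pose adjacent i j := exists x y, [/\ psi x = Some i, psi y = Some j & e x y].
have adjC i j : adjacent i j -> adjacent j i.
  by move=> [x [y [xi yj xy]]]; exists y, x; rewrite es.
have pqadj z k : psi z = Some k -> e p z || e q z -> adjacent (inord 1) k.
  by move=> zk /orP[pz|qz]; [exists p, z|exists q, z].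
suff wl (i j : 'I_5) : i < j -> adjacent i j.
  by move=> i j; rewrite /K5 -val_eqE neq_ltn => /orP[/wl|/wl/adjC].
have oE (k : 'I_5) n : val k = n -> k = inord n by move=> <-; rewrite inord_val.
case: i => -[|[|[|[|[|i]]]]] // hi; case: j => -[|[|[|[|[|j]]]]] // hj _;
  rewrite (oE (Ordinal hi) _ erefl) (oE (Ordinal hj) _ erefl) /=;
  do ?[exact: pqadj Pa pqa|exact: pqadj Pb pqb|exact: pqadj Pc pqc].
- by exists v, p.
- by exists v, a.
- by exists v, b.
- by exists v, c.
- by exists a, b.
- by exists a, c.
- by exists b, c.
Qed.

(* On five vertices of degree at least three, contracting a suitable edge
   leaves a complete graph. *)
Lemma five_vertices_K4 (r : nat -> nat -> bool) :
  (forall i j, r i j = r j i) ->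
  (forall i, r i i = false) -> (forall i, i < 5 -> 3 <= count (r i) (iota 0 5)) ->
  exists s, [/\ perm_eq s (iota 0 5), r (nth 0 s 0) (nth 0 s 1),
    all (fun z => r (nth 0 s 0) z || r (nth 0 s 1) z) (drop 2 s) &
    [&& r (nth 0 s 2) (nth 0 s 3), r (nth 0 s 3) (nth 0 s 4) & r (nth 0 s 2) (nth 0 s 4)]].
Proof.
move=> rs ri deg.
have := deg 0 isT; have := deg 1 isT; have := deg 2 isT; have := deg 3 isT; have := deg 4 isT.
rewrite /= !ri.
rewrite (rs 4 0) (rs 4 1) (rs 4 2) (rs 4 3) (rs 3 0) (rs 3 1) (rs 3 2) (rs 2 0) (rs 2 1) (rs 1 0).
pose good s := [&& perm_eq s (iota 0 5), r (nth 0 s 0) (nth 0 s 1),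
    all (fun z => r (nth 0 s 0) z || r (nth 0 s 1) z) (drop 2 s) &
    [&& r (nth 0 s 2) (nth 0 s 3), r (nth 0 s 3) (nth 0 s 4) & r (nth 0 s 2) (nth 0 s 4)]].
move=> d4 d3 d2 d1 d0.
suff /hasP[s _ /and4P[? ? ? ?]] : has good [:: [:: 0; 1; 2; 3; 4]; [:: 0; 2; 1; 3; 4];
   [:: 0; 3; 1; 2; 4]; [:: 0; 4; 1; 2; 3]; [:: 1; 2; 0; 3; 4]; [:: 1; 3; 0; 2; 4];
   [:: 1; 4; 0; 2; 3]; [:: 2; 3; 0; 1; 4]; [:: 2; 4; 0; 1; 3]; [:: 3; 4; 0; 1; 2]].
  by exists s.
rewrite /good /= (rs 2 1) (rs 3 1) (rs 3 2) (rs 4 1) (rs 4 2) (rs 4 3) (rs 1 0) (rs 2 0) (rs 3 0) (rs 4 0).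
by move: d4 d3 d2 d1 d0; case: (r 0 1); case: (r 0 2); case: (r 0 3); case: (r 0 4);
  case: (r 1 2); case: (r 1 3); case: (r 1 4); case: (r 2 3); case: (r 2 4); case: (r 3 4).
Qed.

(** The actual vertex set of a symmetric relation e: the vertices outside A are isolated leftovers
    of deletions and contractions. *)
Definition supported e A := forall x y, e x y -> x \in A.

Lemma supportedr e A x y : symmetric e -> supported e A -> e x y -> y \in A.
Proof. by move=> es eA; rewrite es; exact: eA. Qed.

Lemma card_edges_supported e A : supported e A -> #|edges e| = \sum_(v in A) #|nbr e v|.
Proof.
move=> eA; rewrite card_edges [RHS]big_mkcond; apply: eq_bigr => v _.
case: ifPn => // vA; apply/eqP; rewrite cards_eq0 -subset0; apply/subsetP => u.
by rewrite inE => /eA; rewrite (negPf vA).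
Qed.

Lemma nbr_sub e A v : symmetric e -> irreflexive e -> supported e A -> nbr e v \subset A :\ v.
Proof.
move=> es ei eA; apply/subsetP => u; rewrite !inE => vu.
rewrite (supportedr es eA vu) andbT.
by apply: contraTneq vu => ->; rewrite ei.
Qed.

Lemma card_nbr e A v : symmetric e -> irreflexive e -> supported e A -> v \in A ->
  #|nbr e v| <= #|A|.-1.
Proof.
move=> es ei eA vA; apply: leq_trans (subset_leq_card (nbr_sub v es ei eA)) _.
by rewrite [#|A|](cardsD1 v) vA.
Qed.

(** The neighbourhood of v has minimal degree at least three. On four vertices it is K4, on five an
    edge contracts to K4, and v completes it to K5. *)
Lemma K5_minor_of_nbr e v : symmetric e -> irreflexive e ->
  0 < #|nbr e v| <= 5 -> (forall u, e v u -> 3 <= #|nbr e v :&: nbr e u|) ->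
  has_minor e K5.
Proof.
move=> es ei /andP[n0 n5] deg.
pose s := enum (nbr e v).
have su : uniq s by exact: enum_uniq.
have sE u : (u \in s) = e v u by rewrite mem_enum inE.
have sn : size s = #|nbr e v| by rewrite -cardE.
have degs u : u \in s -> 3 <= count (e u) s.
  rewrite sE => vu; have := deg u vu; rewrite -size_filter.
  rewrite -(card_uniqP (filter_uniq (e u) su)).
  by congr (_ <= _); apply: eq_card => w; rewrite !inE mem_filter sE andbC.
have sv u : u \in s -> e v u by rewrite sE.
have vs : v \notin s by rewrite sE ei.
have s4 : 4 <= size s.
  have /card_gt0P[u] := n0; rewrite -[_ \in _]mem_enum -/s => us.
  rewrite (perm_size (perm_to_rem us)) /= ltnS; apply: leq_trans (count_size (e u) _).
  by have := degs u us; rewrite (permP (perm_to_rem us)) /= ei.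
have [s5|s5] := eqVneq (size s) 5.
  pose r i j := e (nth v s i) (nth v s j).
  have sE5 : s = [seq nth v s i | i <- iota 0 5] by rewrite -s5 map_nth_iota0 // take_size.
  have [||i i5|t [pt t01 tall t234]] := @five_vertices_K4 r.
  - by move=> i j; rewrite /r es.
  - by move=> i; rewrite /r ei.
  - have := degs (nth v s i); rewrite mem_nth ?s5 // => /(_ isT).
    by rewrite {2}sE5 count_map.
  have t5 i : i < 5 -> nth 0 t i < 5.
    by move=> i5; have := mem_nth 0 (n := i) (s := t); rewrite (perm_size pt) => /(_ i5); rewrite (perm_mem pt) mem_iota.
  pose n i := nth v s (nth 0 t i).
  have nI i j : i < 5 -> j < 5 -> i != j -> n i != n j.
    move=> i5 j5 ij; rewrite /n nth_uniq ?s5 ?t5 // nth_uniq ?(perm_size pt) //.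
    by rewrite (perm_uniq pt) iota_uniq.
  have ns i : i < 5 -> n i \in s by move=> i5; rewrite mem_nth ?s5 ?t5.
  have tE : drop 2 t = [:: nth 0 t 2; nth 0 t 3; nth 0 t 4].
    by have := perm_size pt; case: (t) => [|? [|? [|? [|? [|? []]]]]].
  apply: (@K5_minor_intro e v (n 0) (n 1) (n 2) (n 3) (n 4)) => //.
  - by rewrite /= !sv ?ns.
  - by rewrite orbC (_ : e _ _).
  - by rewrite /= !inE !negb_or !nI.
  - by rewrite !inE !negb_or !nI //= andbT; apply: contraNneq vs => <-; rewrite ns.
  - by move: tall; rewrite tE.
move: s4 s5 n5; rewrite -sn.
case: (s) su degs sv => [|a [|b [|c [|d [|? [|? ?]]]]]] //= su degs sv _ _ _.
have := degs a; have := degs b; have := degs c; rewrite !inE !eqxx !orbT => /(_ isT) + /(_ isT) + /(_ isT).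
rewrite !ei (es b a) (es c a) (es c b) => dc db da.
have ab : e a b by move: da; case: (e a b); case: (e a c); case: (e a d).
have ac : e a c by move: da; case: (e a b); case: (e a c); case: (e a d).
have ad : e a d by move: da; case: (e a b); case: (e a c); case: (e a d).
have bc : e b c by move: db; case: (e a b); case: (e b c); case: (e b d).
have bd : e b d by move: db; case: (e a b); case: (e b c); case: (e b d).
have cd : e c d by move: dc; case: (e a c); case: (e b c); case: (e c d).
apply: (@K5_minor_intro e v a a b c d) => //; rewrite ?eqxx //.
- by rewrite /= !sv ?inE ?eqxx ?orbT.
- move: su => /andP[]; rewrite !inE !negb_or => -> _; rewrite andbT.
  by apply: contraTneq (sv a (mem_head _ _)) => ->; rewrite ei.
- by rewrite bc cd bd.
- by rewrite /= ab ac ad.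
Qed.

(** With ordered pairs the bound is twice 3n - 6. The measure is lexicographic in the numbers of
    vertices and edges. Contracting an edge with at most two common neighbours costs at most six
    ordered pairs, exactly what the bound grants for one vertex. *)
Lemma K5_minor_free_edges e A : symmetric e -> irreflexive e -> supported e A ->
  3 <= #|A| -> ~ has_minor e K5 -> #|edges e| + 12 <= 6 * #|A|.
Proof.
have [m] := ubnP (#|A| * (#|V| * #|V|).+1 + #|edges e|).
elim: m e A => // m IHm e A; rewrite ltnS => mA es ei eA A3 nK5.
rewrite leqNgt; apply/negP => lt6.
have shrink (f : rel V) (B : {set V}) : #|A| = #|B|.+1 -> #|B| * (#|V| * #|V|).+1 + #|edges f| < m.
  move=> AB; apply: leq_trans mA; rewrite AB mulSn.
  have : #|edges f| <= #|V| * #|V| by rewrite -card_prod max_card.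
  lia.
have A4 : 4 <= #|A|.
  rewrite ltn_neqAle A3 andbT; apply: contraL lt6 => /eqP E3.
  have : \sum_(v in A) #|nbr e v| <= \sum_(v in A) 2.
    by apply: leq_sum => v vA; have := card_nbr es ei eA vA; rewrite -E3.
  rewrite sum_nat_const -E3 -(card_edges_supported eA) => le6.
  by rewrite -leqNgt (leq_add2r 12 _ 6).
(* As long as there are 6n ordered edges or more, one edge is deleted; afterwards the average degree
   is below six and a vertex of degree at most five exists. *)
have [E6|E6] := leqP (6 * #|A|) #|edges e|.
  have /card_gt0P[[u w]] : 0 < #|edges e| by lia.
  rewrite inE /= => uw.
  have unw : u != w by apply: contraTneq uw => ->; rewrite ei.
  pose f : rel V := fun x y => e x y && ((x, y) != (u, w)) && ((x, y) != (w, u)).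
  have fe : subrel f e by move=> x y /andP[/andP[]].
  have fE : edges f = edges e :\ (u, w) :\ (w, u).
    by apply/setP => -[x y]; rewrite !inE /f /= andbC [in RHS](andbC _ (e x y)).
  have cE : #|edges e| = (#|edges f|).+2.
    rewrite fE (cardsD1 (u, w)) inE uw (cardsD1 (w, u)) !inE /= es uw.
    by rewrite -pair_eqE /= negb_and (eq_sym w) unw.
  have fs : symmetric f.
    by move=> x y; rewrite /f (es y x) -!pair_eqE /= ![(x == _) && _]andbC -!andbA; congr andb; rewrite andbC.
  have fi : irreflexive f by move=> x; rewrite /f ei.
  have fA : supported f A by move=> x y /fe /eA.
  have nf : ~ has_minor f K5 by move=> h; apply: nK5; apply: has_minor_trans h; exact: has_minor_sub.
  by have := IHm f A _ fs fi fA A3 nf; rewrite cE in mA E6; lia.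
have [v vA v5] : exists2 v, v \in A & #|nbr e v| <= 5.
  apply/exists_inP; apply: contraLR E6; rewrite negb_exists_in => /forall_inP h.
  rewrite -leqNgt (card_edges_supported eA) mulnC -sum_nat_const.
  by apply: leq_sum => v /h; rewrite -ltnNge.
have cA : #|A| = (#|A :\ v|).+1 by rewrite (cardsD1 v) vA.
have [n0|n0] := posnP #|nbr e v|.
  have n0' u : e v u = false by have := cards0_eq n0 => /setP/(_ u); rewrite !inE.
  have eA' : supported e (A :\ v).
    by move=> x y xy; rewrite !inE (eA _ _ xy) andbT; apply: contraTneq xy => ->; rewrite n0'.
  have := IHm e (A :\ v) (shrink _ _ cA) es ei eA' _ nK5; lia.
have [/existsP[u /andP[vu k2]]|no] := boolP [exists u, e v u && (#|nbr e v :&: nbr e u| <= 2)].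
  have uA := supportedr es eA vu.
  have cA' : #|A| = (#|A :\ u|).+1 by rewrite (cardsD1 u) uA.
  have sup : supported (contract e v u) (A :\ u).
    move=> x y /and4P[xu _ _ h]; rewrite !inE xu /=.
    by case/or3P: h => [/eA //|/andP[/eqP -> _] //|/andP[_ /eA]].
  have nc : ~ has_minor (contract e v u) K5.
    by move=> h; apply: nK5; apply: has_minor_trans h; exact: contract_minor.
  have := IHm _ _ (shrink _ _ cA') (contract_sym v u es) (@contract_irr _ e v u) sup _ nc.
  have := card_edges_contract ei vu es; lia.
apply: nK5; apply: (@K5_minor_of_nbr e v) => //; first by rewrite n0.
move=> u vu; rewrite ltnNge; apply: contra no => k2.
by apply/existsP; exists u; rewrite vu.
Qed.

End EdgeBound.

(** * A vertex of low degree that does not disconnect *)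

Section NonCutVertex.
Local Open Scope nat_scope.
Variable V : finType.
Implicit Types (e : rel V) (A S : {set V}).

Definition connected_on e A := {in A &, forall x y, connect e x y}.
Definition remove e v : rel V := restrict (predC1 v) e.

Lemma remove_sym e v : symmetric e -> symmetric (remove e v).
Proof. by move=> es x y; rewrite /remove /restrict /= es andbCA. Qed.

Lemma remove_irr e v : irreflexive e -> irreflexive (remove e v).
Proof. by move=> ei x; rewrite /remove /restrict /= ei !andbF. Qed.

Lemma remove_supported e v A : supported e A -> supported (remove e v) (A :\ v).
Proof. by move=> eA x y /and3P[xv _ /eA xA]; apply/setD1P. Qed.

(** The vertex w is the only one through which a walk can leave S. *)
Definition outlet e A S w :=
  [/\ S \subset A, w \in A :\: S & forall x y, x \in S -> e x y -> y \in w |: S].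

(** If all vertices of S had degree at least six, the subgraph on [w |: S] would have at least 6|S|
    ordered edges, against the bound 6(|S| + 1) - 12. *)
Lemma outlet_low_degree e A S w : symmetric e -> irreflexive e -> ~ has_minor e K5 ->
  outlet e A S w -> S != set0 -> exists2 v, v \in S & #|nbr e v| <= 5.
Proof.
move=> es ei nK [SA wAS out] S0.
have wS : w \notin S by move: wAS; rewrite inE => /andP[].
have [S1|S2] := leqP #|S| 1.
  have /set0Pn[v vS] := S0; exists v => //.
  have : nbr e v \subset w |: S by apply/subsetP => u; rewrite inE => /(out _ _ vS).
  move=> /subset_leq_card/leq_trans; apply; rewrite cardsU1 wS /=.
  by apply: leq_trans (_ : 1 + 1 <= _); rewrite ?leq_add2l.
apply/exists_inP; apply: contraT; rewrite negb_exists_in => /forall_inP deg6.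
pose f := restrict [in w |: S] e.
have fs : symmetric f by move=> x y; rewrite /f /restrict /= es andbCA.
have fi : irreflexive f by move=> x; rewrite /f /restrict /= ei !andbF.
have fA : supported f (w |: S) by move=> x y /and3P[].
have fe : subrel f e by move=> x y /and3P[].
have nf : ~ has_minor f K5 by move=> h; apply: nK; apply: has_minor_trans h; exact: has_minor_sub.
have c3 : #|w |: S| = #|S|.+1 by rewrite cardsU1 wS.
have := K5_minor_free_edges fs fi fA _ nf; rewrite c3 => /(_ S2).
rewrite (card_edges_supported fA) (big_setU1 _ wS) /=.
suff : \sum_(v in S) 6 <= \sum_(v in S) #|nbr f v| by rewrite sum_nat_const; lia.
apply: leq_sum => v vS; have := deg6 v vS; rewrite -ltnNge => /leq_trans; apply.
apply: subset_leq_card; apply/subsetP => u; rewrite !inE /f /restrict /= => vu.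
by have := out _ _ vS vu; rewrite !inE vS orbT vu => ->.
Qed.

(** Descent on S: if some v in S is a cut vertex, a component of A - v missing w is a smaller part
    with outlet v. Once no vertex of S cuts, the one of low degree in S serves. *)
Lemma noncut_low_degree e A : symmetric e -> irreflexive e -> supported e A ->
  ~ has_minor e K5 -> connected_on e A -> 2 <= #|A| ->
  exists v, [/\ v \in A, #|nbr e v| <= 5 & connected_on (remove e v) (A :\ v)].
Proof.
move=> es ei eA nK conn A2.
suff main m S w : #|S| < m -> outlet e A S w -> S != set0 ->
    exists v, [/\ v \in A, #|nbr e v| <= 5 & connected_on (remove e v) (A :\ v)].
  have [w wA] : exists w, w \in A by apply/card_gt0P; lia.
  have cA : #|A| = #|A :\ w|.+1 by rewrite (cardsD1 w) wA.
  apply: (main _ (A :\ w) w (ltnSn _)); last by rewrite -card_gt0; lia.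
  split; first exact: subsetDl; first by rewrite !inE eqxx.
  by move=> x y xS xy; rewrite !inE (supportedr es eA xy) andbT orbN.
elim: m S w => // m IHm S w; rewrite ltnS => Sm outS S0.
have [SA wAS out] := outS.
have [wS wA] : w \notin S /\ w \in A by move: wAS; rewrite inE => /andP[].
have [cut|noncut] := pselect (exists2 v, v \in S & ~ connected_on (remove e v) (A :\ v)); last first.
  have [v vS v5] := outlet_low_degree es ei nK outS S0.
  exists v; split => //; first exact: (subsetP SA).
  by apply: contrapT => nc; apply: noncut; exists v.
case: cut => v vS nconn; pose h := remove e v.
have vA := subsetP SA v vS.
have hc : connect_sym h by apply: sym_connect_sym; exact: remove_sym.
have [z zA zw] : exists2 z, z \in A :\ v & ~~ connect h z w.
  apply: contrapT => no; apply: nconn => x y xA yA.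
  have H z : z \in A :\ v -> connect h z w.
    by move=> zA; apply: contrapT => /negP nz; apply: no; exists z.
  by apply: connect_trans (H x xA) _; rewrite hc H.
pose C := [set c | connect h z c].
have zC : z \in C by rewrite inE.
have CA : C \subset A :\ v.
  apply/subsetP => c; rewrite inE => /connectP[p]; elim: p z zA {zw C zC} => [|y p IHp] x xA /=.
    by move=> _ ->.
  move=> /andP[xy yp] yl; apply: IHp yp yl.
  by move/and3P: xy => [_ yv xy]; apply/setD1P; rewrite (supportedr es eA xy).
have vC : v \notin C by apply/negP => /(subsetP CA); rewrite !inE eqxx.
have outC x y : x \in C -> e x y -> y != v -> y \in C.
  rewrite !inE => zx xy yv; apply: (connect_trans zx (connect1 _)).
  apply/and3P; split=> //=; apply/eqP => xv.
  by rewrite inE -xv zx in vC.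
have [c cC cv] : exists2 c, c \in C & e c v.
  apply: contrapT => no.
  have walk p x : x \in C -> path e x p -> last x p != v.
    elim: p x => [|y p IHp] x xC /=; first by move=> _; apply: contraNneq vC => <-.
    move=> /andP[xy yp]; apply: IHp yp; apply: (outC x y xC xy).
    by apply/eqP => yv; apply: no; exists x; rewrite // -yv.
  have /connectP[p zp /esym/eqP] := conn z v (subsetP (subsetDl _ _) _ zA) vA.
  by rewrite (negPf (walk p z zC zp)).
(* C contains a neighbour of v that lies in S, and a walk inside C could only leave S through w,
   which is not in C. *)
have CS : C \subset S.
  have cS : c \in S.
    have := out v c vS; rewrite es cv => /(_ isT); rewrite !inE => /orP[/eqP cw|//].
    by move: zw; rewrite -cw; move: cC; rewrite inE => ->.
  have closedC x y : x \in C -> x \in S -> h x y -> y \in S.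
    move=> xC xS /and3P[_ _ xy]; have := out x y xS xy; rewrite !inE => /orP[/eqP yw|//].
    have : y \in C by apply: (outC x y xC xy); rewrite yw; apply: contraNneq wS => ->.
    by rewrite inE yw (negPf zw).
  apply/subsetP => x xC; have : connect h c x.
    by move: cC xC; rewrite !inE hc => cz zx; exact: connect_trans cz zx.
  move=> /connectP[p]; elim: p c cC cS {cv} => [|y p IHp] c cC cS /=; first by move=> _ ->.
  move=> /andP[cy yp]; apply: (IHp y) => //; last exact: closedC cy.
  by have /and3P[_ yv ey] := cy; apply: outC ey yv.
apply: (IHm C v); last by apply/set0Pn; exists z.
  apply: leq_trans Sm; apply: proper_card; apply/properP; split=> //; by exists v.
split; first exact: subset_trans CS SA; first by rewrite inE vC.
by move=> x y xC xy; rewrite in_setU1; have [//|yv] := eqVneq y v; exact: outC xC xy yv.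
Qed.

End NonCutVertex.

(** * The chromatic polynomial bound *)

Lemma poly_eq_nat (R : numDomainType) (p q : {poly R}) :
  (forall k : nat, p.[k%:R] = q.[k%:R]) -> p = q.
Proof.
move=> pq; apply/eqP; rewrite -subr_eq0; apply/eqP.
apply: (@roots_geq_poly_eq0 _ _ [seq k%:R | k <- iota 0 (size (p - q))]).
- by apply/allP => _ /mapP[k _ ->]; rewrite /root !hornerE pq subrr.
- by rewrite map_inj_uniq ?iota_uniq // => i j /eqP; rewrite eqr_nat => /eqP.
- by rewrite size_map size_iota.
Qed.

(** * Deletion and contraction on a fixed vertex type *)

Section DeletionContraction.
Variables (R : realType) (V : finType).
Implicit Types e h : rel V.

Definition chi e : {poly R} :=
  \sum_(P : {set {set V}} | partition P [set: V]%SET &&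
      [forall B in P, [forall x in B, forall y in B, ~~ e x y]])
    \prod_(i < #|P|) ('X - (i%:R)%:P).

Definition colorings e k : {set {ffun V -> 'I_k}} :=
  [set f : {ffun V -> 'I_k} | [forall x, forall y, e x y ==> (f x != f y)]].

Lemma coloringsP e k (f : {ffun V -> 'I_k}) :
  reflect (forall x y, e x y -> f x != f y) (f \in colorings e k).
Proof.
rewrite inE; apply: (iffP forallP) => [H x y xy|H x]; last first.
  by apply/forallP => y; apply/implyP; exact: H.
by have /forallP/(_ y)/implyP := H x; apply.
Qed.

Lemma chi_nat e k : symmetric e -> irreflexive e -> (chi e).[k%:R] = #|colorings e k|%:R.
Proof. by move=> es ei; rewrite -[chi e]/(chromatic_poly R (SGraph es ei)) chromatic_polyP. Qed.

Definition add_edge e u w : rel V := fun x y =>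
  [|| e x y, (x == u) && (y == w) | (x == w) && (y == u)].

Lemma add_edge_sym e u w : symmetric e -> symmetric (add_edge e u w).
Proof. by move=> es x y; rewrite /add_edge es [in RHS](orbC (_ && _)) ![(y == _) && _]andbC. Qed.

Lemma add_edge_irr e u w : u != w -> irreflexive e -> irreflexive (add_edge e u w).
Proof.
move=> uw ei x; rewrite /add_edge ei /= andbC orbb; apply/andP => -[/eqP -> /eqP E].
by rewrite E eqxx in uw.
Qed.

Lemma colorings_split e u w k :
  #|colorings e k| =
  (#|colorings (add_edge e u w) k| + #|[set f in colorings e k | f u == f w]|)%N.
Proof.
rewrite -(cardsID [set f : {ffun V -> 'I_k} | f u == f w] (colorings e k)) addnC.
congr (_ + _)%N; last by apply: eq_card => f; rewrite !inE andbC.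
apply: eq_card => f; rewrite in_setD [in LHS]inE; apply/andP/coloringsP.
  move=> [uw /coloringsP fP] x y /or3P[/fP //|/andP[/eqP -> /eqP ->]//|/andP[/eqP -> /eqP ->]].
  by rewrite eq_sym.
move=> H; split; first by apply: H; rewrite /add_edge !eqxx orbT.
by apply/coloringsP => x y xy; apply: H; rewrite /add_edge xy.
Qed.

(** The factor k is the free colour of w, isolated in the contraction. *)
Lemma colorings_contract e u w k : symmetric e -> irreflexive e -> u != w -> ~~ e u w ->
  #|colorings (contract e u w) k| = (k * #|[set f in colorings e k | f u == f w]|)%N.
Proof.
move=> es ei uw nuw; rewrite mulnC -[X in (_ * X)%N](card_ord k) -cardsT -cardsX.
pose g (p : {ffun V -> 'I_k} * 'I_k) := [ffun z => if z == w then p.2 else p.1 z].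
have gI : {in setX [set f in colorings e k | f u == f w] [set: 'I_k]%SET &, injective g}.
  move=> [f c] [f' c']; rewrite !inE /= !andbT => /andP[_ /eqP fuw] /andP[_ /eqP fuw'] /ffunP H.
  have ff z : z != w -> f z = f' z by move=> zw; have := H z; rewrite !ffunE (negPf zw).
  have cc : c = c' by have := H w; rewrite !ffunE eqxx.
  congr pair => //; apply/ffunP => z; have [->|] := eqVneq z w; last exact: ff.
  by rewrite -fuw -fuw' ff.
rewrite -(card_in_imset gI).
apply: eq_card => f; apply/coloringsP/imsetP => [H|[[f' c]]].
  exists ([ffun z => if z == w then f u else f z], f w); last first.
    by apply/ffunP => z; rewrite !ffunE /=; case: eqP => [->|].
  rewrite in_setX in_setT andbT inE !ffunE eqxx (negPf uw) eqxx andbT.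
  apply/coloringsP => x y xy; rewrite !ffunE.
  have xny : x != y by apply: contraTneq xy => ->; rewrite ei.
  case: (x =P w) => [xw|/eqP xw]; case: (y =P w) => [yw|/eqP yw].
  - by rewrite xw yw ei in xy.
  - apply: H; rewrite /contract uw yw eqxx -xw xy orbT andbT /=.
    by apply: contraNneq nuw => ->; rewrite es -xw.
  - apply: H; rewrite /contract uw xw eqxx -yw (es y) xy !orbT andbT /=.
    by apply: contraNneq nuw => <-; rewrite -yw.
  - by apply: H; rewrite /contract xw yw xny xy.
rewrite in_setX in_setT andbT inE => /andP[/coloringsP H /eqP fuw] -> x y.
rewrite /contract !ffunE => /and4P[/negPf -> /negPf -> xny /or3P[/H //|/andP[/eqP -> /H]|/andP[/eqP -> /H]]].
  by rewrite fuw.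
by rewrite fuw.
Qed.

(** Deletion-contraction, read from the graph without the edge. The factor 'X on the other terms
    compensates the isolated vertex of the contraction. *)
Lemma chi_contract e u w : symmetric e -> irreflexive e -> u != w -> ~~ e u w ->
  'X * chi e = 'X * chi (add_edge e u w) + chi (contract e u w).
Proof.
move=> es ei uw nuw; apply: poly_eq_nat => k; rewrite hornerD !hornerM hornerX.
rewrite (chi_nat _ es ei) (chi_nat _ (add_edge_sym u w es) (add_edge_irr uw ei)).
rewrite (chi_nat _ (contract_sym u w es) (@contract_irr _ e u w)).
rewrite (colorings_split e u w) colorings_contract //.
by rewrite natrD natrM mulrDr.
Qed.

Lemma chi_empty e : (forall x y, ~~ e x y) -> chi e = 'X^#|V|.
Proof.
move=> e0; have es : symmetric e by move=> x y; rewrite !(negPf (e0 _ _)).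
have ei : irreflexive e by move=> x; rewrite (negPf (e0 _ _)).
apply: poly_eq_nat => k; rewrite chi_nat // hornerXn -natrX -[in RHS](card_ord k) -card_ffun.
rewrite -cardsT; congr (_%:R); apply: eq_card => f; rewrite [RHS]inE.
by apply/coloringsP => x y; rewrite (negPf (e0 x y)).
Qed.

Definition star h u (s : seq V) : rel V := fun x y =>
  [|| h x y, (x == u) && (y \in s) | (y == u) && (x \in s)].

Lemma star_nil h u : star h u [::] = h.
Proof. by apply/funext => x; apply/funext => y; rewrite /star !in_nil !andbF !orbF. Qed.

Lemma star_sym h u s : symmetric h -> symmetric (star h u s).
Proof. by move=> hs x y; rewrite /star hs [in RHS](orbC (_ && _)). Qed.

Lemma star_irr h u s : irreflexive h -> u \notin s -> irreflexive (star h u s).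
Proof.
move=> hi us x; rewrite /star hi /= orbb; apply/andP => -[/eqP -> E].
by rewrite E in us.
Qed.

Lemma star_rcons h u s w : star h u (rcons s w) = add_edge (star h u s) u w.
Proof.
apply/funext => x; apply/funext => y; rewrite /star /add_edge !mem_rcons !inE.
by case: (h x y); case: (x == u); case: (y == u); case: (x == w); case: (y == w);
  case: (x \in s); case: (y \in s).
Qed.

Lemma star_rcons_adj h u s w : symmetric h -> star h u s u w -> star h u (rcons s w) = star h u s.
Proof.
move=> hs uw; rewrite star_rcons; apply/funext => x; apply/funext => y; rewrite /add_edge.
case E: (star h u s x y) => //=; apply/negP => /orP[] /andP[/eqP xE /eqP yE].
  by rewrite xE yE uw in E.
by rewrite xE yE (star_sym u s hs) uw in E.
Qed.

(** Since v is isolated in h, merging it into w hands over exactly the edges to s. *)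
Lemma contract_star h v s w : symmetric h -> irreflexive h -> (forall y, ~~ h v y) -> v \notin s -> w \notin s -> w != v ->
  contract (star h v s) w v = star h w s.
Proof.
move=> hs hi hv vs ws wv; apply/funext => x; apply/funext => y; rewrite /contract /star.
have hv' z : h z v = false by rewrite hs (negPf (hv z)).
case: (x =P v) => [->|/eqP xv] /=.
  by rewrite (negPf (hv y)) (negPf vs) (eq_sym v) (negPf wv) andbF.
case: (y =P v) => [->|/eqP yv] /=.
  by rewrite hv' (negPf vs) (eq_sym v) (negPf wv) andbF.
rewrite eqxx (negPf (hv y)) hv' !orbF /=.
have [<-|] := eqVneq x y; last by [].
by rewrite /= hi /= orbb; apply/esym/negbTE/negP => /andP[/eqP -> E]; rewrite E in ws.
Qed.

End DeletionContraction.

(** * Induction on the number of vertices *)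

Section ChromaticBound.
Variables (R : realType) (V : finType) (t : R).
Hypothesis ht : 463%:R / 100%:R < t.
Implicit Types (e h : rel V) (A : {set V}).

Local Notation c e := (chi R e).[t].
Local Notation x := (t - 1).

Lemma t_gt0 : 0 < t. Proof. by move: ht; lra. Qed.

Lemma chi_contract_at e u w : symmetric e -> irreflexive e -> u != w -> ~~ e u w ->
  t * c e = t * c (add_edge e u w) + c (contract e u w).
Proof.
move=> es ei uw nuw; have := congr1 (horner^~ t) (chi_contract R es ei uw nuw).
by rewrite !(hornerD, hornerM, hornerX).
Qed.

(** Each new edge at u changes the value by that of a contraction divided by t; edges already
    present in h change nothing. *)
Lemma star_close h u s M : symmetric h -> irreflexive h -> u \notin s -> uniq s -> 0 <= M ->
  (forall s' w, prefix (rcons s' w) s -> ~~ h u w ->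
    `|c (contract (star h u s') u w)| <= M) ->
  t * `|c (star h u s) - c h| <= (size s)%:R * M.
Proof.
move=> hs hi + + M0; elim/last_ind: s => [|s w IHs] us sU HM.
  by rewrite star_nil subrr normr0 mulr0 mul0r.
have [uw us'] : u != w /\ u \notin s by move: us; rewrite mem_rcons inE negb_or => /andP[].
have [ws sU'] : w \notin s /\ uniq s by move: sU; rewrite rcons_uniq => /andP[].
have {}IHs : t * `|c (star h u s) - c h| <= (size s)%:R * M.
  by apply: IHs => // s' w' p; apply: HM; apply: prefix_trans p _; exact: prefix_rcons.
rewrite size_rcons -natr1 mulrDl mul1r.
have [uwE|nuw] := boolP (star h u s u w).
  by rewrite star_rcons_adj //; apply: le_trans IHs _; rewrite lerDl.
have nhuw : ~~ h u w by apply: contraNN nuw => uwE; rewrite /star uwE.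
have E := chi_contract_at (star_sym u s hs) (star_irr hi us') uw nuw.
rewrite -star_rcons in E.
have -> : t * `|c (star h u (rcons s w)) - c h| =
    `|t * (c (star h u s) - c h) - c (contract (star h u s) u w)|.
  rewrite -[X in X * `|_|](gtr0_norm t_gt0) -normrM; congr `|_|; lra.
apply: le_trans (ler_normB _ _) _; rewrite lerD ?HM ?prefix_refl //.
by rewrite normrM (gtr0_norm t_gt0).
Qed.

(** Joining v to a after the neighbours s' subtracts 1/t times the value of [star h a s'], which is
    that of h up to (size s') M / t. As v is isolated in h, the value of h already contains a factor
    t. *)
Lemma star_expand h v s M : symmetric h -> irreflexive h -> (forall y, ~~ h v y) ->
  v \notin s -> uniq s ->
  (forall s' a, prefix (rcons s' a) s -> t * `|c (star h a s') - c h| <= (size s')%:R * M) ->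
  `|t * t * c (star h v s) - t * (t - (size s)%:R) * c h| <= (\sum_(i < size s) i)%:R * M.
Proof.
move=> hs hi hv; elim/last_ind: s => [|s a IHs] vs sU HM.
  by rewrite star_nil big_ord0 subr0 mul0r subrr normr0.
have [va vs'] : v != a /\ v \notin s by move: vs; rewrite mem_rcons inE negb_or => /andP[].
have [as_ sU'] : a \notin s /\ uniq s by move: sU; rewrite rcons_uniq => /andP[].
have {}IHs : `|t * t * c (star h v s) - t * (t - (size s)%:R) * c h| <= (\sum_(i < size s) i)%:R * M.
  by apply: IHs => // s' w' p; apply: HM; apply: prefix_trans p _; exact: prefix_rcons.
have av : a != v by rewrite eq_sym.
have nva : ~~ star h v s v a by rewrite /star (negPf (hv a)) eqxx (negPf as_) (negPf av).
have nav : ~~ star h v s a v by rewrite (star_sym v s hs).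
have E := chi_contract_at (star_sym v s hs) (star_irr hi vs') av nav.
have swap : add_edge (star h v s) a v = add_edge (star h v s) v a.
  by apply/funext => y; apply/funext => z; rewrite /add_edge [_ && _ || _]orbC.
rewrite swap -star_rcons contract_star // in E.
rewrite size_rcons big_ord_recr /= natrD mulrDl -natr1.
have -> : t * t * c (star h v (rcons s a)) - t * (t - ((size s)%:R + 1)) * c h =
   (t * t * c (star h v s) - t * (t - (size s)%:R) * c h) - t * (c (star h a s) - c h).
  have -> : t * t * c (star h v s) = t * (t * c (star h v s)) by rewrite mulrA.
  rewrite E; lra.
apply: le_trans (ler_normB _ _) _; rewrite lerD //.
by rewrite normrM (gtr0_norm t_gt0) HM ?prefix_refl.
Qed.

Lemma star_remove e v : symmetric e -> irreflexive e ->
  star (remove e v) v (enum (nbr e v)) = e.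
Proof.
move=> es ei; apply/funext => y; apply/funext => z.
rewrite /star /remove /restrict /= !mem_enum !inE.
case: (y =P v) => [->|_] /=; case: (z =P v) => [->|_] //=; rewrite ?ei ?orbF //.
Qed.

Lemma remove_isolated e v y : ~~ remove e v v y.
Proof. by rewrite /remove /restrict /= eqxx. Qed.

Lemma connected_contract e u w A : symmetric e -> u \in A -> connected_on e A -> u != w ->
  connected_on (contract e u w) (A :\ w).
Proof.
move=> es uA conn uw a b; rewrite !inE => /andP[aw aA] /andP[bw bA].
pose m z := if z == w then u else z.
have step y z : e y z -> connect (contract e u w) (m y) (m z).
  move=> yz; have [->|myz] := eqVneq (m y) (m z); first exact: connect0.
  apply: connect1; move: myz; rewrite /m /contract.
  case: (y =P w) yz => [->|/eqP yw]; case: (z =P w) => [->|/eqP zw] yz; rewrite ?uw ?eqxx //=.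
  - by move=> ->; rewrite zw yz orbT.
  - by move=> ->; rewrite yw yz !orbT.
  - by move=> ->; rewrite yw zw yz.
have /connectP[p] := conn a b aA bA.
suff H q y : path e y q -> connect (contract e u w) (m y) (m (last y q)).
  by move=> /H + bE; rewrite -bE /m (negPf aw) (negPf bw).
elim: q y => //= z q IHq y /andP[yz /IHq]; exact: connect_trans (step _ _ yz).
Qed.

Lemma connected_sub e f A : subrel e f -> connected_on e A -> connected_on f A.
Proof.
move=> ef conn a b aA bA; apply: connect_sub (conn a b aA bA) => y z /ef.
exact: connect1.
Qed.

Lemma contract_supported e u w A : supported e A -> u \in A -> supported (contract e u w) (A :\ w).
Proof.
move=> eA uA y z /and4P[yw _ _ h]; rewrite !inE yw /=.
by case/or3P: h => [/eA|/andP[/eqP -> _]|/andP[_ /eA]].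
Qed.

Lemma contract_mono e f u w : subrel e f -> subrel (contract e u w) (contract f u w).
Proof.
move=> ef y z /and4P[yw zw yz h]; rewrite /contract yw zw yz /=.
by case/or3P: h => [/ef ->|/andP[-> /ef ->]|/andP[-> /ef ->]]; rewrite ?orbT.
Qed.

Definition acyclic e := forall s : seq V, ucycle e s -> (size s <= 2)%N.

(** A cycle of length at least three through v would give v two distinct neighbours. *)
Lemma acyclic_leaf e v : symmetric e -> irreflexive e -> #|nbr e v| = 1%N ->
  acyclic (remove e v) -> acyclic e.
Proof.
move=> es ei n1 ac s /andP[es' su]; rewrite leqNgt; apply/negP => s3.
have [vs|vs] := boolP (v \in s).
  have [i s' sE] := rot_to vs.
  have : cycle e (v :: s') by rewrite -sE rot_cycle.
  have : uniq (v :: s') by rewrite -sE rot_uniq.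
  have : (2 < size (v :: s'))%N by rewrite -sE size_rot.
  case: s' {sE} => [|a [|b s']] //= _ /and3P[_ abs _] /and3P[va _].
  rewrite rcons_path => /andP[_ lv].
  have : (#|[set a; last b s']| <= #|nbr e v|)%N.
    by apply: subset_leq_card; apply/subsetP => z; rewrite !inE => /orP[] /eqP -> //; rewrite es.
  rewrite n1 cards2; case: eqP => // al; by rewrite al mem_last in abs.
suff /ac : ucycle (remove e v) s by rewrite leqNgt s3.
rewrite /ucycle su andbT.
case: s es' vs {su s3} => //= a s ps vs.
have : all (fun z => z != v) (a :: rcons s a).
  by apply/allP => z; rewrite inE mem_rcons inE => h; apply: contraNneq vs => <-; case/or3P: h => [/eqP->|/eqP->|]; rewrite inE ?eqxx // => ->; rewrite orbT.
move: ps; move: (rcons s a) => q; elim: q a {vs} => //= b q IHq a /andP[ab bq] /and3P[av bv qv].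
by rewrite /remove /restrict /= av bv ab -[path _ _ _]/(path (remove e v) b q) IHq //= bv.
Qed.

(* The bound for [n] vertices, times the factor [t] for each of the remaining
   isolated vertices of [V]. *)
Definition bnd n : R := t ^+ #|V|.+1 * x ^+ n.-1 / t ^+ n.

Lemma bndS n : bnd n.+2 = bnd n.+1 * (x / t).
Proof.
rewrite /bnd /= !exprS; have := t_gt0; move=> t0; field.
by rewrite expf_neq0 ?gt_eqF.
Qed.

Lemma bnd_gt0 n : 0 < bnd n.
Proof.
by rewrite /bnd divr_gt0 ?mulr_gt0 ?exprn_gt0 ?t_gt0 //; move: ht; lra.
Qed.

(** For t >= d the inequality is linear in x = t - 1. The critical case is d = 5 with t < 5: there
    it reads x^2 - 2x - 5 > 0, that is x > 1 + sqrt 6. *)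
Lemma degree_bound d : (1 < d <= 5)%N ->
  `|t - d%:R| * x + (\sum_(i < d) i)%:R < x ^+ 2.
Proof.
have -> : (\sum_(i < d) i)%N = (\sum_(0 <= i < d) i)%N by rewrite big_mkord.
case: d => [|[|[|[|[|[|d]]]]]] // _; rewrite !big_nat_recr ?big_geq //=;
  case: (ger0P (t - _)) => h; move: ht h => ht' h; nra.
Qed.

Lemma chi_bound n e A : #|A| = n.+1 -> symmetric e -> irreflexive e -> supported e A ->
  connected_on e A -> ~ has_minor e K5 ->
  `|c e| <= bnd n.+1 /\ (`|c e| = bnd n.+1 -> acyclic e).
Proof.
elim/ltn_ind: n e A => -[|m] IHn e A cA es ei eA conn nK.
  have e0 y z : ~~ e y z.
    have /cards1P[a Aa] : #|A| == 1%N by rewrite cA.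
    apply/negP => yz; have := eA _ _ yz; have := supportedr es eA yz.
    by rewrite Aa !inE => /eqP zE /eqP yE; move: yz; rewrite yE zE ei.
  have -> : c e = bnd 1.
    rewrite (chi_empty _ e0) hornerXn /bnd /= mulr1 exprS expr1 mulrAC divff ?mul1r //.
    by rewrite gt_eqF ?t_gt0.
  rewrite ger0_norm ?(ltW (bnd_gt0 _)) //; split=> // _ [|a [|b s]] //=.
  by rewrite /ucycle /= (negPf (e0 _ _)).
have [|v [vA d5 connh]] := noncut_low_degree es ei eA nK conn; first by rewrite cA.
set h := remove e v in connh; pose s := enum (nbr e v).
have hs : symmetric h by exact: remove_sym.
have hi : irreflexive h by exact: remove_irr.
have hA : supported h (A :\ v) by exact: remove_supported.
have cA' : #|A :\ v| = m.+1 by move: cA; rewrite (cardsD1 v) vA => -[].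
have he : subrel h e by move=> y z /and3P[].
have nKh : ~ has_minor h K5 by move=> ?; apply: nK; apply: has_minor_trans (has_minor_sub he) _.
have sE z : (z \in s) = e v z by rewrite mem_enum inE.
have sA z : z \in s -> z \in A :\ v.
  by rewrite sE => vz; apply: (subsetP (nbr_sub v es ei eA)); rewrite inE.
have vs : v \notin s by rewrite sE ei.
have [hle heq] := IHn m (ltnSn m) h _ cA' hs hi hA connh nKh.
have d1 : (0 < #|nbr e v|)%N.
  have /card_gt0P[a] : (0 < #|A :\ v|)%N by rewrite cA'.
  rewrite !inE => /andP[av aA]; have /connectP[[|b p] /=] := conn v a vA aA.
    by move=> _ va; rewrite va eqxx in av.
  by move=> /andP[vb _] _; apply/card_gt0P; exists b; rewrite inE.
have bnd0 k : 0 <= bnd k by rewrite ltW ?bnd_gt0.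
have close s' a : prefix (rcons s' a) s ->
    t * `|c (star h a s') - c h| <= (size s')%:R * bnd m.
  move=> ps.
  have [s2 sE2] : exists s2, s = rcons s' a ++ s2 by apply/prefixP.
  have : uniq s by exact: enum_uniq.
  rewrite sE2 cat_uniq => /and3P[]; rewrite rcons_uniq => /andP[as' us'] _ _.
  have ss z : z \in rcons s' a -> e v z by rewrite -sE sE2 mem_cat => ->.
  have va : e v a by rewrite ss // mem_rcons mem_head.
  apply: star_close => // s3 w ps3 naw.
  have [s4 sE3] : exists s4, s' = rcons s3 w ++ s4 by apply/prefixP.
  have ws' : w \in s' by rewrite sE3 mem_cat mem_rcons mem_head.
  have vw : e v w by rewrite ss // mem_rcons inE ws' orbT.
  have as3 : a \notin s3.
    by apply: contraNN as' => as3; rewrite sE3 mem_cat mem_rcons inE as3 orbT.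
  have aw : a != w by apply: contraNneq as' => ->.
  have wA : w \in A :\ v by rewrite sA ?sE.
  have aA : a \in A :\ v by rewrite sA ?sE.
  case: m => [|m] in IHn cA cA' hle heq *.
    by move: cA'; rewrite (cardsD1 w) wA (cardsD1 a) in_setD1 aw aA.
  have fs : symmetric (star h a s3) by exact: star_sym.
  have fi : irreflexive (star h a s3) by exact: star_irr.
  have fA : supported (star h a s3) (A :\ v).
    move=> y z /or3P[/hA //|/andP[/eqP -> //]|/andP[_ ys3]].
    by apply: sA; rewrite sE ss // mem_rcons inE sE3 mem_cat mem_rcons inE ys3 !orbT.
  (* Joining a to earlier neighbours of v gives a subgraph of e with v contracted into a. Hence the
     graphs of the error term are minors of e and have no K5 minor either. *)
  have sub1 : subrel (star h a s3) (contract e a v).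
    have nva : v != a by apply: contraTneq va => <-; rewrite ei.
    have s3P z : z \in s3 -> [/\ z != v, e v z & a != z].
      move=> zs3; split; last by apply: contraNneq as3 => ->.
        by apply: contraNneq vs => <-; rewrite sE2 mem_cat mem_rcons inE sE3 mem_cat mem_rcons inE zs3 !orbT.
      by apply: ss; rewrite mem_rcons inE sE3 mem_cat mem_rcons inE zs3 !orbT.
    move=> y z /or3P[/and3P[/= yv zv yz]|/andP[/eqP -> /s3P[zv vz az]]|/andP[/eqP -> /s3P[yv vy ay]]];
      rewrite /contract.
    - by rewrite yv zv yz andbT; apply: contraTneq yz => ->; rewrite ei.
    - by rewrite (eq_sym a v) nva zv az eqxx vz orbT.
    - by rewrite yv (eq_sym a v) nva (eq_sym y) ay eqxx (es y v) vy !orbT.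
  have e1s := contract_sym a v es.
  have e1aw : contract e a v a w.
    have [wv wA'] : w != v /\ w \in A by move: wA; rewrite !inE => /andP[].
    have [av _] : a != v /\ a \in A by move: aA; rewrite !inE => /andP[].
    by rewrite /contract wv av aw eqxx vw orbT.
  have sub2 : subrel (contract (star h a s3) a w) (contract (contract e a v) a w).
    exact: contract_mono.
  have nK' : ~ has_minor (contract (star h a s3) a w) K5.
    move=> H; apply: nK; apply: (has_minor_trans (contract_minor es _)); last first.
      apply: (has_minor_trans (contract_minor e1s e1aw)).
      exact: has_minor_trans (has_minor_sub sub2) H.
    by rewrite es.
  have cAw : #|A :\ v :\ w| = m.+1 by move: cA'; rewrite (cardsD1 w) wA => -[].
  have fconn : connected_on (star h a s3) (A :\ v).
    by apply: connected_sub connh => y z yz; rewrite /star yz.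
  have m2 : (m < m.+2)%N by rewrite ltnW.
  by have [] := IHn m m2 _ _ cAw (contract_sym a w fs) (@contract_irr _ _ a w)
    (@contract_supported _ a w _ fA aA) (connected_contract fs aA fconn aw) nK'.
have Hd := @star_expand h v s (bnd m) hs hi (remove_isolated e v) vs (enum_uniq _) close.
rewrite /h star_remove // -/h -cardE in Hd; set d := #|nbr e v| in d5 d1 Hd; have t0 := t_gt0.
have x0 : 0 < x by move: ht; lra.
have bE : bnd m.+1 = bnd m.+2 * (t / x) by rewrite bndS; field; rewrite !gt_eqF.
(* For degree one the error sum is empty and the recursion exact, so the equality case passes to h.
   For degree at least two the bound is strict. *)
have [d2|d2] := ltnP 1 d; last first.
  have {d2 d5 d1}d1 : d = 1%N by lia.
  move: Hd; rewrite d1 big_ord1 mul0r normr_le0 subr_eq0 => /eqP Hd.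
  have ce : c e = x / t * c h.
    apply: (mulfI (x := t * t)); first by rewrite mulf_neq0 ?gt_eqF.
    by rewrite Hd; field; rewrite gt_eqF.
  rewrite ce normrM (gtr0_norm (divr_gt0 x0 t0)) bndS [x / t * _]mulrC.
  have xt : 0 < x / t by rewrite divr_gt0.
  split; first by rewrite ler_pM2r.
  by move=> /(mulIf (lt0r_neq0 xt))/heq; exact: acyclic_leaf.
have m1 : (0 < m)%N.
  have := subset_leq_card (nbr_sub v es ei eA); rewrite -/d cA'; lia.
have bE' : bnd m = bnd m.+2 * (t / x) ^+ 2.
  by case: m m1 {IHn cA cA' hle heq Hd close} bE => // m _ bE; rewrite expr2 mulrA -bE bndS; field; rewrite !gt_eqF.
have Dd := @degree_bound d; rewrite d2 d5 in Dd; have {}Dd := Dd isT.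
have B0 := bnd_gt0 m.+2.
suff lt : `|c e| < bnd m.+2 by split; [exact: ltW|move=> E; rewrite E ltxx in lt].
rewrite -(ltr_pM2l (mulr_gt0 t0 t0)).
rewrite -[X in X * `|_|](gtr0_norm (mulr_gt0 t0 t0)) -normrM.
set S := (\sum_(i < d) i)%:R in Hd Dd.
have S0 : 0 <= S by rewrite ler0n.
have: `|t * t * c e| <= t * `|t - d%:R| * bnd m.+1 + S * bnd m.
  rewrite -(subrK (t * (t - d%:R) * c h) (t * t * c e)).
  apply: le_trans (ler_normD _ _) _; rewrite addrC lerD //.
  by rewrite !normrM (gtr0_norm t0) ler_wpM2l ?mulr_ge0 // ltW.
move/le_lt_trans; apply; rewrite bE bE'.
have -> : t * `|t - d%:R| * (bnd m.+2 * (t / x)) + S * (bnd m.+2 * (t / x) ^+ 2) =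
   (`|t - d%:R| * x + S) * (bnd m.+2 * (t / x) ^+ 2) by field; rewrite gt_eqF.
have -> : t * t * bnd m.+2 = x ^+ 2 * (bnd m.+2 * (t / x) ^+ 2) by field; rewrite gt_eqF.
by rewrite (ltr_pM2r (mulr_gt0 B0 (exprn_gt0 2 (divr_gt0 t0 x0)))).
Qed.

End ChromaticBound.

Lemma planar_chromatic_bound (R : realType) (t : R) (G : sgraph) :
  463%:R / 100%:R < t -> planar R G -> connected_graph G ->
  `|(chromatic_poly R G).[t]| <= t * (t - 1) ^+ #|G|.-1 /\
  (~ is_tree G -> `|(chromatic_poly R G).[t]| < t * (t - 1) ^+ #|G|.-1).
Proof.
move=> ht pG cG; have [n0 conn] := cG.
have t0 := t_gt0 ht.
have bE : bnd G t #|G| = t * (t - 1) ^+ #|G|.-1.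
  by rewrite /bnd exprS; field; rewrite expf_neq0 ?gt_eqF.
have [le_bnd eq_bnd] : `|(chi R (@adj G)).[t]| <= bnd G t #|G| /\
    (`|(chi R (@adj G)).[t]| = bnd G t #|G| -> acyclic (@adj G)).
  have cT : #|[set: G]%SET| = #|G|.-1.+1 by rewrite cardsT prednK.
  have := chi_bound ht cT (@adj_sym G) (@adj_irrefl G); rewrite prednK //; apply.
  - by move=> x y _; rewrite inE.
  - by move=> x y _ _.
  - exact: planar_no_K5 pG.
rewrite -bE; split=> // nT; rewrite lt_neqAle le_bnd andbT.
by apply/eqP => E; apply: nT; split=> //; exact: eq_bnd.
Qed.

(** * State sums for Temperley-Lieb diagrams *)

(* Local weights for a matching of points on a line: each matched point [x]
   contributes [pw b s s'], where [b] tells whether [x] is the left end of its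
   pair, and [s], [s'] are the states of [x] and of its partner. The axioms say
   that contracting two consecutive points with [cw] joins their partners. *)
Record model (K : comRingType) := Model {
  pw : bool -> bool -> bool -> K;
  cw : bool -> bool -> K;
  loopw : K;
  pairw := fun s s' => pw true s s' * pw false s' s;
  cw_loop : \sum_a \sum_b cw a b * pairw a b = loopw;
  cw_lr : forall s s', \sum_a \sum_b cw a b * (pairw s a * pairw b s') = pairw s s';
  cw_ll : forall s s', \sum_a \sum_b cw a b * (pairw s a * pairw s' b) = pairw s' s;
  cw_rr : forall s s', \sum_a \sum_b cw a b * (pairw a s * pairw b s') = pairw s' s
}.
Arguments pairw {K} m.

(** * Contracting neighbouring points of a non-crossing matching *)

Section Contraction.
Variables (X : finType) (rk : X -> nat).
Hypothesis rkI : injective rk.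
Implicit Types (A : {set X}) (D : X -> X) (u v x y z : X) (st : X -> bool).

Definition btw x y z := ((rk y < rk x < rk z) || (rk z < rk x < rk y))%N.

(** Linking of two pairs of points on a line is a symmetric relation. *)
Lemma btw_cross x y z w : x != z -> x != w -> y != z -> y != w ->
  btw x z w = btw y z w -> btw z x y = btw w x y.
Proof.
rewrite -!(inj_eq rkI) /btw => xz xw yz yw.
by move: (rk x) (rk y) (rk z) (rk w) xz xw yz yw => a b c d; lia.
Qed.

(** Non-crossing is stated without choosing left ends: a pair lies entirely inside or entirely
    outside any other pair. *)
Definition nc_matching A D :=
  (forall x, x \in A -> [/\ D x \in A, D (D x) = x & D x != x]) /\
  {in A &, forall x y, x != y -> x != D y -> btw x y (D y) = btw (D x) y (D y)}.

(** The former partners of u and v become partners of each other. If u and v were already paired, a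
    loop closes and D is kept. *)
Definition capD D u v : X -> X := fun x =>
  if D u == v then D x else
  if x == D u then D v else if x == D v then D u else D x.

Definition adjacent A u v := forall x, x \in A -> ~~ (rk u < rk x < rk v)%N.

Definition upd st u v a b : X -> bool :=
  fun z => if z == u then a else if z == v then b else st z.

Variables (A : {set X}) (D : X -> X) (u v : X).
Hypotheses (AD : nc_matching A D) (uA : u \in A) (vA : v \in A)
  (uv : (rk u < rk v)%N) (adj : adjacent A u v).

Let unv : u != v. Proof. by apply: contraTneq uv => ->; rewrite ltnn. Qed.

Let mA := AD.1.
Let nA := AD.2.

Lemma matching_inj x y : x \in A -> y \in A -> D x = D y -> x = y.
Proof. by move=> xA yA E; have [_ <- _] := mA xA; have [_ <- _] := mA yA; rewrite E. Qed.

Lemma capD_left : D u != v -> capD D u v (D u) = D v.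
Proof. by move=> Duv; rewrite /capD (negPf Duv) eqxx. Qed.

Lemma capD_right : D u != v -> capD D u v (D v) = D u.
Proof.
move=> Duv; rewrite /capD (negPf Duv) eqxx.
by case: eqP => // /(matching_inj vA uA) E; have := unv; rewrite E eqxx.
Qed.

Lemma capD_other x : x != D u -> x != D v -> capD D u v x = D x.
Proof. by move=> /negPf xu /negPf xv; rewrite /capD xu xv if_same. Qed.

Lemma adjacent_cmp z : z \in A -> z != u -> z != v ->
  ((rk u < rk z) = (rk v < rk z))%N /\ ((rk z < rk u) = (rk z < rk v))%N.
Proof.
rewrite -!(inj_eq rkI) => zA zu zv; have := adj zA.
case: ltngtP zu => //= [uz _|zu _ _]; last first.
  by rewrite (ltn_trans zu uv) ltnNge ltnW // (ltn_trans zu uv).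
by rewrite -leqNgt leq_eqVlt eq_sym (negPf zv) /= => vz; rewrite vz ltnNge ltnW.
Qed.

Lemma capD_same_side x : x \in A -> x != u -> x != v -> x != D u -> x != D v ->
  btw (D u) x (D x) = btw (D v) x (D x).
Proof.
move=> xA xu xv xDu xDv; have [DxA DDx Dxn] := mA xA.
have [DuA DDu Dun] := mA uA; have [DvA DDv Dvn] := mA vA.
have uDx : D x != u by apply: contraNneq xDu => <-; rewrite DDx.
have vDx : D x != v by apply: contraNneq xDv => <-; rewrite DDx.
have [c1 c2] := adjacent_cmp xA xu xv; have [c3 c4] := adjacent_cmp DxA uDx vDx.
by rewrite -(nA uA xA) // 1?eq_sym // -(nA vA xA) 1?eq_sym // /btw c1 c2 c3 c4.
Qed.

Lemma capD_matching : nc_matching (A :\ u :\ v) (capD D u v).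
Proof.
have [DuA DDu Dun] := mA uA; have [DvA DDv Dvn] := mA vA.
have [Duv|Duv] := eqVneq (D u) v.
  have Dvu : D v = u by rewrite -Duv.
  rewrite /capD Duv eqxx; split=> [x|x y]; rewrite !inE.
    move=> /and3P[xv xu xA]; have [DxA DDx Dxn] := mA xA; split=> //.
    rewrite DxA andbT; apply/andP; split.
      by apply: contraNneq xu => E; rewrite -DDx E Dvu.
    by apply: contraNneq xv => E; rewrite -DDx E Duv.
  by move=> /and3P[_ _ xA] /and3P[_ _ yA]; exact: nA.
have Dvu : D v != u by apply: contraNneq Duv => <-; rewrite DDv.
have DuDv : D u != D v by apply: contraNneq (unv) => /(matching_inj uA vA) ->.
split=> [x|x y]; rewrite !inE => /and3P[xv xu xA]; have [DxA DDx Dxn] := mA xA.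
  have [->|xDu] := eqVneq x (D u).
    by rewrite capD_left // capD_right // Dvn Dvu DvA eq_sym.
  have [->|xDv] := eqVneq x (D v).
    by rewrite capD_right // capD_left // Duv Dun DuA.
  have nDu : D x != D u by apply: contraNneq xu => /(matching_inj xA uA) ->.
  have nDv : D x != D v by apply: contraNneq xv => /(matching_inj xA vA) ->.
  rewrite !capD_other //; split=> //; rewrite DxA andbT.
  by apply/andP; split; [apply: contraNneq xDv => <-|apply: contraNneq xDu => <-]; rewrite DDx.
move=> /and3P[yv yu yA] xy; have [DyA DDy Dyn] := mA yA.
have nx z : z \in A -> x != z -> D x != D z by move=> zA; apply: contraNneq => /(matching_inj xA zA) ->.
have [yDu|yDu] := eqVneq y (D u); last have [yDv|yDv] := eqVneq y (D v).
- rewrite yDu capD_left // => xDv; have xDu : x != D u by rewrite -yDu.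
  by rewrite capD_other //; apply: btw_cross; rewrite 1?eq_sym ?capD_same_side ?nx.
- rewrite yDv capD_right // => xDu; have xDv : x != D v by rewrite -yDv.
  by rewrite capD_other //; apply: btw_cross; rewrite 1?eq_sym ?capD_same_side ?nx.
- rewrite capD_other // => xDy.
  have [->|xDu] := eqVneq x (D u); first by rewrite capD_left // capD_same_side.
  have [->|xDv] := eqVneq x (D v); first by rewrite capD_right // capD_same_side.
  by rewrite capD_other // nA.
Qed.

Variables (K : comRingType) (M : model K).

Definition wt A D st : K := \prod_(x in A) pw M (rk x < rk (D x))%N (st x) (st (D x)).

Lemma wt_cap st :
  \sum_a \sum_b cw M a b * wt A D (upd st u v a b) =
  (if D u == v then loopw M else 1) * wt (A :\ u :\ v) (capD D u v) st.
Proof.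
have [DuA DDu Dun] := mA uA; have [DvA DDv Dvn] := mA vA.
have updu a b : upd st u v a b u = a by rewrite /upd eqxx.
have updv a b : upd st u v a b v = b by rewrite /upd eqxx eq_sym (negPf unv).
have updx a b x : x != u -> x != v -> upd st u v a b x = st x.
  by rewrite /upd => /negPf -> /negPf ->.
have vA' : v \in A :\ u by rewrite !inE eq_sym unv.
have wtE a b : wt A D (upd st u v a b) =
   pw M (rk u < rk (D u))%N a (upd st u v a b (D u)) * (pw M (rk v < rk (D v))%N b (upd st u v a b (D v)) *
   \prod_(x in A :\ u :\ v) pw M (rk x < rk (D x))%N (upd st u v a b x) (upd st u v a b (D x))).
  by rewrite /wt (big_setD1 u) //= (big_setD1 v) //= updu updv.
have [Duv|Duv] := eqVneq (D u) v.
  have Dvu : D v = u by rewrite -Duv.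
  have C : wt (A :\ u :\ v) (capD D u v) st = wt (A :\ u :\ v) D st.
    by rewrite /capD Duv eqxx.
  rewrite C -(cw_loop M) big_distrl /=; apply: eq_bigr => a _.
  rewrite big_distrl /=; apply: eq_bigr => b _.
  rewrite wtE Dvu Duv updv updu uv [(rk v < _)%N]ltnNge (ltnW uv) /pairw !mulrA.
  congr (_ * _); apply: eq_bigr => x; rewrite !inE => /and3P[xv xu xA].
  have [DxA DDx Dxn] := mA xA.
  rewrite !updx //; first by apply: contraNneq xv => E; rewrite -DDx E Duv.
  by apply: contraNneq xu => E; rewrite -DDx E Dvu.
have Dvu : D v != u by apply: contraNneq Duv => <-; rewrite DDv.
have DuDv : D u != D v by apply: contraNneq (unv) => /(matching_inj uA vA) ->.
have DuB : D u \in A :\ u :\ v by rewrite !inE Duv Dun DuA.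
have DvB : D v \in A :\ u :\ v :\ D u by rewrite !inE eq_sym DuDv Dvu Dvn DvA.
pose C := \prod_(x in A :\ u :\ v :\ D u :\ D v) pw M (rk x < rk (D x))%N (st x) (st (D x)).
have wtE' : wt (A :\ u :\ v) (capD D u v) st =
   pw M (rk (D u) < rk (D v))%N (st (D u)) (st (D v)) *
   pw M (rk (D v) < rk (D u))%N (st (D v)) (st (D u)) * C.
  rewrite /wt (big_setD1 (D u)) //= (big_setD1 (D v)) //= capD_left // capD_right // mulrA.
  congr (_ * _); apply: eq_bigr => x; rewrite !inE => /and5P[xDv xDu xv xu xA].
  by rewrite capD_other.
pose P a b := pw M (rk u < rk (D u))%N a (st (D u)) * pw M (rk (D u) < rk u)%N (st (D u)) a *
   (pw M (rk v < rk (D v))%N b (st (D v)) * pw M (rk (D v) < rk v)%N (st (D v)) b).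
have {}wtE a b : wt A D (upd st u v a b) = P a b * C.
  rewrite wtE (big_setD1 (D u)) //= (big_setD1 (D v)) //= DDu DDv updu updv !updx //.
  rewrite (eq_bigr (fun x => pw M (rk x < rk (D x))%N (st x) (st (D x)))) => [|x].
    by rewrite -/C /P; ring.
  rewrite !inE => /and5P[xDv xDu xv xu xA]; have [DxA DDx Dxn] := mA xA.
  rewrite !updx //; first by apply: contraNneq xDu => <-; rewrite DDx.
  by apply: contraNneq xDv => <-; rewrite DDx.
rewrite wtE' mul1r.
under eq_bigr => a _ do under eq_bigr => b _ do rewrite wtE mulrA.
under eq_bigr => a _ do rewrite -big_distrl /=.
rewrite -big_distrl /=; congr (_ * _).
have cmp z : z \in A -> z != u -> z != v ->
    ((rk z < rk u) && (rk z < rk v) || (rk v < rk z) && (rk u < rk z))%N.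
  move=> zA zu zv; have [<- <-] := adjacent_cmp zA zu zv; rewrite !andbb -neq_ltn.
  by rewrite (inj_eq rkI).
have nc : btw u v (D v) = btw (D u) v (D v).
  by apply: nA; rewrite // eq_sym.
have asym x y : (rk x < rk y)%N -> (rk y < rk x)%N = false by move=> h; rewrite ltnNge (ltnW h).
have Duv_ne : rk (D u) != rk (D v) by rewrite (inj_eq rkI).
rewrite /P; move: nc; rewrite /btw uv (asym _ _ uv) /=.
(* The partners of u and v may lie both left, left and right, right and left, or both right. The
   third arrangement would cross; the other three are the axioms [cw_ll], [cw_lr] and [cw_rr]. *)
case/orP: (cmp _ DuA Dun Duv) => /andP[c1 c2]; case/orP: (cmp _ DvA Dvu Dvn) => /andP[c3 c4];
  rewrite ?c1 ?c2 ?c3 ?c4 ?(asym _ _ c1) ?(asym _ _ c2) ?(asym _ _ c3) ?(asym _ _ c4) ?andbT ?andbF ?orbF /=.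
- move=> c5; rewrite -c5 (asym _ _ (esym c5)) mulrC.
  rewrite -[RHS]/(pairw M _ _) -(cw_ll M); apply: eq_bigr => a _; apply: eq_bigr => b _.
  by rewrite /pairw; ring.
- move=> _; rewrite (ltn_trans c1 (ltn_trans uv c3)) (asym _ _ (ltn_trans c1 (ltn_trans uv c3))).
  rewrite -[RHS]/(pairw M _ _) -(cw_lr M); apply: eq_bigr => a _; apply: eq_bigr => b _.
  by rewrite /pairw; ring.
- by move=> c5; rewrite ltnNge ltnW // (ltn_trans c3 (ltn_trans uv c1)) in c5.
- move=> c5; have {}c5 : (rk (D v) < rk (D u))%N.
    by rewrite ltn_neqAle eq_sym Duv_ne leqNgt -c5.
  rewrite c5 (asym _ _ c5) mulrC -[RHS]/(pairw M _ _) -(cw_rr M).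
  by apply: eq_bigr => a _; apply: eq_bigr => b _; rewrite /pairw; ring.
Qed.

End Contraction.

(** * Diagrams as matchings along the rim *)

Section Diagrams.
Local Open Scope nat_scope.
Variables m n : nat.

Lemma rim_lt (q : bpoint m n) : rim q < m + n.
Proof. by case: q => i /=; have := ltn_ord i; lia. Qed.

Lemma rim_inj : injective (@rim m n).
Proof.
move=> [i|i] [j|j] /= E; have := ltn_ord i; have := ltn_ord j => ? ?.
- by congr inl; apply: val_inj.
- by lia.
- by lia.
- by congr inr; apply: val_inj => /=; lia.
Qed.

Lemma tldiagP (d : tldiag m n) q : d (d q) = q /\ d q != q.
Proof. by have := valP d => /andP[/forallP/(_ q)/andP[? /eqP ?] _]; split. Qed.

Lemma tldiag_eqP (d d' : tldiag m n) : (forall q, d q = d' q) -> d = d'.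
Proof. by move=> dd; apply: val_inj; apply/ffunP. Qed.

Lemma tldiag_noncrossing (d : tldiag m n) q r :
  ~~ [&& rim q < rim r, rim r < rim (d q) & rim (d q) < rim (d r)].
Proof. by have := valP d => /andP[_ /forallP/(_ q)/forallP/(_ r)]. Qed.

Lemma tldiag_nc_matching (d : tldiag m n) : nc_matching (@rim m n) [set: bpoint m n] d.
Proof.
split=> [x _|x y _ _ xy xdy]; first by rewrite inE; have [? ?] := tldiagP d x.
have [dx dxn] := tldiagP d x; have [dy dyn] := tldiagP d y.
have neq (a b : bpoint m n) : a != b -> rim a != rim b by rewrite (inj_eq rim_inj).
have h1 := neq _ _ xy; have h2 := neq _ _ xdy; have h3 := neq _ _ dxn; have h4 := neq _ _ dyn.
have h5 : rim (d x) != rim y by apply: neq; apply: contraNneq xdy => <-; rewrite dx.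
have h6 : rim (d x) != rim (d y) by apply: neq; apply: contraNneq xy => E; rewrite -dx E dy.
have := tldiag_noncrossing d x y; have := tldiag_noncrossing d y x.
have := tldiag_noncrossing d (d x) y; have := tldiag_noncrossing d y (d x).
have := tldiag_noncrossing d x (d y); have := tldiag_noncrossing d (d y) x.
have := tldiag_noncrossing d (d x) (d y); have := tldiag_noncrossing d (d y) (d x).
rewrite dx dy /btw; move: h1 h2 h3 h4 h5 h6.
move: (rim x) (rim y) (rim (d x)) (rim (d y)) => a b c e.
case: (ltngtP a b) => // ab _; case: (ltngtP a e) => // ae _; case: (ltngtP c a) => // ca _;
  case: (ltngtP e b) => // eb _; case: (ltngtP c b) => // cb _; case: (ltngtP c e) => //.
Qed.

Lemma nc_matching_tldiag (f : bpoint m n -> bpoint m n) :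
  nc_matching (@rim m n) [set: bpoint m n] f -> exists d : tldiag m n, forall q, d q = f q.
Proof.
move=> [mf nf]; pose d := [ffun q => f q].
have dP : [forall p, (d p != p) && (d (d p) == p)] && noncrossing d.
  apply/andP; split.
    by apply/forallP => q; rewrite !ffunE; have [_ -> ->] := mf q (in_setT q); rewrite eqxx.
  apply/forallP => x; apply/forallP => y; rewrite !ffunE; apply/negP => /and3P[h1 h2 h3].
  have := nf y x (in_setT _) (in_setT _); rewrite /btw h1 h2 /=.
  have -> : y != x by apply: contraTneq h1 => ->; rewrite ltnn.
  have -> : y != f x by apply: contraTneq h2 => ->; rewrite ltnn.
  by move=> /(_ isT isT); lia.
by exists (exist _ d dP) => q; rewrite /diag_fun /= ffunE.
Qed.

Definition wtd (K : comRingType) (M : model K) (d : tldiag m n) (st : bpoint m n -> bool) : K :=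
  (\prod_q pw M (rim q < rim (d q))%N (st q) (st (d q)))%R.

End Diagrams.

(** * Gluing two diagrams along the middle line *)

Section Gluing.
Variables (m n p : nat) (d1 : tldiag n p) (d2 : tldiag m n).

Definition glued : finType := (bpoint m n + bpoint n p)%type.

(** The rim of d2 ends with its top read from right to left, and the rim of d1 starts with its
    bottom read from left to right. The two copies of the middle points are therefore nested, and
    the k-th copies become neighbours once those of smaller index are contracted. *)
Definition glued_rk (x : glued) : nat :=
  match x with inl q => rim q | inr q => (m + n + rim q)%N end.

Definition glued_match (x : glued) : glued :=
  match x with inl q => inl (d2 q) | inr q => inr (d1 q) end.

Lemma glued_rk_inj : injective glued_rk.
Proof.
move=> [q|q] [r|r] /= E.
- by congr inl; exact: rim_inj.
- by have := rim_lt q; lia.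
- by have := rim_lt r; lia.
- by congr inr; apply: rim_inj; lia.
Qed.

Lemma glued_nc_matching : nc_matching glued_rk [set: glued] glued_match.
Proof.
have [m1 n1] := tldiag_nc_matching d1; have [m2 n2] := tldiag_nc_matching d2.
split=> [[q|q] _|[q|q] [r|r] _ _]; rewrite ?inE /=.
- by have [_ -> qn] := m2 q (in_setT q).
- by have [_ -> qn] := m1 q (in_setT q).
- by move=> qr qdr; exact: n2.
- by move=> _ _; rewrite /btw /=; have := rim_lt q; have := rim_lt (d2 q); lia.
- by move=> _ _; rewrite /btw /=; have := rim_lt r; have := rim_lt (d2 r); lia.
- move=> qr qdr; have := n1 q r (in_setT _) (in_setT _) qr qdr.
  by rewrite /btw /= !ltn_add2l.
Qed.

(* The points that are left after contracting the first [k] middle pairs. *)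
Definition alive_pred (k : nat) (x : glued) : bool :=
  match x with inl (inr i) => (k <= i)%N | inr (inl i) => (k <= i)%N | _ => true end.
Definition alive (k : nat) : {set glued} := [set x | alive_pred k x].

Definition lo (i : 'I_n) : glued := inl (inr i).
Definition hi (i : 'I_n) : glued := inr (inl i).

Lemma alive0 : alive 0 = [set: glued].
Proof. by apply/setP => -[[i|i]|[i|i]]; rewrite !inE. Qed.

Lemma aliveS (k : 'I_n) : alive k.+1 = alive k :\ lo k :\ hi k.
Proof.
apply/setP => -[[i|i]|[i|i]]; rewrite !inE //=.
- have -> : (inl (inr i) == lo k :> glued) = (i == k) by [].
  by rewrite -val_eqE /= ltn_neqAle eq_sym.
- have -> : (inr (inl i) == hi k :> glued) = (i == k) by [].
  by rewrite -val_eqE /= ltn_neqAle eq_sym.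
Qed.

Definition outer (q : bpoint m p) : glued :=
  match q with inl i => inl (inl i) | inr k => inr (inr k) end.

Definition outer_inv (x : glued) : option (bpoint m p) :=
  match x with inl (inl i) => Some (inl i) | inr (inr k) => Some (inr k) | _ => None end.

Lemma outerK : pcancel outer outer_inv. Proof. by case. Qed.

Lemma alive_outer x : x \in alive n -> exists q, x = outer q.
Proof.
rewrite inE; case: x => [[i|i]|[i|i]] /= h; [by exists (inl i)| | |by exists (inr i)].
  by rewrite leqNgt ltn_ord in h.
by rewrite leqNgt ltn_ord in h.
Qed.

Lemma outer_alive q : outer q \in alive n.
Proof. by case: q => i; rewrite inE. Qed.

Lemma glued_rk_outer q r : (glued_rk (outer q) < glued_rk (outer r))%N = (rim q < rim r)%N.
Proof. by case: q => i; case: r => j /=; have := ltn_ord i; have := ltn_ord j; lia. Qed.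

Definition set_mid (st : glued -> bool) (k : nat) (a b : bool) : glued -> bool := fun x =>
  match x with
  | inl (inr i) => if i == k :> nat then a else st x
  | inr (inl i) => if i == k :> nat then b else st x
  | _ => st x
  end.

Fixpoint capsum (K : comRingType) (M : model K) k (W : (glued -> bool) -> K) (st : glued -> bool) : K :=
  if k is k'.+1 then \sum_a \sum_b cw M a b * capsum M k' W (set_mid st k' a b) else W st.

Lemma capsum_wt k : (k <= n)%N -> exists D L, nc_matching glued_rk (alive k) D /\
  forall (K : comRingType) (M : model K) st,
    capsum M k (wt glued_rk M [set: glued] glued_match) st = loopw M ^+ L * wt glued_rk M (alive k) D st.
Proof.
elim: k => [_|k IHk kn].
  exists glued_match, 0%N; rewrite alive0; split; first exact: glued_nc_matching.
  by move=> K M st; rewrite mul1r.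
have [D [L [Dnc DE]]] := IHk (ltnW kn); pose ko := Ordinal kn.
have lok : lo ko \in alive k by rewrite inE /=.
have hik : hi ko \in alive k by rewrite inE /=.
have lh : (glued_rk (lo ko) < glued_rk (hi ko))%N by rewrite /=; lia.
have adj : adjacent glued_rk (alive k) (lo ko) (hi ko).
  move=> x; rewrite inE; case: x => [[i|i]|[i|i]] /=; have := ltn_ord i; lia.
exists (capD D (lo ko) (hi ko)), (if D (lo ko) == hi ko then L.+1 else L); split.
  by rewrite (aliveS ko); exact: (capD_matching glued_rk_inj Dnc lok hik lh adj).
move=> K M st; rewrite (aliveS ko) /=.
have setE a b : set_mid st k a b = upd st (lo ko) (hi ko) a b.
  by apply/funext => -[[i|i]|[i|i]]; rewrite /upd //= -[inl _ == _]/(i == ko) -[inr _ == _]/(i == ko).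
under eq_bigr => a _ do under eq_bigr => b _ do rewrite setE DE mulrCA.
under eq_bigr => a _ do rewrite -big_distrr /=.
rewrite -big_distrr /= (wt_cap glued_rk_inj Dnc lok hik lh adj) mulrA; congr (_ * _).
by case: ifP; rewrite ?mulr1 // exprSr.
Qed.

(** The order of quantifiers matters: the diagram and the loop exponent are found before the model,
    so they may be identified afterwards with a convenient one. *)
Lemma glue : exists (d : tldiag m p) L, forall (K : comRingType) (M : model K) st,
  capsum M n (wt glued_rk M [set: glued] glued_match) st = loopw M ^+ L * wtd M d (st \o outer).
Proof.
have [D [L [[mD nD] DE]]] := capsum_wt (leqnn n).
have Do q : exists r, D (outer q) = outer r.
  by have [/alive_outer] := mD _ (outer_alive q).
pose f q := odflt q (outer_inv (D (outer q))).
have fE q : outer (f q) = D (outer q) by have [r Dq] := Do q; rewrite /f Dq outerK.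
have oI := pcan_inj outerK.
have [|d dE] := @nc_matching_tldiag m p f.
  split=> [q _|q r _ _ qr qfr].
    have [_ DD Dn] := mD _ (outer_alive q); rewrite inE; split=> //.
      by apply: oI; rewrite !fE.
    by rewrite -(inj_eq oI) fE.
  have := nD _ _ (outer_alive q) (outer_alive r).
  rewrite (inj_eq oI) qr -fE (inj_eq oI) => /(_ isT qfr).
  by rewrite -fE /btw !glued_rk_outer.
exists d, L => K M st; rewrite DE; congr (_ * _); rewrite /wt /wtd.
have -> : alive n = outer @: [set: bpoint m p].
  apply/setP => x; apply/idP/imsetP => [/alive_outer[q ->]|[q _ ->]]; last exact: outer_alive.
  by exists q.
rewrite big_imset; last by move=> ? ? _ _ /oI.
by apply: eq_big => [q|q _]; rewrite ?inE // -fE glued_rk_outer /= dE.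
Qed.

Lemma wt_glued (K : comRingType) (M : model K) st :
  wt glued_rk M [set: glued] glued_match st =
  wtd M d2 (fun q => st (inl q)) * wtd M d1 (fun q => st (inr q)).
Proof.
rewrite /wt /wtd (eq_bigl predT) => [|x]; last by rewrite inE.
rewrite big_sumType /=; congr (_ * _).
by apply: eq_bigr => q _; rewrite ltn_add2l.
Qed.

End Gluing.

(** * Sums over strand states *)

Section SumOverBits.
Variable K : comRingType.

Fixpoint bsum n (F : seq bool -> K) : K :=
  if n is n'.+1 then \sum_b bsum n' (fun s => F (b :: s)) else F [::].

Lemma eq_bsum n F G : (forall s, size s = n -> F s = G s) -> bsum n F = bsum n G.
Proof.
elim: n F G => [|n IHn] F G FG /=; first exact: FG.
by apply: eq_bigr => b _; apply: IHn => s sn; apply: FG; rewrite /= sn.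
Qed.

Lemma bsumS_rcons n F : bsum n.+1 F = \sum_b bsum n (fun s => F (rcons s b)).
Proof.
elim: n F => [//|n IHn] F.
have -> : bsum n.+2 F = \sum_b bsum n.+1 (fun s => F (b :: s)) by [].
under eq_bigr => b _ do rewrite IHn.
by rewrite exchange_big.
Qed.

Lemma bsum_tuple n F : bsum n F = \sum_(s : n.-tuple bool) F s.
Proof.
elim: n F => [|n IHn] F /=.
  by rewrite (big_pred1 [tuple]) // => s; apply/esym/eqP; exact: tuple0.
under eq_bigr => b _ do rewrite IHn.
rewrite pair_big /= (reindex (fun p : bool * n.-tuple bool => [tuple of p.1 :: p.2])) //=.
exists (fun s : n.+1.-tuple bool => (thead s, [tuple of behead s])) => [[b s] _|s _] /=.
  by congr pair; apply: val_inj.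
by rewrite -tuple_eta.
Qed.

Lemma bsum_cat n1 n2 F : bsum (n1 + n2) F = bsum n1 (fun s => bsum n2 (fun r => F (s ++ r))).
Proof. by elim: n1 F => [//|n1 IHn] F /=; apply: eq_bigr => b _; rewrite IHn. Qed.

Lemma bsumD n F G : bsum n (fun s => F s + G s) = bsum n F + bsum n G.
Proof.
elim: n F G => [//|n IHn] F G /=; rewrite -big_split /=.
by apply: eq_bigr => b _; rewrite IHn.
Qed.

Lemma bsumZ n c F : bsum n (fun s => c * F s) = c * bsum n F.
Proof.
elim: n F => [//|n IHn] F /=; rewrite big_distrr /=.
by apply: eq_bigr => b _; rewrite IHn.
Qed.

Lemma bsum0 n : bsum n (fun=> 0) = 0.
Proof. by elim: n => //= n ->; rewrite big1. Qed.

Lemma bsum_sum n I (r : seq I) (F : I -> seq bool -> K) :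
  bsum n (fun s => \sum_(i <- r) F i s) = \sum_(i <- r) bsum n (F i).
Proof.
elim: r => [|i r IHr]; first by rewrite big_nil -[RHS](bsum0 n); apply: eq_bsum => s _; rewrite big_nil.
by rewrite big_cons -IHr -bsumD; apply: eq_bsum => s _; rewrite big_cons.
Qed.

Lemma exchange_bsum n1 n2 F :
  bsum n1 (fun s => bsum n2 (fun r => F s r)) = bsum n2 (fun r => bsum n1 (fun s => F s r)).
Proof.
elim: n1 F => [//|n1 IHn] F /=; rewrite -[index_enum _]/(index_enum _).
by rewrite bsum_sum; apply: eq_bigr => b _; rewrite IHn.
Qed.

Lemma bsum_delta n (r : seq bool) F : size r = n ->
  bsum n (fun s => (s == r)%:R * F s) = F r.
Proof.
elim: n r F => [|n IHn] [|b r] F //= => [_|[sr]]; first by rewrite mul1r.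
rewrite (bigD1 b) //= [X in _ + X]big1 ?addr0 => [|b' /negPf bb'].
  rewrite -[RHS](IHn r (fun s => F (b :: s)) sr); apply: eq_bsum => s _.
  by rewrite eqseq_cons eqxx.
rewrite -[RHS](bsum0 n); apply: eq_bsum => s _.
by rewrite eqseq_cons bb' mul0r.
Qed.

End SumOverBits.

(** * Composite diagram and loop count from two-colourings *)

Section Expansion.
Variables (m n p : nat) (d1 : tldiag n p) (d2 : tldiag m n).

(* The middle points are given states by [s], up to [phi] on the lower side. *)
Definition set_mids (phi : bool -> bool) (st : glued m n p -> bool) (s : seq bool) : glued m n p -> bool :=
  fun x => match x with
  | inl (inr i) => if (i < size s)%N then phi (nth false s i) else st x
  | inr (inl i) => if (i < size s)%N then nth false s i else st x
  | _ => st x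
  end.

Lemma capsum_expand (K : comRingType) (M : model K) phi (gam : bool -> K) k W st :
  (forall a b, cw M a b = (a == phi b)%:R * gam b) ->
  @capsum m n p K M k W st =
  bsum k (fun s => \prod_(b <- s) gam b * W (set_mids phi st s)).
Proof.
move=> cwE; elim: k st => [|k IHk] st.
  rewrite /= big_nil mul1r; congr W; apply/funext => x.
  by case: x => [[i|i]|[i|i]].
rewrite bsumS_rcons [LHS]/= exchange_big /=; apply: eq_bigr => b _.
rewrite (bigD1 (phi b)) //= big1 ?addr0 => [|a /negPf ab]; last by rewrite cwE ab mul0r mul0r.
rewrite cwE eqxx mul1r IHk -bsumZ; apply: eq_bsum => s sk.
rewrite big_rcons /= mulrA [gam b * _]mulrC; congr (_ * W _).
apply/funext => x; case: x => [[i|i]|[i|i]] //=; rewrite size_rcons nth_rcons sk ltnS (leq_eqVlt i k);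
  by case: (ltngtP i k).
Qed.

End Expansion.

(** Counts colourings by two colours that are constant along strands. A loop contributes 2, so its
    exponent can be recovered from the value. *)
Definition const_model : model int.
Proof.
refine (@Model _ (fun _ s s' => (s == s')%:R) (fun a b => (a == b)%:R) 2 _ _ _ _);
  by [rewrite !big_bool|move=> [] []; rewrite !big_bool].
Defined.

Section StackAndLoops.
Variables (m n p : nat) (d1 : tldiag n p) (d2 : tldiag m n).
Local Notation adjg := (glue_adj d1 d2).

Definition mid_state (st : bpoint m p -> bool) (s : seq bool) : {ffun glue_point m n p -> bool} :=
  [ffun x : glue_point m n p => match x with
   | inl (inl i) => st (inl i) | inl (inr j) => nth false s j | inr k => st (inr k) end].

Definition constant_on (tau : {ffun glue_point m n p -> bool}) : bool :=
  [forall x, forall y, adjg x y ==> (tau x == tau y)].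

Lemma constant_onP (tau : {ffun glue_point m n p -> bool}) :
  reflect ((forall q, tau (glue_low p q) = tau (glue_low p (d2 q))) /\
           (forall q, tau (glue_high m q) = tau (glue_high m (d1 q)))) (constant_on tau).
Proof.
apply: (iffP forallP) => [H|[H1 H2] x].
  by split=> q; apply/eqP; [have /forallP/(_ (glue_low p (d2 q)))/implyP := H (glue_low p q)
      |have /forallP/(_ (glue_high m (d1 q)))/implyP := H (glue_high m q)]; apply;
    apply/orP; [left|right]; apply/existsP; exists q; rewrite !eqxx.
apply/forallP => y; apply/implyP => /orP[] /existsP[q /andP[/eqP -> /eqP ->]].
  by rewrite H1.
by rewrite H2.
Qed.

Definition extensions (st : bpoint m p -> bool) : {set {ffun glue_point m n p -> bool}} :=
  [set tau | constant_on tau & [forall q, tau (glue_outer n q) == st q]].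

Lemma natrb_and (I : finType) (P : pred I) : \prod_i (P i)%:R = [forall i, P i]%:R :> int.
Proof.
case: (boolP [forall i, P i]) => [/forallP H|].
  by apply: big1 => i _; rewrite H.
by rewrite negb_forall => /existsP[i /negPf Pi]; rewrite (bigD1 i) //= Pi mul0r.
Qed.

Lemma capsum_extensions (st : bpoint m p -> bool) (st' : glued m n p -> bool) :
  (forall q, st' (outer n q) = st q) ->
  capsum const_model n (wt (@glued_rk m n p) const_model [set: glued m n p] (glued_match d1 d2)) st' =
  #|extensions st|%:R.
Proof.
move=> stE; rewrite (@capsum_expand _ _ _ _ _ id (fun=> 1)) => [|a b]; last by rewrite mulr1.
rewrite bsum_tuple.
have msI : injective (fun s : n.-tuple bool => mid_state st s).
  move=> s r /ffunP E; apply: eq_from_tnth => i; rewrite !(tnth_nth false).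
  by have := E (inl (inr i)); rewrite !ffunE.
have -> : extensions st = [set mid_state st s | s : n.-tuple bool & constant_on (mid_state st s)].
  apply/setP => tau; rewrite inE; apply/andP/imsetP.
    move=> [ct /forallP to].
    have tE : mid_state st [tuple tau (inl (inr i)) | i < n] = tau.
      apply/ffunP => x; rewrite ffunE; case: x => [[i|j]|k].
      - by have /eqP := to (inl i).
      - by rewrite -(tnth_nth _ [tuple tau (inl (inr i)) | i < n] j) tnth_mktuple.
      - by have /eqP := to (inr k).
    by exists [tuple tau (inl (inr i)) | i < n]; rewrite ?inE tE.
  by move=> [s]; rewrite inE => cs ->; split=> //; apply/forallP => -[i|i]; rewrite ffunE.
rewrite card_imset // -sum1_card [in RHS]big_mkcond natr_sum.
apply: eq_bigr => s _; rewrite big1 // mul1r wt_glued /wtd /= !natrb_and -natrM mulnb inE.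
have lowE q : mid_state st s (glue_low p q) = set_mids id st' s (inl q).
  by case: q => i; rewrite ffunE /= ?size_tuple ?ltn_ord // (stE (inl i)).
have highE q : mid_state st s (glue_high m q) = set_mids id st' s (inr q).
  by case: q => i; rewrite ffunE /= ?size_tuple ?ltn_ord // (stE (inr i)).
have -> : constant_on (mid_state st s) =
    [forall q, set_mids id st' s (inl q) == set_mids id st' s (inl (d2 q))] &&
    [forall q, set_mids id st' s (inr q) == set_mids id st' s (inr (d1 q))].
  apply/constant_onP/andP => [[H1 H2]|[/forallP H1 /forallP H2]].
    by split; apply/forallP => q; rewrite -?lowE -?highE (H1, H2).
  by split=> q; rewrite ?lowE ?highE; apply/eqP.
by case: (_ && _).
Qed.

Lemma glue_adj_sym : connect_sym adjg.
Proof.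
apply: sym_connect_sym => x y; apply/idP/idP => /orP[] /existsP[q /andP[/eqP -> /eqP ->]];
  apply/orP; [left|right|left|right]; apply/existsP.
all: by [exists (d2 q); have [-> _] := tldiagP d2 q; rewrite !eqxx
        |exists (d1 q); have [-> _] := tldiagP d1 q; rewrite !eqxx].
Qed.

Lemma constant_connect (tau : {ffun glue_point m n p -> bool}) x y :
  constant_on tau -> connect adjg x y -> tau x = tau y.
Proof.
move=> /forallP H /connectP[q]; elim: q x => [|z q IHq] x /=; first by move=> _ ->.
by move=> /andP[xz zq] /(IHq z zq) <-; apply/eqP; have /forallP/(_ z)/implyP := H x; apply.
Qed.

(** A constant colouring supported on a closed set is a free choice of one colour on each of its
    components. *)
Lemma card_constant (a : pred (glue_point m n p)) : closed adjg a ->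
  #|[set tau : {ffun glue_point m n p -> bool} | constant_on tau & [forall x, ~~ a x ==> ~~ tau x]]| =
  (2 ^ n_comp adjg a)%N.
Proof.
move=> ca; have as_ := glue_adj_sym.
pose r := [set x | roots adjg x && a x].
have rE : n_comp adjg a = #|r| by apply: eq_card => x; rewrite !inE.
rewrite rE -card_powerset.
pose f (S : {set glue_point m n p}) := [ffun x => fingraph.root adjg x \in S].
have fI : {in powerset r &, injective f}.
  move=> S S'; rewrite !inE => /subsetP Sr /subsetP S'r /ffunP E; apply/setP => x.
  have [xr|xr] := boolP (roots adjg x).
    by have := E x; rewrite !ffunE (eqP xr).
  by rewrite (contraNF (Sr x)) ?(contraNF (S'r x)) // inE (negPf xr).
rewrite -(card_in_imset fI); apply: eq_card => tau; rewrite inE; apply/andP/imsetP.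
  move=> [ct /forallP ta]; exists [set x | roots adjg x && tau x].
    rewrite inE; apply/subsetP => x; rewrite !inE => /andP[-> tx] /=.
    by apply: contraLR (tx); have /implyP := ta x.
  apply/ffunP => x; rewrite ffunE inE (roots_root as_) /=.
  exact: constant_connect ct (connect_root _ _).
move=> [S]; rewrite inE => /subsetP Sr ->; split.
  apply/forallP => x; apply/forallP => y; apply/implyP => xy; rewrite !ffunE.
  by rewrite (eqP (_ : fingraph.root adjg x == fingraph.root adjg y)) // (root_connect as_) connect1.
apply/forallP => x; apply/implyP; apply: contraNN; rewrite ffunE => /Sr; rewrite inE => /andP[_].
by rewrite -[a (fingraph.root _ _)]/(fingraph.root adjg x \in a) -(closed_connect ca (connect_root _ _)).
Qed.

(* The state sum for constant colourings determines the composite diagram and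
   its number of closed loops. *)
Lemma glue_stack : exists d : tldiag m p,
  (forall d', is_stack d1 d2 d' = (d' == d)) /\
  forall (K : comRingType) (M : model K) st,
    capsum M n (wt (@glued_rk m n p) M [set: glued m n p] (glued_match d1 d2)) st =
    loopw M ^+ nloops d1 d2 * wtd M d (st \o @outer m n p).
Proof.
have [d [L dE]] := glue d1 d2; exists d.
pose ext (st : bpoint m p -> bool) (x : glued m n p) : bool := odflt false (omap st (outer_inv x)).
have extE st q : ext st (outer n q) = st q by rewrite /ext outerK.
have extN st : #|extensions st|%:R = 2 ^+ L * [forall q, st q == st (d q)]%:R :> int.
  rewrite -(capsum_extensions (extE st)) dE /wtd /= natrb_and; congr (_ * (_ : bool)%:R).
  by apply: eq_forallb => q; rewrite !extE.
have extP st : (exists tau, constant_on tau /\ forall q, tau (glue_outer n q) = st q) <->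
    forall q, st q = st (d q).
  have := extN st; case: (boolP [forall q, _]) => [/forallP H|H] E; split=> //.
  - by move=> _ q; apply/eqP.
  - move=> _; have : (0 < #|extensions st|)%N.
      by rewrite -(ltr_nat int) E mulr1 exprn_gt0.
    by move=> /card_gt0P[tau]; rewrite inE => /andP[ct /forallP to]; exists tau; split=> // q; apply/eqP.
  - move=> [tau [ct to]]; have : tau \in extensions st.
      by rewrite inE ct; apply/forallP => q; rewrite to.
    move: E; rewrite mulr0 => /eqP; rewrite pnatr_eq0 cards_eq0 => /eqP ->; by rewrite inE.
  - by move=> H'; case/negP: H; apply/forallP => q; apply/eqP.
(* The indicator of {q, d q} extends to a colouring, so q is connected to no other boundary point.
   Conversely the indicator of the component of q is a colouring, so that component contains d q. *)
have stackP q r : connect adjg (glue_outer n q) (glue_outer n r) = (r == q) || (r == d q).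
  apply/idP/idP.
    move=> qr; have [|tau [ct to]] := (extP (fun r => (r == q) || (r == d q))).2.
      move=> r'; have [dd _] := tldiagP d r'; have [ddq _] := tldiagP d q.
      rewrite -[d r' == d q](inj_eq (can_inj (fun z => (tldiagP d z).1))) dd.
      by rewrite -[r' == d q](inj_eq (can_inj (fun z => (tldiagP d z).1))) ddq orbC.
    have := constant_connect ct qr; rewrite !to eqxx /= => <- //.
  move=> /orP[/eqP -> //|/eqP ->].
  pose tau := [ffun x => connect adjg (glue_outer n q) x].
  have ct : constant_on tau.
    apply/forallP => x; apply/forallP => y; apply/implyP => xy; rewrite !ffunE.
    by rewrite (same_connect_r glue_adj_sym (connect1 xy)).
  have := (extP (fun r => tau (glue_outer n r))).1 _ q; rewrite !ffunE connect0 => <- //.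
  by exists tau.
split=> [d'|K M st].
  apply/forallP/eqP => [H|-> q]; last by rewrite stackP eqxx orbT.
  apply: tldiag_eqP => q; have := H q; rewrite stackP.
  by have [_ /negPf ->] := tldiagP d' q => /eqP.
rewrite dE; congr (loopw M ^+ _ * _).
pose a := [pred x | [forall q, ~~ connect adjg (glue_outer n q) x]].
have ca : closed adjg a.
  move=> x y xy; rewrite !inE; apply: eq_forallb => q.
  by rewrite (same_connect_r glue_adj_sym (connect1 xy)).
(* Colourings vanishing on the boundary number 2^L by the state sum, and 2^nloops by counting
   components off the boundary. *)
have := extN (fun=> false); rewrite (_ : [forall q, _] = true); last by apply/forallP.
rewrite mulr1 -natrX => /eqP; rewrite eqr_nat.
suff -> : extensions (fun=> false) =
    [set tau : {ffun glue_point m n p -> bool} | constant_on tau & [forall x, ~~ a x ==> ~~ tau x]].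
  by rewrite card_constant // eqn_exp2l // => /eqP <-.
apply/setP => tau; rewrite !inE; apply: andb_id2l => ct.
apply/forallP/forallP => [H x|H q].
  apply/implyP; rewrite negb_forall => /existsP[q]; rewrite negbK => /(constant_connect ct) <-.
  by rewrite (eqP (H q)).
have /implyP := H (glue_outer n q); rewrite eqbF_neg; apply.
by rewrite negb_forall; apply/existsP; exists q; rewrite negbK connect0.
Qed.

End StackAndLoops.

(** * The spin weights *)

Lemma prod_involution (K : comRingType) (I : finType) (d : I -> I) (r : I -> nat) (F G : I -> K) :
  injective r -> involutive d -> (forall x, d x != x) ->
  (forall x, F x * F (d x) = G x * G (d x)) -> \prod_x F x = \prod_x G x.
Proof.
move=> rI dI dn FG.
have pairs H : \prod_x H x = \prod_(x | (r x < r (d x))%N) (H x * H (d x)) :> K.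
  rewrite (bigID (fun x => (r x < r (d x))%N)) big_split /=; congr (_ * _).
  rewrite (reindex_inj (can_inj dI)) /=; apply: eq_bigl => x.
  by rewrite dI -leqNgt leq_eqVlt (inj_eq rI) eq_sym (negPf (dn x)).
by rewrite !pairs; apply: eq_bigr => x _.
Qed.

Section SpinModel.
Variables (K : fieldType) (w : K).
Hypothesis w0 : w != 0.

(** Only the end in state [true] carries a weight, so a pair weighs w for the states up, down from
    left to right and w^-1 for down, up. *)
Definition spin_pw (lt s s' : bool) : K :=
  if s == s' then 0 else if s then (if lt then w else w^-1) else 1.

Definition kap (b : bool) : K := if b then w else w^-1.

Lemma kap0 b : kap b != 0.
Proof. by case: b; rewrite /kap ?invr_eq0. Qed.

Definition spin_model : model K.
Proof.
refine (@Model _ spin_pw (fun a b => (a == ~~ b)%:R * kap (~~ b)) (w ^+ 2 + w ^- 2) _ _ _ _);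
  first by rewrite !big_bool /spin_pw /kap /=; field.
all: by move=> [] []; rewrite !big_bool /spin_pw /kap /=; field.
Defined.

Definition strand_weight m n (q r : bpoint m n) (s s' : bool) : K :=
  match q, r with
  | inl i, inl j => spin_pw (i < j)%N s s'
  | inr i, inr j => spin_pw (i < j)%N s s'
  | _, _ => (s == s')%:R
  end.

Definition diagram_weight m n (d : tldiag m n) (st : bpoint m n -> bool) : K :=
  \prod_q strand_weight q (d q) (st q) (st (d q)).

(* Bending the top boundary down to the bottom line reverses the orientation
   of the top states. *)
Definition bend m n (st : bpoint m n -> bool) (q : bpoint m n) : bool :=
  if q is inr _ then ~~ st q else st q.

(** A bent through strand weighs [kap] of its state. A bottom pair has opposite states, whose [kap]
    factors cancel. A top pair is reversed both in order and in states, so its weight does not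
    change. *)
Lemma wtd_bend m n (d : tldiag m n) (st : bpoint m n -> bool) :
  wtd spin_model d (bend st) = diagram_weight d st * \prod_(i < m) kap (st (inl i)).
Proof.
pose G (q : bpoint m n) := strand_weight q (d q) (st q) (st (d q)) *
  (if q is inl _ then kap (st q) else 1).
have -> : diagram_weight d st * \prod_(i < m) kap (st (inl i)) = \prod_q G q.
  rewrite /G big_split /=; congr (_ * _).
  by rewrite big_sumType /= [X in _ * X]big1 ?mulr1.
apply: (@prod_involution _ _ d (@rim m n)); first exact: rim_inj.
- by move=> q; have [] := tldiagP d q.
- by move=> q; have [] := tldiagP d q.
move=> q; have [dd dn] := tldiagP d q; rewrite /G dd.
move: dn {dd}; case: q => [i|i]; case: (d _) => [j|j] /= dn; rewrite /spin_pw /kap.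
- have ij : (j : nat) != i by apply: contraNneq dn => /val_inj ->.
  by case: (ltngtP i j) ij => //= _ _; case: (st (inl i)); case: (st (inl j)) => //=; field.
- have ij : (i < m + (n - j.+1))%N by have := ltn_ord i; lia.
  rewrite ij ltnNge (ltnW ij) /=.
  by case: (st (inl i)); case: (st (inr j)) => //=; rewrite ?mulr1 ?mul1r ?mulr0 ?mul0r.
- have ij : (j < m + (n - i.+1))%N by have := ltn_ord j; lia.
  rewrite ij ltnNge (ltnW ij) /=.
  by case: (st (inl j)); case: (st (inr i)) => //=; rewrite ?mulr1 ?mul1r ?mulr0 ?mul0r.
- have ij : (j : nat) != i by apply: contraNneq dn => /val_inj ->.
  have -> : (m + (n - i.+1) < m + (n - j.+1))%N = (j < i)%N by have := ltn_ord i; have := ltn_ord j; lia.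
  have -> : (m + (n - j.+1) < m + (n - i.+1))%N = (i < j)%N by have := ltn_ord i; have := ltn_ord j; lia.
  by case: (ltngtP i j) ij => //= _ _; case: (st (inr i)); case: (st (inr j)) => //=; ring.
Qed.

Definition point_state m n (b t : seq bool) (q : bpoint m n) : bool :=
  match q with inl i => nth false b i | inr j => nth false t j end.

Definition amplitude m n (d : tldiag m n) (b t : seq bool) : K :=
  diagram_weight d (point_state b t).

Lemma eq_wtd m n (M : model K) (d : tldiag m n) st st' : (forall q, st q = st' q) ->
  wtd M d st = wtd M d st'.
Proof. by move=> E; apply: eq_bigr => q _; rewrite !E. Qed.

(** The top of d2 is bent, hence [negb] on the lower copies. The factors [kap (~~ b)] of the
    contraction cancel the bottom factors of d1 from [wtd_bend], and stacking becomes matrix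
    multiplication. *)
Lemma amplitude_stack m n p (d1 : tldiag n p) (d2 : tldiag m n) :
  exists d : tldiag m p, (forall d', is_stack d1 d2 d' = (d' == d)) /\
  forall b t, bsum n (fun s => amplitude d1 s t * amplitude d2 b s) =
     (w ^+ 2 + w ^- 2) ^+ nloops d1 d2 * amplitude d b t.
Proof.
have [d [dP dE]] := glue_stack d1 d2; exists d; split=> // b t.
pose st (x : glued m n p) : bool := match x with
  inl (inl i) => nth false b i | inr (inr k) => ~~ nth false t k | _ => false end.
have {dE} := dE K spin_model st.
rewrite (@capsum_expand _ _ _ _ _ negb (fun b => kap (~~ b))) => [|? ?]; last by [].
have kb0 : \prod_(i < m) kap (nth false b i) != 0.
  by apply/prodf_neq0 => i _; exact: kap0.
have -> : wtd spin_model d (st \o @outer m n p) = amplitude d b t * \prod_(i < m) kap (nth false b i).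
  by rewrite -wtd_bend; apply: eq_wtd => -[i|i].
rewrite mulrA => E; apply: (mulIf kb0); rewrite -E mulrC -bsumZ; apply: eq_bsum => s sn.
rewrite wt_glued.
have -> : wtd spin_model d2 (fun q => set_mids negb st s (inl q)) =
    amplitude d2 b s * \prod_(i < m) kap (nth false b i).
  by rewrite -wtd_bend; apply: eq_wtd => -[i|i] //=; rewrite sn ltn_ord.
have -> : wtd spin_model d1 (fun q => set_mids negb st s (inr q)) =
    amplitude d1 s t * \prod_(i < n) kap (nth false s i).
  by rewrite -wtd_bend; apply: eq_wtd => -[i|i] //=; rewrite sn ltn_ord.
have -> : \prod_(c <- s) kap (~~ c) = (\prod_(i < n) kap (nth false s i))^-1.
  rewrite (big_nth false) big_mkord sn -prodfV; apply: eq_bigr => i _.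
  by rewrite /kap; case: nth; rewrite ?invrK.
have ks0 : \prod_(i < n) kap (nth false s i) != 0 by apply/prodf_neq0 => i _; exact: kap0.
by field.
Qed.

End SpinModel.

(** * Juxtaposition, reflection, identity and cup as unique diagrams *)

Section JuxtapositionDiagram.
Local Open Scope nat_scope.
Variables m n m' n' : nat.
Local Notation lp := (@left_point m n m' n').
Local Notation rp := (@right_point m n m' n').

Lemma juxt_pointP (q : bpoint (m + m') (n + n')) :
  (exists r, q = lp r) \/ (exists r, q = rp r).
Proof.
case: q => i; case: (split_ordP i) => j ->.
- by left; exists (inl j).
- by right; exists (inl j).
- by left; exists (inr j).
- by right; exists (inr j).
Qed.

Lemma rim_left q r : (rim (lp q) < rim (lp r)) = (rim q < rim r).
Proof. by case: q => i; case: r => j /=; have := ltn_ord i; have := ltn_ord j; lia. Qed.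

Lemma rim_right q r : (rim (rp q) < rim (rp r)) = (rim q < rim r).
Proof. by case: q => i; case: r => j /=; have := ltn_ord i; have := ltn_ord j; lia. Qed.

Lemma left_point_inj : injective lp.
Proof. by move=> q r E; apply: (@rim_inj m n q r); case: (ltngtP (rim q) (rim r)); rewrite // -rim_left E ltnn. Qed.

Lemma right_point_inj : injective rp.
Proof. by move=> q r E; apply: (@rim_inj m' n' q r); case: (ltngtP (rim q) (rim r)); rewrite // -rim_right E ltnn. Qed.

Lemma rim_left_out q : rim (lp q) < m \/ m + m' + n' <= rim (lp q).
Proof. by case: q => i /=; have := ltn_ord i; lia. Qed.

Lemma rim_right_in q : m <= rim (rp q) < m + m' + n'.
Proof. by case: q => i /=; have := ltn_ord i; lia. Qed.

(** On the rim the right diagram occupies an interval and the left one its complement, so no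
    crossing arises. Uniqueness collapses the relational sum in [rjuxt] to one term. *)
Lemma is_juxt_unique (d1 : tldiag m n) (d2 : tldiag m' n') :
  exists d, forall d', is_juxt d1 d2 d' = (d' == d).
Proof.
pose f (q : bpoint (m + m') (n + n')) : bpoint (m + m') (n + n') :=
  match q with
  | inl i => match split i with inl i' => lp (d1 (inl i')) | inr i' => rp (d2 (inl i')) end
  | inr j => match split j with inl j' => lp (d1 (inr j')) | inr j' => rp (d2 (inr j')) end
  end.
have fl q : f (lp q) = lp (d1 q).
  by case: q => i /=; rewrite -[lshift _ i]/(unsplit (inl i)) unsplitK.
have fr q : f (rp q) = rp (d2 q).
  by case: q => i /=; rewrite -[rshift _ i]/(unsplit (inr i)) unsplitK.
have [m1 n1] := tldiag_nc_matching d1; have [m2 n2] := tldiag_nc_matching d2.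
have out a b : b < m \/ m + m' + n' <= b -> m <= a < m + m' + n' ->
    ((a < b) = (m < b)) * ((b < a) = (b < m)).
  by move=> [h|h] /andP[h1 h2]; split; lia.
have [|d dE] := @nc_matching_tldiag (m + m') (n + n') f.
  split=> [q _|x y _ _].
    rewrite inE; case: (juxt_pointP q) => -[r ->]; rewrite !(fl, fr).
      by have [_ -> dn] := m1 r (in_setT _); rewrite (inj_eq left_point_inj).
    by have [_ -> dn] := m2 r (in_setT _); rewrite (inj_eq right_point_inj).
  case: (juxt_pointP x) => -[q ->]; case: (juxt_pointP y) => -[r ->]; rewrite !(fl, fr).
  - rewrite !(inj_eq left_point_inj) => qr qdr.
    by have := n1 q r (in_setT _) (in_setT _) qr qdr; rewrite /btw !rim_left.
  - move=> _ _; have ir := rim_right_in r; have idr := rim_right_in (d2 r).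
    have no a : (m < a < m) || (m < a < m) = false by lia.
    by rewrite /btw !(out _ _ (rim_left_out q) ir) !(out _ _ (rim_left_out q) idr) no
      !(out _ _ (rim_left_out (d1 q)) ir) !(out _ _ (rim_left_out (d1 q)) idr) no.
  - move=> _ _.
    rewrite /btw; have oq := rim_right_in q; have odq := rim_right_in (d2 q).
    by rewrite !(out _ _ (rim_left_out r) oq) !(out _ _ (rim_left_out r) odq)
      !(out _ _ (rim_left_out (d1 r)) oq) !(out _ _ (rim_left_out (d1 r)) odq).
  - rewrite !(inj_eq right_point_inj) => qr qdr.
    by have := n2 q r (in_setT _) (in_setT _) qr qdr; rewrite /btw !rim_right.
exists d => d'; apply/andP/eqP => [[/forallP H1 /forallP H2]|->].
  apply: tldiag_eqP => q; rewrite dE; case: (juxt_pointP q) => -[r ->].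
    by rewrite fl; apply/eqP.
  by rewrite fr; apply/eqP.
by split; apply/forallP => q; rewrite dE ?fl ?fr.
Qed.

End JuxtapositionDiagram.

Lemma flip_pointK m n : cancel (@flip_point m n) (@flip_point n m).
Proof. by case. Qed.

Lemma rim_flip m n (q r : bpoint m n) : (rim (flip_point q) < rim (flip_point r))%N = (rim r < rim q)%N.
Proof. by case: q => i; case: r => j /=; have := ltn_ord i; have := ltn_ord j; lia. Qed.

Lemma btw_flip m n (q r s : bpoint m n) :
  btw (@rim n m) (flip_point q) (flip_point r) (flip_point s) = btw (@rim m n) q r s.
Proof. by rewrite /btw !rim_flip orbC andbC [X in _ || X]andbC. Qed.

Lemma is_flip_unique m n (d : tldiag m n) : exists d', forall d'', is_flip d d'' = (d'' == d').
Proof.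
pose f (q : bpoint n m) : bpoint n m := flip_point (d (flip_point q)).
have [md nd] := tldiag_nc_matching d.
have [|d' dE] := @nc_matching_tldiag n m f.
  split=> [q _|q r _ _ qr qfr].
    have [_ dd dn] := md (flip_point q) (in_setT _).
    rewrite inE /f flip_pointK dd flip_pointK; split=> //.
    by rewrite -[X in _ != X](flip_pointK q) (inj_eq (can_inj (@flip_pointK _ _))).
  move: qr qfr; rewrite /f -[q]flip_pointK -[r]flip_pointK.
  move: (flip_point q) (flip_point r) => q' r'; rewrite !flip_pointK !btw_flip.
  rewrite !(inj_eq (can_inj (@flip_pointK _ _))); exact: nd.
exists d' => d''; apply/forallP/eqP => [H|-> q]; last by rewrite dE /f flip_pointK.
by apply: tldiag_eqP => q; have /eqP := H (flip_point q); rewrite flip_pointK dE.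
Qed.

Lemma is_id_unique n : exists d : tldiag n n, forall d' : tldiag n n,
  [forall i : 'I_n, d' (inl i) == inr i] = (d' == d).
Proof.
pose f (q : bpoint n n) := flip_point q.
have [|d dE] := @nc_matching_tldiag n n f.
  split=> [q _|q r _ _]; first by rewrite inE /f flip_pointK; split=> //; case: q.
  by case: q => i; case: r => j /=; rewrite /btw /= => /eqP + /eqP; have := ltn_ord i; have := ltn_ord j; lia.
exists d => d'; apply/forallP/eqP => [H|-> i]; last by rewrite dE.
apply: tldiag_eqP => -[i|i]; rewrite dE /f /=; have /eqP E := H i; first by [].
by rewrite -E (tldiagP d' (inl i)).1.
Qed.

Lemma is_cup_unique : exists d : tldiag 0 2, forall d' : tldiag 0 2,
  (d' (inr ord0) == inr ord_max) = (d' == d).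
Proof.
pose f (q : bpoint 0 2) : bpoint 0 2 := if q is inr j then inr (rev_ord j) else q.
have [|d dE] := @nc_matching_tldiag 0 2 f.
  split=> [[[]//|j] _|[[]//|i] [[]//|j] _ _].
    rewrite inE /f rev_ordK; split=> //; rewrite -[_ == _]/(rev_ord j == j) -val_eqE /=.
    by case: j => -[|[|]].
  rewrite -[inr i == inr j]/(i == j) -[inr i == _]/(i == rev_ord j).
  by case: i => -[|[|//]] hi; case: j => -[|[|//]] hj.
exists d => d'; apply/eqP/eqP => [H|->]; last by rewrite dE /f; congr inr; apply: val_inj.
apply: tldiag_eqP => -[[]//|j]; rewrite dE /f.
have [E|E] : j = ord0 \/ j = ord_max by case: j => -[|[|//]] hj; [left|right]; apply: val_inj.
  by rewrite E H; congr inr; apply: val_inj.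
by rewrite E -H (tldiagP d' (inr ord0)).1; congr inr; apply: val_inj.
Qed.

Section Amplitudes.
Variables (K : fieldType) (w : K).

Lemma amplitude_flip m n (d : tldiag m n) (d' : tldiag n m) b t :
  is_flip d d' -> amplitude w d' t b = amplitude w d b t.
Proof.
move=> /forallP dd; rewrite /amplitude /diagram_weight.
rewrite (reindex (@flip_point m n)) /=; last first.
  by exists (@flip_point n m) => q _; rewrite flip_pointK.
apply: eq_bigr => q _.
rewrite (eqP (dd q)); have E r : point_state t b (flip_point r) = point_state b t r by case: r.
by rewrite !E; case: q => i; case: (d _).
Qed.

Lemma amplitude_juxt m n m' n' (d1 : tldiag m n) (d2 : tldiag m' n') d b1 t1 b2 t2 :
  is_juxt d1 d2 d -> size b1 = m -> size t1 = n ->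
  amplitude w d (b1 ++ b2) (t1 ++ t2) = amplitude w d1 b1 t1 * amplitude w d2 b2 t2.
Proof.
move=> /andP[/forallP H1 /forallP H2] sb st; rewrite /amplitude /diagram_weight.
rewrite big_sumType /= !big_split_ord /= mulrACA [in RHS]big_sumType /= [X in _ = _ * X]big_sumType /=.
have sl (q : bpoint m n) : point_state (b1 ++ b2) (t1 ++ t2) (left_point m' n' q) = point_state b1 t1 q.
  by case: q => i /=; rewrite nth_cat; [rewrite sb (@ltn_ord m i)|rewrite st (@ltn_ord n i)].
have sr (q : bpoint m' n') : point_state (b1 ++ b2) (t1 ++ t2) (right_point m n q) = point_state b2 t2 q.
  by case: q => i /=; rewrite nth_cat; [rewrite sb|rewrite st]; rewrite ltnNge leq_addr /= addKn.
have wl (q : bpoint m n) : strand_weight w (left_point m' n' q) (left_point m' n' (d1 q)) =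
    strand_weight w q (d1 q) by case: q => i; case: (d1 _).
have wr (q : bpoint m' n') : strand_weight w (right_point m n q) (right_point m n (d2 q)) =
    strand_weight w q (d2 q).
  by case: q => i; case: (d2 _) => j; apply/funext => s; apply/funext => s' /=; rewrite ?ltn_add2l.
have kl q : strand_weight w (left_point m' n' q) (d (left_point m' n' q))
    (point_state (b1 ++ b2) (t1 ++ t2) (left_point m' n' q))
    (point_state (b1 ++ b2) (t1 ++ t2) (d (left_point m' n' q))) =
  strand_weight w q (d1 q) (point_state b1 t1 q) (point_state b1 t1 (d1 q)).
  by rewrite (eqP (H1 q)) wl !sl.
have kr q : strand_weight w (right_point m n q) (d (right_point m n q))
    (point_state (b1 ++ b2) (t1 ++ t2) (right_point m n q))
    (point_state (b1 ++ b2) (t1 ++ t2) (d (right_point m n q))) =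
  strand_weight w q (d2 q) (point_state b2 t2 q) (point_state b2 t2 (d2 q)).
  by rewrite (eqP (H2 q)) wr !sr.
congr (_ * _ * (_ * _)); apply: eq_bigr => i _.
- exact: (kl (inl i)).
- exact: (kl (inr i)).
- exact: (kr (inl i)).
- exact: (kr (inr i)).
Qed.

Lemma amplitude_id n (d : tldiag n n) b t : [forall i : 'I_n, d (inl i) == inr i] ->
  size b = n -> size t = n -> amplitude w d b t = (b == t)%:R.
Proof.
move=> /forallP dE sb st.
have dl i : d (inl i) = inr i by exact/eqP.
have dr i : d (inr i) = inl i by rewrite -dl (tldiagP d _).1.
rewrite /amplitude /diagram_weight big_sumType /=.
under eq_bigr => i _ do rewrite dl /=.
under [X in _ * X]eq_bigr => i _ do rewrite dr /=.
have [->|bt] := eqVneq b t.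
  by rewrite !big1 ?mulr1 // => i _; rewrite eqxx.
have [i bti] : exists i : 'I_n, nth false b i != nth false t i.
  apply/existsP; apply: contraNT bt; rewrite negb_exists => /forallP H.
  apply/eqP/(@eq_from_nth _ false); rewrite sb // => i ib.
  by have := H (Ordinal ib); rewrite negbK => /eqP.
by rewrite (bigD1 i) //= (negPf bti) !mul0r.
Qed.

Lemma amplitude_cup (d : tldiag 0 2) a c : d (inr ord0) == inr ord_max ->
  amplitude w d [::] [:: a; c] = if a == c then 0 else kap w a.
Proof.
move=> /eqP d0; have d1 : d (inr ord_max) = inr ord0 by rewrite -d0 (tldiagP d _).1.
rewrite /amplitude /diagram_weight big_sumType /= big_ord0 mul1r big_ord_recl big_ord1.
have -> : lift ord0 ord0 = ord_max :> 'I_2 by apply: val_inj.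
by rewrite d0 d1 /= /spin_pw /kap; case: a; case: c; rewrite /= ?mul0r ?mulr1 ?mul1r.
Qed.

End Amplitudes.

(** * Non-crossing matchings as bracketings *)

Section Openers.
Local Open Scope nat_scope.
Variables m n : nat.
Implicit Types d : tldiag m n.

Definition opener d (q : bpoint m n) := rim q < rim (d q).

Lemma opener_partner d q : opener d (d q) = ~~ opener d q.
Proof.
have [dd dn] := tldiagP d q; rewrite /opener dd -leqNgt [in RHS]leq_eqVlt.
by rewrite (inj_eq (@rim_inj m n)) (negPf dn).
Qed.

(** Induction on the length of a pair of d. With everything inside it settled, another partner of q
    in d' would lie further out, and the pair of [d q] in d' would cross it. *)
Lemma opener_eq d d' : opener d =1 opener d' -> d = d'.
Proof.
move=> dd'.
suff H k q : opener d q -> rim (d q) - rim q < k -> d' q = d q.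
  apply: tldiag_eqP => q; have [oq|oq] := boolP (opener d q).
    by rewrite (H _ _ oq (ltnSn _)).
  have {}oq : opener d (d q) by rewrite opener_partner.
  have := H _ _ oq (ltnSn _); rewrite (tldiagP d q).1 => E.
  by rewrite -{2}E (tldiagP d' _).1.
elim: k q => // k IHk q oq; rewrite ltnS => len.
have inside z : rim q < rim z < rim (d q) -> d' z = d z.
  move=> /andP[qz zy]; have [ddz dzn] := tldiagP d z; have [ddq _] := tldiagP d q.
  have [h1 h2] : rim q < rim (d z) /\ rim (d z) < rim (d q).
    have zq : z != q by apply: contraTneq qz => ->; rewrite ltnn.
    have zdq : z != d q by apply: contraTneq zy => ->; rewrite ltnn.
    have [_ nd] := tldiag_nc_matching d.
    have := nd z q (in_setT _) (in_setT _) zq zdq; rewrite /btw qz zy /= => /esym.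
    by case/orP => /andP[a b]; split => //; have := ltn_trans a b; rewrite ltnNge (ltnW oq).
  have [oz|oz] := boolP (opener d z).
    by apply: IHk oz _; lia.
  have {}oz : opener d (d z) by rewrite opener_partner.
  have := IHk _ oz; rewrite ddz => E; have {}E : d' (d z) = z by apply: E; lia.
  by rewrite -{1}E (tldiagP d' _).1.
have [ddq dqn] := tldiagP d q; have [dd'q _] := tldiagP d' q.
apply/eqP; apply: contraT => ne; exfalso.
have oq' : opener d' q by rewrite -dd'.
have yz : rim (d q) < rim (d' q).
  rewrite ltnNge leq_eqVlt (inj_eq (@rim_inj m n)) (negPf ne) /=; apply/negP => lt.
  have := inside (d' q); rewrite lt andbT => /(_ oq'); rewrite dd'q => E.
  have dq : d q = d' q by rewrite {1}E (tldiagP d (d' q)).1.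
  by rewrite dq eqxx in ne.
have oy : ~~ opener d' (d q) by rewrite -dd' opener_partner oq.
have [dd'y d'yn] := tldiagP d' (d q).
have zy : rim (d' (d q)) < rim (d q).
  by move: oy; rewrite /opener -leqNgt leq_eqVlt (inj_eq (@rim_inj m n)) (negPf d'yn).
have zq : rim (d' (d q)) < rim q.
  rewrite ltnNge leq_eqVlt (inj_eq (@rim_inj m n)); apply/negP => /orP[/eqP E|lt].
    by move: ne; rewrite {1}E dd'y eqxx.
  have := inside (d' (d q)); rewrite lt zy dd'y => /(_ isT) E.
  by move: lt; rewrite -[d' (d q)](tldiagP d _).1 -E ddq ltnn.
have := tldiag_noncrossing d' (d' (d q)) q.
by rewrite zq dd'y yz /= andbT => /negP; apply; exact: oq.
Qed.

Definition opener_sum d := \sum_(q | opener d q) rim q.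

(** Each pair of d' contains exactly one opener of d. Replacing it by the left end of the pair never
    increases the rank, and if it is always the left end then [opener_eq] applies. *)
Lemma opener_sum_le d d' : (forall q, opener d q != opener d (d' q)) ->
  opener_sum d' <= opener_sum d ?= iff (d == d').
Proof.
move=> opp.
have dE : opener_sum d = \sum_(q | opener d' q) (if opener d q then rim q else rim (d' q)).
  have -> : opener_sum d = \sum_q opener d q * rim q.
    by rewrite /opener_sum big_mkcond; apply: eq_bigr => q _; case: ifP; rewrite ?mul1n.
  rewrite (bigID (opener d')) /= [X in _ + X](reindex_inj (can_inj (fun q => (tldiagP d' q).1))) /=.
  rewrite [X in _ + X](eq_bigl (opener d')) => [|q]; last by rewrite opener_partner negbK.
  rewrite -big_split /=; apply: eq_bigr => q _.
  by have := opp q; case: (opener d q); case: (opener d (d' q)); rewrite //= ?mul1n ?mul0n ?addn0.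
rewrite dE; apply/leqifP; case: eqP => [<-|/eqP ne].
  by apply/eqP; apply: eq_bigr => q ->.
have [q oq nq] : exists2 q, opener d' q & ~~ opener d q.
  apply/exists_inP; apply: contraNT ne; rewrite negb_exists_in => /forall_inP H.
  apply/eqP/opener_eq => q; have [oq|oq] := boolP (opener d' q).
    by have := H q oq; rewrite negbK.
  have {}oq : opener d' (d' q) by rewrite opener_partner.
  by have := opp q; have := H _ oq; rewrite negbK => ->; case: (opener d q).
rewrite /opener_sum (bigD1 q) //= [X in _ < X](bigD1 q) //= (negPf nq).
rewrite -addSn leq_add //; apply: leq_sum => r /andP[or _].
by case: ifP => // _; exact: ltnW.
Qed.

End Openers.

(** * Faithfulness of the spin representation *)

Section StateModel.
Variables (R : realType) (delta w : R).
Hypotheses (w_gt0 : 0 < w) (deltaE : delta = w ^+ 2 + w ^- 2).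
Local Notation C := R[i].
Local Notation wc := (w%:C)%C.

Let wc0 : wc != 0.
Proof. by rewrite (fmorph_eq0 (real_complex R)) gt_eqF. Qed.

Let deltaC : (delta%:C)%C = wc ^+ 2 + wc ^- 2.
Proof. by rewrite deltaE rmorphD /= fmorphV !rmorphXn. Qed.

(* The image of a vector in the spin representation, in which the cup is
   [w e1 e2 + w^-1 e2 e1], as a matrix indexed by boundary states. *)
Definition spin m n (x : Rec R m n) (b t : seq bool) : C :=
  \sum_(d : tldiag m n) (x d : C) * amplitude wc d b t.

Lemma spinD m n (x y : Rec R m n) b t : spin (x + y) b t = spin x b t + spin y b t.
Proof. by rewrite /spin -big_split; apply: eq_bigr => d _; rewrite ffunE mulrDl. Qed.

Lemma spinZ m n (c : C) (x : Rec R m n) b t : spin (c *: x) b t = c * spin x b t.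
Proof. by rewrite /spin big_distrr; apply: eq_bigr => d _; rewrite ffunE -mulrA. Qed.

Lemma spinB m n (x y : Rec R m n) b t : spin (x - y) b t = spin x b t - spin y b t.
Proof. by rewrite -scaleN1r spinD spinZ mulN1r. Qed.

Lemma sum_unique (T : finType) (P : pred T) (c : C) (f : T -> C) d0 :
  (forall d, P d = (d == d0)) -> \sum_d (if P d then c else 0) * f d = c * f d0.
Proof.
move=> PE; rewrite (bigD1 d0) //= PE eqxx big1 ?addr0 // => d /negPf dd.
by rewrite PE dd mul0r.
Qed.

Lemma spin_rcomp m n p (x : Rec R n p) (y : Rec R m n) b t :
  spin (rcomp delta x y) b t = bsum n (fun s => spin x s t * spin y b s).
Proof.
rewrite /spin; under eq_bigr => d _ do rewrite ffunE big_distrl /=.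
rewrite exchange_big /=.
have -> : bsum n (fun s => (\sum_d (x d : C) * amplitude wc d s t) * (\sum_d (y d : C) * amplitude wc d b s)) =
   \sum_d1 \sum_d2 (x d1 : C) * (y d2 : C) * bsum n (fun s => amplitude wc d1 s t * amplitude wc d2 b s).
  under eq_bigr => d1 _ do under eq_bigr => d2 _ do rewrite -bsumZ.
  under eq_bigr => d1 _ do rewrite -bsum_sum.
  rewrite -bsum_sum; apply: eq_bsum => s _; rewrite big_distrl /=; apply: eq_bigr => d1 _.
  by rewrite big_distrr /=; apply: eq_bigr => d2 _; rewrite mulrACA.
apply: eq_bigr => d1 _.
under eq_bigr => d _ do rewrite big_mkcond /= big_distrl /=.
rewrite exchange_big /=; apply: eq_bigr => d2 _.
have [d0 [dP dE]] := amplitude_stack wc0 d1 d2.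
rewrite (@sum_unique _ (is_stack d1 d2) _ (fun d => amplitude wc d b t) d0 dP).
by rewrite dE -deltaC -!mulrA mulrCA; congr (_ * _); rewrite mulrCA.
Qed.

Lemma spin_rdagger m n (y : Rec R m n) b t : spin (rdagger y) t b = (spin y b t)^*.
Proof.
have wC : wc^* = wc by rewrite -[LHS]/(conjc _) /= oppr0.
have ampC (d : tldiag m n) : (amplitude wc d b t)^* = amplitude wc d b t.
  rewrite /amplitude /diagram_weight rmorph_prod; apply: eq_bigr => q _.
  have pwC lt s s' : (spin_pw wc lt s s')^* = spin_pw wc lt s s'.
    by rewrite /spin_pw; case: (s == s'); case: s; case: lt; rewrite ?rmorph0 ?rmorph1 ?fmorphV /= ?wC.
  by case: q => i; case: (d _) => j; rewrite /strand_weight; first [exact: pwC|exact: rmorph_nat].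
have rdE d' : (rdagger y) d' = \sum_(d | is_flip d d') (y d : C)^* :> C by exact: ffunE.
rewrite /spin rmorph_sum /=; under [LHS]eq_bigr => d' _ do rewrite rdE big_mkcond /= big_distrl /=.
rewrite exchange_big /=; apply: eq_bigr => d _.
have [d0 dP] := is_flip_unique d.
rewrite (@sum_unique _ (is_flip d) _ (fun d => amplitude wc d t b) d0 dP).
by rewrite rmorphM /= ampC (@amplitude_flip _ _ _ _ d d0) // dP.
Qed.

Lemma spin_rjuxt m n m' n' (x : Rec R m n) (y : Rec R m' n') b1 t1 b2 t2 :
  size b1 = m -> size t1 = n ->
  spin (rjuxt x y) (b1 ++ b2) (t1 ++ t2) = spin x b1 t1 * spin y b2 t2.
Proof.
move=> sb st; rewrite /spin; under eq_bigr => d _ do rewrite ffunE big_distrl /=.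
rewrite exchange_big big_distrl /=; apply: eq_bigr => d1 _.
under eq_bigr => d _ do rewrite big_mkcond /= big_distrl /=.
rewrite exchange_big big_distrr /=; apply: eq_bigr => d2 _.
have [d0 dP] := is_juxt_unique d1 d2.
rewrite (@sum_unique _ (is_juxt d1 d2) _ (fun d => amplitude wc d (b1 ++ b2) (t1 ++ t2)) d0 dP).
by rewrite (@amplitude_juxt _ _ _ _ _ _ d1 d2) ?dP // mulrACA.
Qed.

Lemma spin_rid n b t : size b = n -> size t = n -> spin (rid R n) b t = (b == t)%:R.
Proof.
move=> sb st; have [d0 dP] := is_id_unique n; rewrite /spin (bigD1 d0) //= big1 ?addr0.
  by rewrite ffunE dP eqxx mul1r (amplitude_id _ _ sb st) // dP.
by move=> d /negPf dd; rewrite ffunE dP dd mul0r.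
Qed.

Lemma spin_rcup a c : spin (rcup R) [::] [:: a; c] = if a == c then 0 else kap wc a.
Proof.
have [d0 dP] := is_cup_unique; rewrite /spin (bigD1 d0) //= big1 ?addr0.
  by rewrite ffunE dP eqxx mul1r amplitude_cup // dP.
by move=> d /negPf dd; rewrite ffunE dP dd mul0r.
Qed.

Lemma spin_recast m n m' n' (em : m = m') (en : n = n') (x : Rec R m n) b t :
  spin (recast em en x) b t = spin x b t.
Proof. by case: _ / em; case: _ / en. Qed.

(** Triangularity: among the diagrams with non-zero coefficient take d of minimal [opener_sum], and
    evaluate at the state given by its openers. A diagram with non-zero amplitude there has one
    opener of d in each pair, so [opener_sum_le] and minimality leave only d. *)
Lemma spin_inj m n (x : Rec R m n) :
  (forall b t, size b = m -> size t = n -> spin x b t = 0) -> x = 0.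
Proof.
move=> x0; apply: contrapT => /eqP xn0.
have [d0 d0x] : exists d, (x d : C) != 0.
  apply/existsP; apply: contraNT xn0; rewrite negb_exists => /forallP H.
  by apply/eqP/ffunP => d; have := H d; rewrite negbK ffunE => /eqP.
pose d := [arg min_(d < d0 | (x d : C) != 0%R) opener_sum d]%N.
have [dx dmin] : (x d : C) != 0 /\ forall d', (x d' : C) != 0 -> (opener_sum d <= opener_sum d')%N.
  by rewrite /d; case: arg_minnP.
pose b := [seq opener d (inl i) | i <- enum 'I_m].
pose t := [seq ~~ opener d (inr j) | j <- enum 'I_n].
have sb : size b = m by rewrite size_map size_enum_ord.
have st : size t = n by rewrite size_map size_enum_ord.
have bendE q : bend (point_state b t) q = opener d q.
  case: q => i /=; first by rewrite (nth_map i) ?size_enum_ord // nth_ord_enum.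
  by rewrite (nth_map i) ?size_enum_ord // nth_ord_enum negbK.
have amp0 d' : amplitude wc d' b t != 0 <-> forall q, opener d q != opener d (d' q).
  have k0 : \prod_(i < m) kap wc (point_state b t (inl i : bpoint m n)) != 0.
    by apply/prodf_neq0 => i _; exact: kap0.
  have -> : (amplitude wc d' b t != 0) = (wtd (spin_model wc0) d' (opener d) != 0).
    by rewrite -(eq_wtd _ _ bendE) wtd_bend mulf_eq0 (negPf k0) orbF.
  have pw0 lt s s' : (pw (spin_model wc0) lt s s' != 0) = (s != s').
    by rewrite /= /spin_pw; case: s; case: s'; case: lt; rewrite ?eqxx ?oner_eq0 ?invr_eq0 ?wc0.
  by split=> [/prodf_neq0 H q|H]; [have := H q isT|apply/prodf_neq0 => q _]; rewrite pw0.
have := x0 b t sb st; rewrite /spin (bigD1 d) //= big1 ?addr0 => [/eqP|d' dd'].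
  rewrite mulf_eq0 (negPf dx) /=; apply/negP/amp0 => q; rewrite opener_partner.
  by case: (opener d q).
apply/eqP; rewrite mulf_eq0; apply: contraT; rewrite negb_or => /andP[d'x /amp0/opener_sum_le].
move=> /leqifP; rewrite eq_sym (negPf dd') ltnNge.
by rewrite dmin.
Qed.

End StateModel.

(** * The functor Phi and trees *)

Section TreeAction.
Variables (K : comRingType) (tri : bool -> bool -> bool -> bool -> K).
Implicit Types (t l r : btree) (f g : seq btree) (F G : seq bool -> K) (b u v : seq bool).

(* The tensor network of a tree, with the three-legged tensor [tri] at each
   branching, paired with a function [F] of the states of its top strands:
   leaves and gaps between consecutive leaves alternate. *)
Fixpoint push t F (s : bool) : K :=
  if t is Node l r then
    \sum_x \sum_y \sum_z tri s x y z * push l (fun u => push r (fun v => F (u ++ y :: v)) z) x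
  else F [:: s].

(** Roots and the gaps between them alternate in b. Gap strands pass through unchanged, and no gap
    follows the last tree. *)
Fixpoint pushf f F b : K :=
  if f is t :: f' then
    if f' is [::] then push t F (head false b) else
    push t (fun u => pushf f' (fun v => F (u ++ nth false b 1 :: v)) (drop 2 b)) (head false b)
  else F [::].

Definition linear_form (L : (seq bool -> K) -> K) :=
  (forall F G, L (fun u => F u + G u) = L F + L G) /\ (forall c F, L (fun u => c * F u) = c * L F).

Lemma linear_form_sum L (I : Type) (e : seq I) (F : I -> seq bool -> K) : linear_form L ->
  L (fun u => \sum_(i <- e) F i u) = \sum_(i <- e) L (F i).
Proof.
move=> [LD LZ]; elim: e => [|i e IHe].
  rewrite big_nil -[RHS](mul0r (L (fun=> 0))) -LZ; congr L; apply/funext => u.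
  by rewrite big_nil mul0r.
by rewrite big_cons -IHe -LD; congr L; apply/funext => u; rewrite big_cons.
Qed.

(** Exchange of summations. Grafting needs it to move the trees above the left subtree past the
    right subtree. *)
Lemma push_exchange L t (G : seq bool -> seq bool -> K) s : linear_form L ->
  L (fun v => push t (G v) s) = push t (fun u => L (fun v => G v u)) s.
Proof.
move=> lL; have [_ LZ] := lL; elim: t s G => [//|l IHl r IHr] s G /=.
rewrite linear_form_sum //; apply: eq_bigr => x _.
rewrite linear_form_sum //; apply: eq_bigr => y _.
rewrite linear_form_sum //; apply: eq_bigr => z _.
rewrite LZ (IHl x (fun v u => push r (fun v0 => G v (u ++ y :: v0)) z)).
by congr (_ * push l _ x); apply/funext => u; rewrite IHr.
Qed.

Lemma push_linear t s : linear_form (fun F => push t F s).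
Proof.
split=> [F G|c F].
  elim: t s F G => [|l IHl r IHr] s F G //=.
  rewrite -big_split; apply: eq_bigr => x _; rewrite -big_split; apply: eq_bigr => y _.
  rewrite -big_split; apply: eq_bigr => z _; rewrite /= -mulrDr -IHl; congr (_ * push l _ x).
  by apply/funext => u; rewrite IHr.
elim: t s F => [|l IHl r IHr] s F //=.
rewrite big_distrr; apply: eq_bigr => x _; rewrite /= big_distrr; apply: eq_bigr => y _.
rewrite /= big_distrr; apply: eq_bigr => z _; rewrite /= mulrCA -IHl; congr (_ * push l _ x).
by apply/funext => u; rewrite IHr.
Qed.

Lemma pushf_cons2 t t' f F b : pushf (t :: t' :: f) F b =
  push t (fun u => pushf (t' :: f) (fun v => F (u ++ nth false b 1 :: v)) (drop 2 b)) (head false b).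
Proof. by []. Qed.

Lemma pushf_cons t f F s m b : f != [::] ->
  pushf (t :: f) F (s :: m :: b) = push t (fun u => pushf f (fun v => F (u ++ m :: v)) b) s.
Proof. by case: f => // t' f _; rewrite pushf_cons2 /= drop0. Qed.

Lemma pushf_exchange L f (G : seq bool -> seq bool -> K) b : linear_form L ->
  L (fun v => pushf f (G v) b) = pushf f (fun u => L (fun v => G v u)) b.
Proof.
move=> lL; elim: f b G => [|t [|t' f] IHf] b G //; first exact: push_exchange.
rewrite (push_exchange t (fun v u => pushf (t' :: f) (fun c => G v (u ++ nth false b 1 :: c)) (drop 2 b)) _ lL).
rewrite pushf_cons2; congr (push t _ _); apply/funext => u; exact: IHf.
Qed.

Lemma pushf_linear f b : linear_form (fun F => pushf f F b).
Proof.
split=> [F G|c F].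
  elim: f b F G => [|t [|t' f] IHf] b F G //; first exact: (push_linear t _).1.
  rewrite !pushf_cons2 -(push_linear t _).1; congr (push t _ _); apply/funext => u.
  exact: IHf.
elim: f b F => [|t [|t' f] IHf] b F //; first exact: (push_linear t _).2.
rewrite !pushf_cons2 -(push_linear t _).2; congr (push t _ _); apply/funext => u.
exact: IHf.
Qed.

Lemma eq_push t F G s : (forall u, size u = (nleaves t).*2.-1 -> F u = G u) -> push t F s = push t G s.
Proof.
elim: t s F G => [|l IHl r IHr] s F G FG /=; first exact: FG.
apply: eq_bigr => x _; apply: eq_bigr => y _; apply: eq_bigr => z _; congr (_ * _).
apply: IHl => u su; apply: IHr => v sv; apply: FG.
by rewrite size_cat /= su sv; have := nleaves_gt0 l; have := nleaves_gt0 r; lia.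
Qed.

Lemma pushf_cat f g F u y v : f != [::] -> g != [::] -> size u = (size f).*2.-1 ->
  pushf (f ++ g) F (u ++ y :: v) = pushf f (fun a => pushf g (fun c => F (a ++ y :: c)) v) u.
Proof.
elim: f u F => [//|t f IHf] u F _ g0.
case: u => [|s u]; first by rewrite /=; lia.
case: f IHf => [|t' f] IHf.
  by case: u => // _; exact: pushf_cons.
case: u => [|m u]; first by rewrite /=; lia.
move=> su; rewrite !cat_cons !pushf_cons //; congr (push t _ s); apply/funext => a.
rewrite -cat_cons IHf //; last by move: su => /=; lia.
by congr (pushf (t' :: f) _ u); apply/funext => c; congr (pushf g _ v); apply/funext => e; rewrite -catA.
Qed.

Lemma push_graft t f F s : size f = nleaves t ->
  push (graft t f) F s = push t (fun u => pushf f F u) s.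
Proof.
elim: t f F s => [|l IHl r IHr] f F s; first by case: f => [|t [|? ?]].
move=> /= sf; apply: eq_bigr => x _; apply: eq_bigr => y _; apply: eq_bigr => z _; congr (_ * _).
have sl : size (take (nleaves l) f) = nleaves l by rewrite size_takel // sf leq_addr.
have sr : size (drop (nleaves l) f) = nleaves r by rewrite size_drop sf addKn.
rewrite IHl //; apply: eq_push => u su.
have f10 : take (nleaves l) f != [::] by rewrite -size_eq0 sl -lt0n nleaves_gt0.
have f20 : drop (nleaves l) f != [::] by rewrite -size_eq0 sr -lt0n nleaves_gt0.
rewrite (_ : (fun a => push (graft r _) _ z) = (fun a => push r (fun c =>
    pushf (drop (nleaves l) f) (fun v => F (a ++ y :: v)) c) z)); last first.
  by apply/funext => a; rewrite IHr.
rewrite (push_exchange r (fun a c => pushf (drop (nleaves l) f) (fun v => F (a ++ y :: v)) c) z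
  (pushf_linear (take (nleaves l) f) u)).
apply: eq_push => v sv.
by rewrite -[f in RHS](cat_take_drop (nleaves l)) pushf_cat ?sl.
Qed.

Lemma pushf_graftf g f F b : g != [::] -> size f = nleavesf g -> size b = (size g).*2.-1 ->
  pushf (graftf g f) F b = pushf g (fun u => pushf f F u) b.
Proof.
elim: g f b F => [//|t g IHg] f b F _.
have -> : nleavesf (t :: g) = (nleaves t + nleavesf g)%N by [].
move=> sf sb.
have sl : size (take (nleaves t) f) = nleaves t by rewrite size_takel // sf leq_addr.
have sr : size (drop (nleaves t) f) = nleavesf g by rewrite size_drop sf addKn.
case: b sb => [|s b] sb; first by move: sb => /=; lia.
case: g IHg sf sb sr => [|t' g] IHg sf sb sr.
  rewrite /= push_graft //; congr (push t _ s); apply/funext => u.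
  by rewrite take_oversize // sf /nleavesf /= addn0.
case: b sb => [|m b] sb; first by move: sb => /=; lia.
have g0 : graftf (t' :: g) (drop (nleaves t) f) != [::] by [].
rewrite -[graftf (t :: _) f]/(graft t (take (nleaves t) f) :: graftf (t' :: g) (drop (nleaves t) f)).
rewrite (pushf_cons _ _ _ _ _ g0) pushf_cons // push_graft //; apply: eq_push => u su.
have f10 : take (nleaves t) f != [::] by rewrite -size_eq0 sl -lt0n nleaves_gt0.
have f20 : drop (nleaves t) f != [::].
  by rewrite -size_eq0 sr /nleavesf /= -lt0n addn_gt0 nleaves_gt0.
rewrite (_ : (fun a => pushf (graftf _ _) _ b) = (fun a => pushf (t' :: g) (fun c =>
    pushf (drop (nleaves t) f) (fun v => F (a ++ m :: v)) c) b)); last first.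
  by apply/funext => a; rewrite IHg //; move: sb => /=; lia.
rewrite (pushf_exchange (t' :: g) (fun a c => pushf (drop (nleaves t) f) (fun v => F (a ++ m :: v)) c) b
  (pushf_linear (take (nleaves t) f) u)).
congr (pushf (t' :: g) _ b); apply/funext => v.
by rewrite -[f in RHS](cat_take_drop (nleaves t)) pushf_cat ?sl.
Qed.

Lemma pushf_leaf n F b : (0 < n)%N -> size b = n.*2.-1 -> pushf (nseq n Leaf) F b = F b.
Proof.
elim: n b F => [//|[|n] IHn] b F _; first by case: b => [|s [|? ?]].
have -> : nseq n.+2 Leaf = Leaf :: nseq n.+1 Leaf by [].
case: b => [|s [|m b]] // sb.
rewrite pushf_cons // -[LHS]/(pushf (nseq n.+1 Leaf) (fun v => F ([:: s] ++ m :: v)) b).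
by rewrite IHn //; move: sb => /=; lia.
Qed.

End TreeAction.

Lemma elem_split n (k : 'I_n) (b : seq bool) : size b = strands n ->
  exists b1 s b2, [/\ b = b1 ++ s :: b2, size b1 = k.*2 & size b2 = (n - k.+1).*2].
Proof.
move=> sb; have kn := ltn_ord k.
exists (take k.*2 b), (nth false b k.*2), (drop k.*2.+1 b); split.
- by rewrite -drop_nth ?cat_take_drop // sb /strands; lia.
- by rewrite size_takel // sb /strands; lia.
- by rewrite size_drop sb /strands; lia.
Qed.

(** * Matrix entries of Phi *)

Section SpinPhi.
Variables (R : realType) (delta w : R).
Hypotheses (w_gt0 : 0 < w) (deltaE : delta = w ^+ 2 + w ^- 2).
Local Notation C := R[i].
Local Notation wc := ((w%:C)%C : C).
Local Notation spin := (@spin R w _ _).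

Definition cup_weight (a c : bool) : R := if a == c then 0 else if a then w else w^-1.

Definition triR (s x y z : bool) : R :=
  coef_a delta * ((x == s)%:R * cup_weight y z) + coef_b delta * (cup_weight x y * (s == z)%:R).

Definition tri s x y z : C := ((triR s x y z)%:C)%C.

Lemma spin_rcupE a c : spin (rcup R) [::] [:: a; c] = ((cup_weight a c)%:C)%C.
Proof.
rewrite spin_rcup /cup_weight /kap; case: (a == c); first by rewrite rmorph0.
by case: a => //=; rewrite fmorphV.
Qed.

Lemma spin_rho s x y z : spin (rho delta) [:: s] [:: x; y; z] = tri s x y z.
Proof.
rewrite /rho spinD !spinZ.
have -> : spin (rjuxt (rid R 1) (rcup R) : Rec R 1 3) [:: s] [:: x; y; z] =
    (x == s)%:R * ((cup_weight y z)%:C)%C.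
  transitivity (spin (rid R 1) [:: s] [:: x] * spin (rcup R) [::] [:: y; z]).
    exact: (@spin_rjuxt R w 1 1 0 2 (rid R 1) (rcup R) [:: s] [:: x] [::] [:: y; z]).
  by rewrite spin_rcupE spin_rid // eqseq_cons andbT eq_sym.
have -> : spin (rjuxt (rcup R) (rid R 1) : Rec R 1 3) [:: s] [:: x; y; z] =
    ((cup_weight x y)%:C)%C * (s == z)%:R.
  transitivity (spin (rcup R) [::] [:: x; y] * spin (rid R 1) [:: s] [:: z]).
    exact: (@spin_rjuxt R w 0 2 1 1 (rcup R) (rid R 1) [::] [:: x; y] [:: s] [:: z]).
  by rewrite spin_rcupE spin_rid // eqseq_cons andbT.
by rewrite /tri /triR rmorphD !rmorphM /= !rmorph_nat.
Qed.

Lemma spin_elem n (k : 'I_n) b1 s b2 t1 x y z t2 :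
  size b1 = k.*2 -> size b2 = (n - k.+1).*2 -> size t1 = k.*2 -> size t2 = (n - k.+1).*2 ->
  spin (Phi_elem delta k) (b1 ++ s :: b2) (t1 ++ [:: x, y, z & t2]) =
  (b1 == t1)%:R * tri s x y z * (b2 == t2)%:R.
Proof.
move=> sb1 sb2 st1 st2; rewrite /Phi_elem spin_recast.
have -> : b1 ++ s :: b2 = (b1 ++ [:: s]) ++ b2 by rewrite -catA.
have -> : t1 ++ [:: x, y, z & t2] = (t1 ++ [:: x; y; z]) ++ t2 by rewrite -catA.
rewrite spin_rjuxt ?size_cat /= ?sb1 ?st1 // spin_rjuxt //.
by rewrite !spin_rid // spin_rho.
Qed.

Lemma bsum_elem n (k : 'I_n) b1 s b2 (G : seq bool -> C) :
  size b1 = k.*2 -> size b2 = (n - k.+1).*2 ->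
  bsum (strands n.+1) (fun t => spin (Phi_elem delta k) (b1 ++ s :: b2) t * G t) =
  \sum_x \sum_y \sum_z tri s x y z * G (b1 ++ [:: x, y, z & b2]).
Proof.
move=> sb1 sb2.
rewrite [X in bsum X _](_ : _ = k.*2 + (3 + (n - k.+1).*2))%N; last by rewrite -(elem_cod k) addnA.
rewrite bsum_cat.
transitivity (bsum k.*2 (fun t1 => (t1 == b1)%:R * (\sum_x \sum_y \sum_z
    bsum (n - k.+1).*2 (fun t2 => (t2 == b2)%:R * (tri s x y z * G (t1 ++ [:: x, y, z & t2])))))).
  apply: eq_bsum => t1 st1 /=; rewrite big_distrr /=; apply: eq_bigr => x _.
  rewrite big_distrr /=; apply: eq_bigr => y _; rewrite big_distrr /=; apply: eq_bigr => z _.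
  rewrite -bsumZ; apply: eq_bsum => t2 st2.
  by rewrite spin_elem // (eq_sym b1) (eq_sym b2) -!mulrA; congr (_ * _); rewrite mulrCA.
rewrite bsum_delta //; apply: eq_bigr => x _; apply: eq_bigr => y _; apply: eq_bigr => z _.
by rewrite bsum_delta.
Qed.

Lemma pushf_elem n (k : 'I_n) b1 s b2 (G : seq bool -> C) :
  size b1 = k.*2 -> size b2 = (n - k.+1).*2 ->
  pushf tri (val (felem k)) G (b1 ++ s :: b2) =
  \sum_x \sum_y \sum_z tri s x y z * G (b1 ++ [:: x, y, z & b2]).
Proof.
clear w_gt0 deltaE.
rewrite /=; move: (k : nat) (n - k.+1)%N => {n k} k j.
elim: k b1 G => [|k IHk] b1 G; last first.
  case: b1 => [|a [|c b1]] // sb1 sb2.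
  have -> : nseq k.+1 Leaf ++ Node Leaf Leaf :: nseq j Leaf = Leaf :: (nseq k Leaf ++ Node Leaf Leaf :: nseq j Leaf) by [].
  rewrite pushf_cons; last by case: (k).
  by rewrite [LHS]/= (IHk b1 (fun v => G ([:: a] ++ c :: v))) //; move: sb1; rewrite doubleS => -[].
case: b1 => // _ sb2; rewrite !cat0s.
case: j sb2 => [|j] sb2; first by case: b2 sb2.
case: b2 sb2 => [|m b2] // sb2; rewrite pushf_cons // [LHS]/=.
apply: eq_bigr => x _; apply: eq_bigr => y _; apply: eq_bigr => z _; congr (_ * _).
rewrite -[LHS]/(pushf tri (nseq j.+1 Leaf) (fun v => G ([:: x; y; z] ++ m :: v)) b2).
by rewrite pushf_leaf //; move: sb2 => /=; lia.
Qed.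

Lemma spin_word n m (u : word n m) b (F : seq bool -> C) : (0 < n)%N -> size b = strands n ->
  bsum (strands m) (fun t => spin (Phi_word delta u) b t * F t) =
  pushf tri (val (word_forest u)) F b.
Proof.
move=> + + ; elim: u b F => {n m} [n|n m k u IHu] b F n0 sb.
  rewrite /= pushf_leaf // -(bsum_delta F sb); apply: eq_bsum => t st.
  by rewrite spin_rid // eq_sym.
transitivity (bsum (strands n.+1) (fun s => spin (Phi_elem delta k) b s *
    pushf tri (val (word_forest u)) F s)).
  transitivity (bsum (strands n.+1) (fun s => bsum (strands m) (fun t =>
      spin (Phi_elem delta k) b s * (spin (Phi_word delta u) s t * F t)))); last first.
    by apply: eq_bsum => s ss; rewrite bsumZ IHu.
  rewrite exchange_bsum; apply: eq_bsum => t st.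
  rewrite -[Phi_word delta (wcons k u)]/(rcomp delta (Phi_word delta u) (Phi_elem delta k)).
  rewrite [spin _ _ _](spin_rcomp w_gt0 deltaE) [LHS]mulrC -bsumZ; apply: eq_bsum => s _.
  by rewrite mulrC -mulrA mulrCA.
have [b1 [s [b2 [bE sb1 sb2]]]] := elem_split k sb.
have [sf lf] := forestP (felem k); have [su lu] := forestP (word_forest u).
rewrite bE bsum_elem // -(@pushf_elem n k) // -bE.
rewrite -[val (word_forest (wcons k u))]/(graftf (val (felem k)) (val (word_forest u))) pushf_graftf //.
- by rewrite -size_eq0 sf -lt0n.
- by rewrite su lf.
- by rewrite sf sb.
Qed.

(** The right side depends on f alone, so the factorization chosen in the definition of [Phi] drops
    out. *)
Lemma spin_Phi n m (f : forest n m) b t : (0 < n)%N -> size b = strands n -> size t = strands m ->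
  spin (Phi delta f) b t = pushf tri (val f) (fun u => (u == t)%:R) b.
Proof.
move=> n0 sb st; rewrite -{2}[f]factorizationK -spin_word // /Phi.
rewrite -[LHS](bsum_delta (fun u => spin (Phi_word delta (factorization f)) b u) st).
by apply: eq_bsum => u su; rewrite mulrC.
Qed.

Lemma spin_Phi_comp n m p (f : forest m p) (g : forest n m) b t :
  (0 < n)%N -> size b = strands n -> size t = strands p ->
  spin (rcomp delta (Phi delta f) (Phi delta g)) b t = spin (Phi delta (f \oF g)) b t.
Proof.
move=> n0 sb st; have m0 : (0 < m)%N := leq_trans n0 (word_le (factorization g)).
rewrite (spin_rcomp w_gt0 deltaE) spin_Phi //.
have [sf lf] := forestP f; have [sg lg] := forestP g.
rewrite [val _]/= pushf_graftf ?sg ?sf ?lg ?sb //; last by rewrite -size_eq0 sg -lt0n.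
rewrite -[g in RHS]factorizationK -spin_word // /Phi.
by apply: eq_bsum => s ss; rewrite spin_Phi // mulrC.
Qed.

Lemma Phi_comp n m p (f : forest m p) (g : forest n m) : (0 < n)%N ->
  rcomp delta (Phi delta f) (Phi delta g) = Phi delta (f \oF g).
Proof.
move=> n0; apply/eqP; rewrite -subr_eq0; apply/eqP/(spin_inj w_gt0) => b t sb st.
by rewrite spinB spin_Phi_comp // subrr.
Qed.

End SpinPhi.

(** * The Hilbert norm on states *)

Section StateNorm.
Variable R : realType.
Local Notation C := R[i].
Implicit Types V W : seq bool -> C.

Definition hypot (a b : R) : R := Num.sqrt (a ^+ 2 + b ^+ 2).

Lemma hypot_ge0 a b : 0 <= hypot a b. Proof. exact: sqrtr_ge0. Qed.

Lemma hypot_sqr a b : hypot a b ^+ 2 = a ^+ 2 + b ^+ 2.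
Proof. by rewrite sqr_sqrtr // addr_ge0 ?sqr_ge0. Qed.

Lemma hypotD a b c d : hypot (a + c) (b + d) <= hypot a b + hypot c d.
Proof.
have h0 := hypot_ge0 a b; have h1 := hypot_ge0 c d.
rewrite -(@ler_pXn2r _ 2) ?nnegrE ?addr_ge0 ?hypot_ge0 // sqrrD !hypot_sqr.
suff : a * c + b * d <= hypot a b * hypot c d by lra.
apply: le_trans (ler_norm _) _.
rewrite -(@ler_pXn2r _ 2) ?nnegrE ?mulr_ge0 // exprMn !hypot_sqr real_normK ?num_real //.
by have := sqr_ge0 (a * d - b * c); lra.
Qed.

Lemma hypot_le a b c d : 0 <= a -> 0 <= b -> a <= c -> b <= d -> hypot a b <= hypot c d.
Proof.
move=> a0 b0 ac bd; have c0 := le_trans a0 ac; have d0 := le_trans b0 bd.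
by apply: ler_wsqrtr; apply: lerD; rewrite ler_pXn2r ?nnegrE.
Qed.

Lemma hypot_eq0 a b : hypot a b = 0 -> a = 0 /\ b = 0.
Proof.
move=> E; have := hypot_sqr a b; rewrite E expr0n /= => /esym/eqP.
by rewrite paddr_eq0 ?sqr_ge0 // !sqrf_eq0 => /andP[/eqP -> /eqP ->].
Qed.

(* The Hilbert norm on the states of [n] strands. *)
Fixpoint snorm n V : R :=
  if n is n'.+1 then hypot (snorm n' (fun s => V (true :: s))) (snorm n' (fun s => V (false :: s)))
  else hypot (complex.Re (V [::])) (complex.Im (V [::])).

Lemma snorm_ge0 n V : 0 <= snorm n V.
Proof. by case: n => [|n]; exact: hypot_ge0. Qed.

Lemma snormD n V W : snorm n (fun s => V s + W s) <= snorm n V + snorm n W.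
Proof.
elim: n V W => [|n IHn] V W /=.
  by apply: le_trans (hypotD _ _ _ _); case: (V [::]) => a b; case: (W [::]).
by apply: le_trans (hypotD _ _ _ _); apply: hypot_le; rewrite ?snorm_ge0 ?IHn.
Qed.

Lemma eq_snorm n V W : (forall s, size s = n -> V s = W s) -> snorm n V = snorm n W.
Proof.
elim: n V W => [|n IHn] V W VW /=; first by rewrite VW.
by congr hypot; apply: IHn => s sn; apply: VW; rewrite /= sn.
Qed.

Lemma snormN n V : snorm n (fun s => - V s) = snorm n V.
Proof.
elim: n V => [|n IHn] V /=; last by rewrite !IHn.
by case: (V [::]) => a b; rewrite /hypot /= !sqrrN.
Qed.

Lemma snorm_eq0 n V s : snorm n V = 0 -> size s = n -> V s = 0.
Proof.
elim: n V s => [|n IHn] V [|b s] //= /hypot_eq0[E1 E2].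
  by move: E1 E2; case: (V [::]) => x y /= -> ->.
by move=> [sn]; case: b; [exact: IHn E1 sn|exact: IHn E2 sn].
Qed.

Lemma snorm_sqr n V : ((snorm n V ^+ 2)%:C)%C = bsum n (fun s => (V s)^* * V s).
Proof.
elim: n V => [|n IHn] V /=.
  rewrite hypot_sqr -[(V [::])^*]/(conjc _); case: (V [::]) => a b.
  by apply/eqP; rewrite eq_complex /=; apply/andP; split; apply/eqP; ring.
by rewrite hypot_sqr rmorphD /= !IHn big_bool.
Qed.

End StateNorm.

(** * Phi takes values in isometries *)

Section Isometry.
Variables (R : realType) (delta w : R).
Hypotheses (w_gt0 : 0 < w) (deltaE : delta = w ^+ 2 + w ^- 2).
Local Notation C := R[i].
Local Notation a := (coef_a delta).
Local Notation triR := (triR delta w).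

Lemma delta_ge2 : 2 <= delta.
Proof.
have w2 : w * w^-1 = 1 by rewrite divff ?gt_eqF.
by rewrite deltaE -exprVn; have := sqr_ge0 (w - w^-1); nra.
Qed.

Let d0 : 0 < delta. Proof. by have := delta_ge2; lra. Qed.
Let d1 : 0 < delta ^+ 2 - 1. Proof. by have := delta_ge2; nra. Qed.

Lemma coef_a_gt0 : 0 < a.
Proof. by rewrite /coef_a sqrtr_gt0 divr_gt0. Qed.

Lemma coef_a_sqr : a ^+ 2 = delta / (delta ^+ 2 - 1).
Proof. by rewrite sqr_sqrtr // ltW // divr_gt0. Qed.

Lemma coef_bE : coef_b delta = - (a / delta).
Proof.
rewrite /coef_b; congr (- _).
have -> : a / delta = Num.sqrt ((a / delta) ^+ 2).
  by rewrite sqrtr_sqr ger0_norm // divr_ge0 ?ltW ?coef_a_gt0.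
congr Num.sqrt; rewrite expr_div_n coef_a_sqr; field.
by rewrite !gt_eqF //; have := mulr_gt0 d0 d1; rewrite mulrBr mulr1 -exprS.
Qed.

(** For s = s' the sum is a^2 delta + 2ab + b^2 delta, the cross term being a zigzag with weight w
    w^-1 = 1. With b = -a/delta this is a^2 (delta - 1/delta) = 1. *)
Lemma triR_isometry s s' :
  \sum_x \sum_y \sum_z triR s x y z * triR s' x y z = (s == s')%:R.
Proof.
have wv : w * w^-1 = 1 by rewrite divff ?gt_eqF.
have de : delta * delta^-1 = 1 by rewrite divff ?gt_eqF.
have key : a ^+ 2 * (delta - delta^-1) = 1.
  by rewrite coef_a_sqr; field; rewrite !gt_eqF.
have wd : w ^+ 2 + w^-1 ^+ 2 = delta by rewrite deltaE exprVn.
rewrite !big_bool /triR coef_bE /cup_weight /=; move: wv de key wd.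
move: (w^-1) (delta^-1) a => v e c wv de key wd.
have main : c ^+ 2 * (w ^+ 2 + v ^+ 2 - 2 * (w * v) * e + (w ^+ 2 + v ^+ 2) * e * e) = 1.
  by rewrite wd wv de -[RHS]key; ring.
by case: s; case: s' => /=; rewrite -?[RHS]main; ring.
Qed.

End Isometry.

Section SpinIsometries.
Variables (R : realType) (delta w : R).
Hypotheses (w_gt0 : 0 < w) (deltaE : delta = w ^+ 2 + w ^- 2).
Local Notation C := R[i].
Local Notation spin := (@spin R w _ _).
Local Notation tri := (tri delta w).

Lemma bsum_conj n (F : seq bool -> C) : (bsum n F)^* = bsum n (fun s => (F s)^*).
Proof.
elim: n F => [//|n IHn] F /=; rewrite rmorph_sum.
by apply: eq_bigr => b _; exact: IHn.
Qed.

Definition isometric n p (x : Rec R n p) := forall b b', size b = n -> size b' = n ->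
  bsum p (fun t => spin x b t * (spin x b' t)^*) = (b == b')%:R.

Lemma isometric_gram m n p (x : Rec R n p) (y : Rec R m n) b b' : isometric x ->
  bsum p (fun t => spin (rcomp delta x y) b t * (spin (rcomp delta x y) b' t)^*) =
  bsum n (fun s => spin y b s * (spin y b' s)^*).
Proof.
move=> xI.
transitivity (bsum p (fun t => bsum n (fun s => bsum n (fun s' =>
    spin y b s * ((spin y b' s')^* * (spin x s t * (spin x s' t)^*)))))).
  apply: eq_bsum => t _; rewrite !(spin_rcomp w_gt0 deltaE) bsum_conj mulrC -bsumZ.
  apply: eq_bsum => s _; rewrite mulrC -bsumZ; apply: eq_bsum => s' _.
  by rewrite rmorphM /=; ring.
rewrite exchange_bsum; apply: eq_bsum => s ss; rewrite exchange_bsum.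
rewrite -(bsum_delta (fun s' => spin y b s * (spin y b' s')^*) ss); apply: eq_bsum => s' ss'.
by rewrite !bsumZ xI // mulrA mulrC (eq_sym s).
Qed.

Lemma isometric_rid n : isometric (rid R n).
Proof.
move=> b b' sb sb'; rewrite -(bsum_delta (fun t => (b == t)%:R) sb'); apply: eq_bsum => t st.
by rewrite !spin_rid // rmorph_nat mulrC eq_sym.
Qed.

Lemma isometric_comp m n p (x : Rec R n p) (y : Rec R m n) :
  isometric x -> isometric y -> isometric (rcomp delta x y).
Proof. by move=> xI yI b b' sb sb'; rewrite isometric_gram // yI. Qed.

Lemma isometric_elem n (k : 'I_n) : isometric (Phi_elem delta k).
Proof.
move=> b b' sb sb'; have [b1 [s [b2 [-> s1 s2]]]] := elem_split k sb.
have [b1' [s' [b2' [-> s1' s2']]]] := elem_split k sb'.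
rewrite (@bsum_elem R delta w n k b1 s b2 (fun t => (spin (Phi_elem delta k) (b1' ++ s' :: b2') t)^*) s1 s2).
transitivity ((b1 == b1')%:R * (b2 == b2')%:R * ((\sum_x \sum_y \sum_z
    triR delta w s x y z * triR delta w s' x y z)%:C)%C : C).
  rewrite rmorph_sum mulr_sumr; apply: eq_bigr => x _; rewrite rmorph_sum mulr_sumr.
  apply: eq_bigr => y _; rewrite rmorph_sum mulr_sumr; apply: eq_bigr => z _.
  rewrite spin_elem // !rmorphM /= !rmorph_nat (eq_sym b1) (eq_sym b2).
  have -> : (tri s' x y z)^* = tri s' x y z by rewrite -[LHS]/(conjc _) /= oppr0.
  by rewrite -/(tri s x y z) -/(tri s' x y z); ring.
rewrite (triR_isometry w_gt0 deltaE) rmorph_nat eqseq_cat ?s1 ?s1' // eqseq_cons.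
by case: (b1 == b1'); case: (b2 == b2'); case: (s == s'); rewrite /= ?mulr0 ?mul0r ?mulr1.
Qed.

Lemma isometric_Phi n m (f : forest n m) : isometric (Phi delta f).
Proof.
rewrite /Phi; elim: (factorization f) => {n m f} [n|n m k u IHu]; first exact: isometric_rid.
exact: isometric_comp IHu (@isometric_elem n k).
Qed.

Lemma rscalarE (z : Rec R 1 1) : rscalar z = spin z [:: true] [:: true].
Proof.
apply: eq_bigr => d _; rewrite amplitude_id ?mulr1 //.
apply/forallP => i; have [_] := tldiagP d (inl i).
by case: (diag_fun d (inl i)) => j; rewrite !ord1.
Qed.

(** Elements of Rec(1,1) act as scalars, so the inner product can be read at the single bottom state
    up. *)
Lemma rinnerE n (x y : Rec R 1 n) :
  rinner delta x y = bsum n (fun s => spin x [:: true] s * (spin y [:: true] s)^*).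
Proof.
rewrite /rinner rscalarE (spin_rcomp w_gt0 deltaE); apply: eq_bsum => s _.
by rewrite spin_rdagger mulrC.
Qed.

Lemma rnormE n (x : Rec R 1 n) : rnorm delta x = snorm n (spin x [:: true]).
Proof.
rewrite /rnorm rinnerE.
have -> : bsum n (fun s => spin x [:: true] s * (spin x [:: true] s)^*) =
    ((snorm n (spin x [:: true]) ^+ 2)%:C)%C.
  by rewrite snorm_sqr; apply: eq_bsum => s _; rewrite mulrC.
by rewrite /= sqrtr_sqr ger0_norm ?snorm_ge0.
Qed.

Lemma rnorm_isometric n p (x : Rec R n p) (y : Rec R 1 n) : isometric x ->
  rnorm delta (rcomp delta x y) = rnorm delta y.
Proof. by move=> xI; rewrite /rnorm !rinnerE isometric_gram. Qed.

Lemma rnorm_ge0 n (x : Rec R 1 n) : 0 <= rnorm delta x.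
Proof. exact: sqrtr_ge0. Qed.

Lemma rnormD n (x y : Rec R 1 n) : rnorm delta (x + y) <= rnorm delta x + rnorm delta y.
Proof.
rewrite !rnormE; apply: le_trans (snormD _ _ _).
by rewrite -(@eq_snorm _ _ (spin (x + y) [:: true])) // => s _; rewrite spinD.
Qed.

Lemma rnormN n (x : Rec R 1 n) : rnorm delta (- x) = rnorm delta x.
Proof.
rewrite !rnormE -[RHS]snormN; apply: eq_snorm => s _.
by rewrite -[- x]scaleN1r spinZ mulN1r.
Qed.

Lemma rnorm_eq0 n (x : Rec R 1 n) s : rnorm delta x = 0 -> size s = n -> spin x [:: true] s = 0.
Proof. by rewrite rnormE; exact: snorm_eq0. Qed.

Lemma rcompD n m (x : Rec R n m) (y z : Rec R 1 n) :
  rcomp delta x (y + z) = rcomp delta x y + rcomp delta x z.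
Proof.
have distr (u v1 v2 : C) : u * (v1 + v2) = u * v1 + u * v2 by ring.
apply/ffunP => d; rewrite !ffunE -big_split; apply: eq_bigr => d1 _; rewrite -big_split.
by apply: eq_bigr => d2 _; rewrite ffunE; exact: distr.
Qed.

Lemma rcompZ n m (x : Rec R n m) c (y : Rec R 1 n) : rcomp delta x (c *: y) = c *: rcomp delta x y.
Proof.
have swap (u v : C) : u * (c * v) = c * (u * v) by ring.
apply/ffunP => d; rewrite !ffunE scaler_sumr; apply: eq_bigr => d1 _; rewrite scaler_sumr.
by apply: eq_bigr => d2 _; rewrite ffunE; exact: swap.
Qed.

Lemma rcompB n m (x : Rec R n m) (y z : Rec R 1 n) :
  rcomp delta x (y - z) = rcomp delta x y - rcomp delta x z.
Proof. by rewrite -scaleN1r rcompD rcompZ scaleN1r. Qed.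

Lemma rcomp_sum n m k (x : Rec R n m) (y : 'I_k -> Rec R 1 n) :
  rcomp delta x (\sum_(i < k) y i) = \sum_(i < k) rcomp delta x (y i).
Proof.
elim: k y => [|k IHk] y; last by rewrite !big_ord_recr rcompD IHk.
by rewrite !big_ord0 -[0 : Rec R 1 n](scale0r 0) rcompZ scale0r.
Qed.

End SpinIsometries.

(* Gap [j] lies between the leaves [j] and [j.+1]; it corresponds to a
   branching, namely the last common ancestor of these two leaves. *)
Fixpoint ancestor t (j i : nat) : bool :=
  if t is Node l r then
    if j == (nleaves l).-1 then true
    else if (j < (nleaves l).-1)%N then (i < nleaves l)%N && ancestor l j i
    else (nleaves l <= i)%N && ancestor r (j - nleaves l) (i - nleaves l)
  else false.

(** The gap of the root is the only one above all leaves, and it fixes the size of the left subtree.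
    Leaf 0 and leaf [nleaves l'] detect any mismatch. *)
Lemma ancestor_inj t t' : nleaves t = nleaves t' ->
  (forall j i, (j < (nleaves t).-1)%N -> (i < nleaves t)%N -> ancestor t j i = ancestor t' j i) ->
  t = t'.
Proof.
elim: t t' => [|l IHl r IHr] [|l' r'] //=.
- by have := nleaves_gt0 l'; have := nleaves_gt0 r'; lia.
- by have := nleaves_gt0 l; have := nleaves_gt0 r; lia.
have l0 := nleaves_gt0 l; have r0 := nleaves_gt0 r.
have l0' := nleaves_gt0 l'; have r0' := nleaves_gt0 r'; move=> nE H.
have lE : nleaves l = nleaves l'.
  have j0 : ((nleaves l).-1 < (nleaves l + nleaves r).-1)%N by lia.
  have H1 := H _ (nleaves l') j0; have H0 := H _ 0%N j0; move: H1 H0; rewrite eqxx ltnn leqNgt l0'.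
  by case: (ltngtP (nleaves l).-1 (nleaves l').-1) => ? H1 H0; [have := H1|have := H0|]; lia.
have rE : nleaves r = nleaves r' by lia.
rewrite -lE in H; congr Node.
  apply: IHl => // j i jl il; have := H j i.
  by rewrite (ltn_eqF jl) jl il /= => -> //; lia.
apply: IHr => // j i jr ir; have := H (nleaves l + j)%N (nleaves l + i)%N.
have -> : (nleaves l + j == (nleaves l).-1)%N = false by lia.
have -> : (nleaves l + j < (nleaves l).-1)%N = false by lia.
by rewrite !leq_addr !addKn /= => -> //; lia.
Qed.

(** * Recovering a tree from its amplitudes *)

Section TreeAmplitude.
Variables (K : fieldType) (tri : bool -> bool -> bool -> bool -> K).
Hypothesis tri_neq0 : forall s x y z, (tri s x y z != 0) = (x + y + z == s.+1)%N.

Definition tree_amp t s c : K := push tri t (fun u => (u == c)%:R) s.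

Lemma tree_ampE l r s u y v : size u = (nleaves l).*2.-1 ->
  tree_amp (Node l r) s (u ++ y :: v) =
  \sum_x \sum_z tri s x y z * (tree_amp l x u * tree_amp r z v).
Proof.
move=> su; rewrite /tree_amp /=; apply: eq_bigr => x _; rewrite (bigD1 y) //= [X in _ + X]big1 ?addr0.
  apply: eq_bigr => z _; congr (_ * _).
  have [_ lZ] := push_linear tri l x; rewrite mulrC -lZ; apply: eq_push => a sa.
  have [_ rZ] := push_linear tri r z; rewrite mulrC -rZ; congr push; apply/funext => c.
  by rewrite eqseq_cat ?sa // eqseq_cons eqxx -natrM mulnb.
move=> y' /negPf yy; apply: big1 => z _; rewrite [X in _ * X](_ : _ = 0) ?mulr0 //.
have lin0 t x' : push tri t (fun=> 0) x' = 0.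
  have [_ tZ] := push_linear tri t x'; rewrite -[RHS](mul0r (push tri t (fun=> 0) x')) -tZ.
  by congr push; apply/funext => c; rewrite mul0r.
rewrite -[RHS](lin0 l x); apply: eq_push => a sa; rewrite -[RHS](lin0 r z).
by apply: eq_push => c _; rewrite eqseq_cat ?sa // eqseq_cons yy andbF.
Qed.

(** By [tri_neq0] each of the [nleaves t - 1] branchings adds one strand in state up. *)
Lemma tree_amp_count t s c : size c = (nleaves t).*2.-1 -> tree_amp t s c != 0 ->
  (count id c).+1 = (nleaves t + s)%N.
Proof.
elim: t s c => [|l IHl r IHr] s c.
  by case: c => [|b [|? ?]] //= _; rewrite /tree_amp /= eqseq_cons andbT; case: (s =P b) => [-> _|_]; rewrite ?eqxx //; case: b.
have l0 := nleaves_gt0 l; have r0 := nleaves_gt0 r; move=> sc.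
have -> : c = take (nleaves l).*2.-1 c ++ nth false c (nleaves l).*2.-1 :: drop (nleaves l).*2 c.
  have := @drop_nth _ false (nleaves l).*2.-1 c; rewrite prednK; last by lia.
  by move=> <-; [rewrite cat_take_drop|move: sc => /=; lia].
set u := take _ _; set y := nth _ _ _; set v := drop _ _.
have su : size u = (nleaves l).*2.-1 by rewrite size_takel //; move: sc => /=; lia.
have sv : size v = (nleaves r).*2.-1 by rewrite size_drop sc /=; lia.
rewrite tree_ampE // => H.
have [x [z]] : exists x z : bool, tri s x y z * (tree_amp l x u * tree_amp r z v) != 0.
  apply: contrapT => no; case/eqP: H; apply: big1 => x _; apply: big1 => z _.
  by apply: contrapT => /eqP n0; apply: no; exists x, z.
rewrite !mulf_eq0 !negb_or tri_neq0 => /and3P[/eqP xyz lx rz].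
have := IHl x u su lx; have := IHr z v sv rz; rewrite count_cat /=.
by move: (count _ u) (count _ v) => cu cv; move: xyz; rewrite /=; case: (x); case: (y); case: (z); case: s {H} => /=; lia.
Qed.

(** By [tree_amp_count] the states u and v determine the root states of the two subtrees. The sum
    has at most one non-zero term, so nothing can cancel. *)
Lemma tree_amp_neq0 l r (s : bool) (u : seq bool) (y : bool) (v : seq bool) :
  size u = (nleaves l).*2.-1 -> size v = (nleaves r).*2.-1 ->
  (tree_amp (Node l r) s (u ++ y :: v) != 0) =
  [exists x : bool, exists z : bool, [&& (x + y + z == s.+1)%N, tree_amp l x u != 0 & tree_amp r z v != 0]].
Proof.
move=> su sv; rewrite tree_ampE //; apply/idP/existsP => [H|[x /existsP[z]]].
  apply: contrapT => no; case/eqP: H; apply: big1 => x _; apply: big1 => z _.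
  apply: contrapT => /eqP; rewrite !mulf_eq0 !negb_or tri_neq0 => n0.
  by apply: no; exists x; apply/existsP; exists z.
rewrite -tri_neq0 => /and3P[n1 lx rz].
have lE x' : tree_amp l x' u != 0 -> x' = x.
  by move=> /(tree_amp_count su); rewrite (tree_amp_count su lx); case: x'; case: (x) => //=; lia.
have rE z' : tree_amp r z' v != 0 -> z' = z.
  by move=> /(tree_amp_count sv); rewrite (tree_amp_count sv rz); case: z'; case: (z) => //=; lia.
rewrite (bigD1 x) //= (bigD1 z) //= !big1 ?addr0.
- by rewrite !mulf_neq0.
- move=> x' xx; apply: big1 => z' _; have [->|/lE xE] := eqVneq (tree_amp l x' u) 0.
    by rewrite mul0r mulr0.
  by rewrite xE eqxx in xx.
- move=> z' zz; have [->|/rE zE] := eqVneq (tree_amp r z' v) 0; first by rewrite !mulr0.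
  by rewrite zE eqxx in zz.
Qed.

(* The state [mkseq p] has the leaves at the even positions and the gaps at
   the odd ones. *)
Definition strand_state t (p : nat -> bool) := mkseq p (nleaves t).*2.-1.

Lemma strand_state_node l r p : strand_state (Node l r) p =
  strand_state l p ++ p (nleaves l).*2.-1 :: strand_state r (fun k => p ((nleaves l).*2 + k)%N).
Proof.
have l0 := nleaves_gt0 l; have r0 := nleaves_gt0 r.
rewrite /strand_state /mkseq /=.
have -> : ((nleaves l + nleaves r).*2.-1 = (nleaves l).*2.-1 + (nleaves r).*2.-1.+1)%N by lia.
rewrite iotaD map_cat add0n /=; congr (_ ++ _ :: _).
rewrite prednK; last by lia.
by rewrite -[(nleaves l).*2 in LHS]addn0 iotaDl -map_comp.
Qed.

Lemma tree_amp_node l r (s : bool) (p : nat -> bool) (pl pr : bool -> bool) (y := p (nleaves l).*2.-1) :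
  (forall x, (tree_amp l x (strand_state l p) != 0) = pl x) ->
  (forall z, (tree_amp r z (strand_state r (fun k => p ((nleaves l).*2 + k)%N)) != 0) = pr z) ->
  (tree_amp (Node l r) s (strand_state (Node l r) p) != 0) =
  [exists x : bool, exists z : bool, [&& (x + y + z == s.+1)%N, pl x & pr z]].
Proof.
move=> plE prE; rewrite strand_state_node tree_amp_neq0 ?size_mkseq //.
by apply: eq_existsb => x; apply: eq_existsb => z; rewrite plE prE.
Qed.

Lemma tree_amp_leaf s p : (tree_amp Leaf s (strand_state Leaf p) != 0) = (s == p 0%N).
Proof. by rewrite /tree_amp /= eqseq_cons andbT; case: (s == _); rewrite ?oner_eq0 ?eqxx. Qed.

Lemma exists_bool2 (P : bool -> bool -> bool) :
  [exists x, exists z, P x z] = [|| P true true, P true false, P false true | P false false].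
Proof.
apply/existsP/idP => [[x /existsP[z]]|]; first by case: x; case: z => ->; rewrite ?orbT.
by case/or4P => H; [exists true|exists true|exists false|exists false]; apply/existsP;
  [exists true|exists false|exists true|exists false].
Qed.

Lemma tree_amp_plain t s p : (forall k, (k < (nleaves t).*2.-1)%N -> p k = ~~ odd k) ->
  (tree_amp t s (strand_state t p) != 0) = s.
Proof.
elim: t s p => [|l IHl r IHr] s p pE; first by rewrite tree_amp_leaf pE //; case: s.
have l0 := nleaves_gt0 l; have r0 := nleaves_gt0 r; move: pE => /= pE.
rewrite (@tree_amp_node l r s p id id).
- by rewrite exists_bool2 pE; [have -> : odd (nleaves l).*2.-1 by lia|lia]; case: s.
- by move=> x; apply: IHl => k kl; apply: pE; lia.
- by move=> z; apply: IHr => k kr; rewrite pE ?oddD ?odd_double //; lia.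
Qed.

Lemma tree_amp_leaf_false t s p i : (i < nleaves t)%N ->
  (forall k, (k < (nleaves t).*2.-1)%N -> p k = ~~ odd k && (k != i.*2)) ->
  (tree_amp t s (strand_state t p) != 0) = ~~ s.
Proof.
elim: t s p i => [|l IHl r IHr] s p i it pE.
  by rewrite tree_amp_leaf pE //; case: i it {pE} => // _; case: s.
have l0 := nleaves_gt0 l; have r0 := nleaves_gt0 r; move: it pE => /= it pE.
have y0 : p (nleaves l).*2.-1 = false by rewrite pE; lia.
have [il|li] := ltnP i (nleaves l).
  rewrite (@tree_amp_node l r s p negb id).
  - by rewrite exists_bool2 y0; case: s.
  - by move=> x; apply: (IHl _ _ i) => // k kl; apply: pE; lia.
  - by move=> z; apply: tree_amp_plain => k kr; rewrite pE; lia.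
rewrite (@tree_amp_node l r s p id negb).
- by rewrite exists_bool2 y0; case: s.
- by move=> x; apply: tree_amp_plain => k kl; rewrite pE; lia.
- by move=> z; apply: (IHr _ _ (i - nleaves l)%N) => [|k kr]; rewrite ?pE; lia.
Qed.

(** The state has one up strand too many for either value at the root. *)
Lemma tree_amp_gap_true t s p j : (j < (nleaves t).-1)%N ->
  (forall k, (k < (nleaves t).*2.-1)%N -> p k = ~~ odd k || (k == j.*2.+1)) ->
  (tree_amp t s (strand_state t p) != 0) = false.
Proof.
elim: t s p j => [//|l IHl r IHr] s p j /=.
have l0 := nleaves_gt0 l; have r0 := nleaves_gt0 r => jt pE.
have [jl|lj|jl] := ltngtP j (nleaves l).-1.
- rewrite (@tree_amp_node l r s p xpred0 id) ?exists_bool2 ?andbF //.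
    by move=> x; apply: (IHl _ _ j) => // k kl; apply: pE; lia.
  by move=> z; apply: tree_amp_plain => k kr; rewrite pE; lia.
- rewrite (@tree_amp_node l r s p id xpred0) ?exists_bool2 ?andbF //.
    by move=> x; apply: tree_amp_plain => k kl; rewrite pE; lia.
  by move=> z; apply: (IHr _ _ (j - nleaves l)%N) => [|k kr]; rewrite ?pE; lia.
rewrite (@tree_amp_node l r s p id id).
- have -> : p (nleaves l).*2.-1 = true by rewrite pE; lia.
  by rewrite exists_bool2; case: s.
- by move=> x; apply: tree_amp_plain => k kl; rewrite pE; lia.
- by move=> z; apply: tree_amp_plain => k kr; rewrite pE; lia.
Qed.

(* Whether gap [j] is above leaf [i] can be read off the amplitude of the
   state with all leaves but [i] and, among the gaps, only [j] up. *)
Lemma tree_amp_ancestor t p j i : (j < (nleaves t).-1)%N -> (i < nleaves t)%N ->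
  (forall k, (k < (nleaves t).*2.-1)%N -> p k = (~~ odd k && (k != i.*2)) || (k == j.*2.+1)) ->
  (tree_amp t true (strand_state t p) != 0) = ancestor t j i.
Proof.
elim: t p j i => [//|l IHl r IHr] p j i /=.
have l0 := nleaves_gt0 l; have r0 := nleaves_gt0 r => jt it pE.
have [jl|lj|jl] := ltngtP j (nleaves l).-1.
- have y0 : p (nleaves l).*2.-1 = false by rewrite pE; lia.
  have [il|li] := ltnP i (nleaves l) => /=.
    rewrite (@tree_amp_node l r true p (fun x => tree_amp l x (strand_state l p) != 0) id) //.
      rewrite exists_bool2 y0 /= !orbF -(IHl p j i) ?andbT //.
      by move=> k kl; apply: pE; lia.
    by move=> z; apply: tree_amp_plain => k kr; rewrite pE; lia.
  pose pr z := tree_amp r z (strand_state r (fun k => p ((nleaves l).*2 + k)%N)) != 0.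
  rewrite (@tree_amp_node l r true p xpred0 pr) ?exists_bool2 ?andbF //.
  by move=> x; apply: (@tree_amp_gap_true _ _ _ j) => // k kl; rewrite pE; lia.
- have y0 : p (nleaves l).*2.-1 = false by rewrite pE; lia.
  have [il|li] := ltnP i (nleaves l) => /=.
    pose pl x := tree_amp l x (strand_state l p) != 0.
    rewrite (@tree_amp_node l r true p pl xpred0) ?exists_bool2 ?andbF //.
    by move=> z; apply: (@tree_amp_gap_true _ _ _ (j - nleaves l)%N) => [|k kr]; rewrite ?pE; lia.
  pose pr z := tree_amp r z (strand_state r (fun k => p ((nleaves l).*2 + k)%N)) != 0.
  rewrite (@tree_amp_node l r true p id pr) //.
    rewrite exists_bool2 y0 /= !orbF -(IHr (fun k => p ((nleaves l).*2 + k)%N)) //; try lia.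
    by move=> k kr; rewrite pE; lia.
  by move=> x; apply: tree_amp_plain => k kl; rewrite pE; lia.
have y1 : p (nleaves l).*2.-1 = true by rewrite pE; lia.
have [il|li] := ltnP i (nleaves l).
  rewrite (@tree_amp_node l r true p negb id); first by rewrite exists_bool2 y1.
    by move=> x; apply: (@tree_amp_leaf_false _ _ _ i) => // k kl; rewrite pE; lia.
  by move=> z; apply: tree_amp_plain => k kr; rewrite pE; lia.
rewrite (@tree_amp_node l r true p id negb); first by rewrite exists_bool2 y1.
  by move=> x; apply: tree_amp_plain => k kl; rewrite pE; lia.
by move=> z; apply: (@tree_amp_leaf_false _ _ _ (i - nleaves l)%N) => [|k kr]; rewrite ?pE; lia.
Qed.

Lemma tree_amp_inj t t' : nleaves t = nleaves t' ->
  (forall c, size c = (nleaves t).*2.-1 -> tree_amp t true c = tree_amp t' true c) -> t = t'.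
Proof.
move=> nE H; apply: ancestor_inj => // j i jt it.
pose p k := (~~ odd k && (k != i.*2)) || (k == j.*2.+1).
rewrite -(@tree_amp_ancestor t p) // H ?size_mkseq //.
by rewrite /strand_state nE -/(strand_state t' p) (@tree_amp_ancestor t' p j i) // -nE.
Qed.

End TreeAmplitude.

(** * The Jones representation and its vacuum vector *)

Local Open Scope quotient_scope.

Lemma tree_gt0 n (s : tree n) : (0 < n)%N.
Proof. by have [ss <-] := forestP s; have := nleavesf_ge (val s); rewrite ss. Qed.

Section JonesAction.
Variables (R : realType) (delta w : R).
Hypotheses (w_gt0 : 0 < w) (deltaE : delta = w ^+ 2 + w ^- 2).
Local Notation C := R[i].
Local Notation spin := (@spin R w _ _).
Local Notation Phi := (Phi delta).
Local Notation rcomp := (rcomp delta).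
Local Notation rnorm := (rnorm delta).

(** Where both terms of [triR] contribute they do not cancel, since delta w^-1 - w = w^-3 and delta
    w - w^-1 = w^3. *)
Lemma tri_neq0 (s x y z : bool) : (tri delta w s x y z != 0) = (x + y + z == s.+1)%N.
Proof.
have wn : w != 0 by rewrite gt_eqF.
have dn : delta != 0 by have := delta_ge2 w_gt0 deltaE; case: eqP => // ->; lra.
have an : coef_a delta != 0 by rewrite gt_eqF // (coef_a_gt0 w_gt0 deltaE).
rewrite /tri (fmorph_eq0 (real_complex R)) /triR (coef_bE w_gt0 deltaE) /cup_weight.
have wv : w * w^-1 = 1 by rewrite divff.
have one : (w ^+ 2 + w^-1 ^+ 2) / delta = 1 by rewrite exprVn -deltaE divff.
have up c : c * w^-1 - c / delta * w = c / delta * w^-1 ^+ 3.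
  rewrite -[c * w^-1]mulr1 -one.
  transitivity (c / delta * (w * (w * w^-1) + w^-1 ^+ 3) - c / delta * w); first by ring.
  by rewrite wv; ring.
have down c : c * w - c / delta * w^-1 = c / delta * w ^+ 3.
  rewrite -[c * w]mulr1 -one.
  transitivity (c / delta * (w^-1 * (w * w^-1) + w ^+ 3) - c / delta * w^-1); first by ring.
  by rewrite wv; ring.
case: s; case: x; case: y; case: z; rewrite /= ?(mul0r, mulr0, mul1r, mulr1, addr0, add0r, mulNr) ?up ?down ?oppr_eq0 ?eqxx //.
all: by rewrite ?subr0 ?mulf_neq0 ?expf_neq0 ?invr_neq0.
Qed.

Lemma Phi_inj n (r s : tree n) :
  (forall c, size c = strands n -> spin (Phi r) [:: true] c = spin (Phi s) [:: true] c) -> r = s.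
Proof.
move: r s => [r pr] [s ps] H; apply: val_inj => /=.
case: r pr H => [|r [|? ?]] // pr; case: s ps => [|s [|? ?]] // ps H.
have lr : nleaves r = n by case/andP: (pr) => _ /eqP <-; rewrite /nleavesf /= addn0.
have ls : nleaves s = n by case/andP: (ps) => _ /eqP <-; rewrite /nleavesf /= addn0.
congr [:: _]; apply: (tree_amp_inj tri_neq0) => [|c]; first by rewrite lr ls.
by rewrite lr => sc; have := H c sc; rewrite !(spin_Phi w_gt0 deltaE).
Qed.

Lemma rcompA m n p q (x : Rec R p q) (y : Rec R n p) (z : Rec R m n) :
  rcomp x (rcomp y z) = rcomp (rcomp x y) z.
Proof.
apply/eqP; rewrite -subr_eq0; apply/eqP/(spin_inj w_gt0) => b t _ _.
rewrite spinB; apply/eqP; rewrite subr_eq0; apply/eqP.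
rewrite !(spin_rcomp w_gt0 deltaE).
transitivity (bsum p (fun s => bsum n (fun s' => spin x s t * (spin y s' s * spin z b s')))).
  by apply: eq_bsum => s _; rewrite (spin_rcomp w_gt0 deltaE) -bsumZ.
rewrite exchange_bsum; apply: eq_bsum => s' _.
rewrite (spin_rcomp w_gt0 deltaE) mulrC -bsumZ; apply: eq_bsum => s _.
by rewrite mulrA mulrC.
Qed.

Lemma in_span_Phi n m (f : forest n m) (x : Rec R 1 (strands n)) :
  in_span delta x -> in_span delta (rcomp (Phi f) x : Rec R 1 (strands m)).
Proof.
move=> [k [c [r ->]]]; exists k, c, (fun i => f \oF r i).
rewrite rcomp_sum; apply: eq_bigr => i _; rewrite rcompZ.
by rewrite -(Phi_comp w_gt0 deltaE).
Qed.

Lemma Phi_actE n m (f : forest n m) (xi : tree_span delta n) :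
  val (Phi_act f xi) = rcomp (Phi f) (val xi : Rec R 1 (strands n)) :> Rec R 1 (strands m).
Proof. by rewrite /Phi_act insubdK //; apply/asboolP/in_span_Phi/asboolP; exact: valP xi. Qed.

(** The tree s witnesses [0 < n], as [Phi_comp] requires. *)
Lemma Phi_act_comp n m p (s : tree n) (f : forest m p) (g : forest n m) (xi : tree_span delta n) :
  Phi_act f (Phi_act g xi) = Phi_act (f \oF g) xi.
Proof.
by apply: val_inj; rewrite /= !Phi_actE rcompA (Phi_comp w_gt0 deltaE) ?(tree_gt0 s).
Qed.

Lemma rnorm_act n m (f : forest n m) (xi eta : tree_span delta n) :
  rnorm (val (Phi_act f xi) - val (Phi_act f eta)) = rnorm (val xi - val eta).
Proof.
rewrite !Phi_actE -rcompB (rnorm_isometric w_gt0 deltaE) //.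
exact: isometric_Phi w_gt0 deltaE _ _ _.
Qed.

Definition raw_dist (x y : lim_raw delta) : R :=
  let: existT n (s, xi) := x in
  let: existT m (t, eta) := y in
  let: existT k (p, q) := complete s t in
  rnorm (val (Phi_act p xi) - val (Phi_act q eta)).

(** Any two common expansions of s and t have a further common one, over which the forests agree by
    [fcompI]; isometry then gives equal distances. *)
Lemma raw_distE n m k (s : tree n) (t : tree m) xi eta (f : forest n k) (g : forest m k) :
  f \oF s = g \oF t ->
  raw_dist (mkvec s xi) (mkvec t eta) = rnorm (val (Phi_act f xi) - val (Phi_act g eta)).
Proof.
move=> fg; rewrite /raw_dist /=.
have := completeP s t; case: (complete s t) => k' [p q] /= pq.
have := completeP (f \oF s) (p \oF s).
case: (complete _ _) => j [x y] /=; rewrite !fcompA => xy.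
have xyp := fcompI xy.
have xyq : x \oF g = y \oF q.
  by apply: (@fcompI _ _ _ t); rewrite -!fcompA -fg -pq !fcompA.
rewrite -(rnorm_act y) -[RHS](rnorm_act x).
by rewrite !(Phi_act_comp s) !(Phi_act_comp t) xyp xyq.
Qed.

Lemma raw_dist_sym x y : raw_dist x y = raw_dist y x.
Proof.
case: x => n [s xi]; case: y => m [t eta].
have := completeP s t; case: (complete s t) => k [p q] /= pq.
rewrite -[LHS]/(raw_dist (mkvec s xi) (mkvec t eta)) (raw_distE _ _ pq).
rewrite -[RHS]/(raw_dist (mkvec t eta) (mkvec s xi)) (raw_distE _ _ (esym pq)).
by rewrite -(rnormN w_gt0 deltaE) opprB.
Qed.

Lemma raw_dist_triangle x y z : raw_dist x z <= raw_dist x y + raw_dist y z.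
Proof.
case: x => n [s xi]; case: y => m [t eta]; case: z => p [r zeta].
have := completeP s t; case: (complete s t) => k [f g] /= fg.
have := completeP (f \oF s) r; case: (complete _ _) => j [h l] /= hl.
have E1 : (h \oF f) \oF s = (h \oF g) \oF t by rewrite -!fcompA fg.
have E2 : (h \oF f) \oF s = l \oF r by rewrite -fcompA.
change (raw_dist (mkvec s xi) (mkvec r zeta) <=
  raw_dist (mkvec s xi) (mkvec t eta) + raw_dist (mkvec t eta) (mkvec r zeta)).
rewrite (raw_distE _ _ E1) (raw_distE _ _ E2) (raw_distE _ _ (etrans (esym E1) E2)).
by apply: le_trans (rnormD w_gt0 deltaE _ _); rewrite addrA subrK.
Qed.

Lemma raw_dist_step x y : lim_step x y -> raw_dist x y = 0.
Proof.
case=> [n s xi eta ker|n m s f xi].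
  rewrite (raw_distE _ _ (erefl (fid n \oF s))) rnorm_act.
  by rewrite /rnorm ker sqrtr0.
have E : f \oF s = fid m \oF (f \oF s) by rewrite fcomp1f.
rewrite (raw_distE _ _ E) (Phi_act_comp s) fcomp1f subrr.
exact: rnorm0.
Qed.

(** Both kinds of generating steps have length zero, so the triangle inequality lets x move along
    them. *)
Lemma raw_dist_eql x x' y :
  x = x' %[mod {eq_quot gen_equiv (@lim_step R delta)}] -> raw_dist x y = raw_dist x' y.
Proof.
move: x x'; apply: (gen_equiv_ind (h := fun x => raw_dist x y)) => x x' /raw_dist_step xx.
have xx' := raw_dist_triangle x x' y; have x'x := raw_dist_triangle x' x y.
rewrite xx add0r in xx'; rewrite (raw_dist_sym x' x) xx add0r in x'x.
by apply: le_anti; rewrite xx' x'x.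
Qed.

Lemma lim_distE n m k (s : tree n) (t : tree m) (xi : tree_span delta n) (eta : tree_span delta m) (f : forest n k) (g : forest m k) :
  f \oF s = g \oF t ->
  lim_dist (vec s xi) (vec t eta) = rnorm (val (Phi_act f xi) - val (Phi_act g eta)).
Proof.
move=> fg; rewrite -(raw_distE _ _ fg).
rewrite -[LHS]/(raw_dist (repr (vec s xi)) (repr (vec t eta))).
rewrite (@raw_dist_eql _ (mkvec s xi)) ?reprK // raw_dist_sym.
by rewrite (@raw_dist_eql _ (mkvec t eta)) ?reprK // raw_dist_sym.
Qed.

Lemma lim_dist_sym (u v : jones_lim delta) : lim_dist u v = lim_dist v u.
Proof. exact: raw_dist_sym. Qed.

Lemma lim_dist_triangle (v u z : jones_lim delta) : lim_dist u z <= lim_dist u v + lim_dist v z.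
Proof. exact: raw_dist_triangle. Qed.

Lemma lim_dist_ge0 (u v : jones_lim delta) : 0 <= lim_dist u v.
Proof.
rewrite /lim_dist; case: (repr u) => n [s xi]; case: (repr v) => m [t eta].
by case: (complete s t) => k [p q]; exact: rnorm_ge0.
Qed.

Lemma vecP (u : jones_lim delta) : exists n (s : tree n) (xi : tree_span delta n), u = vec s xi.
Proof. by rewrite -[u]reprK; case: (repr u) => n [s xi]; exists n, s, xi. Qed.

Lemma vec_step n m (s : tree n) (f : forest n m) (xi : tree_span delta n) :
  vec (f \oF s) (Phi_act f xi) = vec s xi.
Proof. by symmetry; apply: gen_equivP; exact: lim_incl. Qed.

Definition pi_raw (x : tree_pair) (y : lim_raw delta) : jones_lim delta :=
  let: existT n (r, s) := x in
  let: existT m (v, xi) := y in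
  let: existT k (p, q) := complete s v in
  vec (p \oF r) (Phi_act q xi).

Lemma pi_rawE n m k (r s : tree n) (v : tree m) xi (p : forest n k) (q : forest m k) :
  p \oF s = q \oF v -> pi_raw (mkpair r s) (mkvec v xi) = vec (p \oF r) (Phi_act q xi).
Proof.
move=> pq; rewrite /pi_raw /=.
have := completeP s v; case: (complete s v) => k' [p' q'] /= pq'.
have := completeP (p \oF s) (p' \oF s).
case: (complete _ _) => j [x y] /=; rewrite !fcompA => xy.
have xyp := fcompI xy.
have xyq : x \oF q = y \oF q'.
  by apply: (@fcompI _ _ _ v); rewrite -!fcompA -pq -pq' !fcompA.
rewrite -(vec_step (p' \oF r) y) -(vec_step (p \oF r) x) !fcompA !(Phi_act_comp v).
by rewrite xyp xyq.
Qed.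

Lemma pi_raw_eql y x x' : x = x' %[mod {eq_quot gen_equiv pair_step}] ->
  pi_raw x y = pi_raw x' y.
Proof.
move: x x'; apply: (gen_equiv_ind (h := fun x => pi_raw x y)).
move=> _ _ [n m r s f]; case: y => k [v xi].
have := completeP (f \oF s) v; case: (complete _ _) => j [p q] /= pq.
rewrite -[LHS]/(pi_raw (mkpair r s) (mkvec v xi)).
rewrite -[RHS]/(pi_raw (mkpair (f \oF r) (f \oF s)) (mkvec v xi)).
rewrite (pi_rawE _ _ pq).
by rewrite fcompA in pq; rewrite (pi_rawE _ _ pq) fcompA.
Qed.

Lemma pi_raw_eqr x y y' : y = y' %[mod {eq_quot gen_equiv (@lim_step R delta)}] ->
  pi_raw x y = pi_raw x y'.
Proof.
move: y y'; apply: (gen_equiv_ind (h := fun y => pi_raw x y)).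
move=> _ _ [m v xi eta ker|m k v f xi]; case: x => n [r s].
  have := completeP s v; case: (complete s v) => j [p q] /= pq.
  rewrite -[LHS]/(pi_raw (mkpair r s) (mkvec v xi)) (pi_rawE _ _ pq).
  rewrite -[RHS]/(pi_raw (mkpair r s) (mkvec v eta)) (pi_rawE _ _ pq).
  apply: gen_equivP; apply: lim_kernel => z.
  (* Difference in the kernel means norm zero. The isometry preserves it, and norm zero annihilates
     every spin entry, hence every inner product. *)
  have n0 : rnorm (val (Phi_act q xi) - val (Phi_act q eta)) = 0.
    by rewrite rnorm_act /rnorm ker sqrtr0.
  rewrite (rinnerE w_gt0 deltaE) -[RHS](bsum0 _ (strands j)); apply: eq_bsum => c sc.
  by rewrite (rnorm_eq0 w_gt0 deltaE n0 sc) mul0r.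
have := completeP s (f \oF v); case: (complete _ _) => j [p q] /= pq.
rewrite -[LHS]/(pi_raw (mkpair r s) (mkvec v xi)).
rewrite -[RHS]/(pi_raw (mkpair r s) (mkvec (f \oF v) (Phi_act f xi))).
rewrite (pi_rawE _ _ pq).
by rewrite fcompA in pq; rewrite (pi_rawE _ _ pq) (Phi_act_comp v).
Qed.

Lemma pi_limE n m k (r s : tree n) (v : tree m) (xi : tree_span delta m) (p : forest n k) (q : forest m k) :
  p \oF s = q \oF v ->
  pi_lim (Defs.frac r s) (vec v xi) = vec (p \oF r) (Phi_act q xi) :> jones_lim delta.
Proof.
move=> pq; rewrite -[LHS]/(pi_raw (repr (Defs.frac r s)) (repr (vec v xi))).
rewrite -(pi_rawE _ _ pq) (@pi_raw_eql _ _ (mkpair r s)) ?reprK //.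
by rewrite (@pi_raw_eqr _ _ (mkvec v xi)) ?reprK.
Qed.

Lemma pi_lim_isometry g (u u' : jones_lim delta) :
  lim_dist (pi_lim g u) (pi_lim g u') = lim_dist u u'.
Proof.
have [n [r [s ->]]] := fracP g; have [m [v [xi ->]]] := vecP u; have [m' [v' [xi' ->]]] := vecP u'.
have := completeP s v; case: (complete s v) => k [p q] /= pq.
have := completeP (p \oF s) v'; case: (complete _ _) => j [h q'] /= hq'.
have hq : (h \oF p) \oF s = (h \oF q) \oF v by rewrite -!fcompA pq.
rewrite fcompA in hq'.
rewrite (pi_limE _ _ hq) (pi_limE _ _ hq') (lim_distE _ _ (erefl (fid j \oF (h \oF p \oF r)))).
by rewrite rnorm_act (lim_distE _ _ (etrans (esym hq) hq')).
Qed.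

Lemma lim_dist_Omega n (r s : tree n) :
  lim_dist (pi_lim (Defs.frac r s) (Omega_lim delta)) (Omega_lim delta) =
  rnorm ((Phi s : Rec R 1 (strands n)) - Phi r).
Proof.
have E : fid n \oF s = s \oF fid 1 by rewrite fcomp1f fcompf1.
have E' : fid n \oF (fid n \oF r) = r \oF fid 1 by rewrite !fcomp1f fcompf1.
have actE t : val (Phi_act t (exist _ (rid R 1) (in_span1 delta) : tree_span delta 1)) =
    Phi t :> Rec R 1 (strands n).
  rewrite Phi_actE /= -[t in RHS]fcompf1 -(Phi_comp w_gt0 deltaE) //.
  by rewrite {3}/Defs.Phi (Phi_word_id _ _ (erefl 1%N)).
by rewrite (pi_limE _ _ E) (lim_distE _ _ E') (Phi_act_comp (fid 1)) fcomp1f !actE.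
Qed.

End JonesAction.

(** * The stabilizer of the vacuum vector *)

Section VacuumStabilizer.
Variables (R : realType) (delta w : R).
Hypotheses (w_gt0 : 0 < w) (deltaE : delta = w ^+ 2 + w ^- 2).
Local Notation triangle := (lim_dist_triangle w_gt0 deltaE).
Local Notation sym := (lim_dist_sym w_gt0 deltaE).

(** [cauchy_equiv] is already an equivalence relation, so the generated one coincides with it. *)
Lemma cauchy_eqP (u v : cauchy_seq delta) :
  reflect (cauchy_equiv u v) (u == v %[mod jones_space delta]).
Proof.
apply: (iffP eqP) => [/eqmodP/asboolP|uv]; last exact: gen_equivP.
elim=> {u v} [//|u e e0|u v _ uv e e0|u v z _ uv _ vz e e0].
- by exists 0%N => i _; rewrite lim_distxx.
- by have [N H] := uv e e0; exists N => i /H; rewrite sym.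
have e2 : 0 < e / 2 by lra.
have [N H] := uv _ e2; have [M H'] := vz _ e2; exists (maxn N M) => i.
rewrite geq_max => /andP[/H h /H' h'].
by apply: le_lt_trans (triangle (val v i) _ _) _; lra.
Qed.

(** The representative of [Omega] picked by [repr] need not be the constant sequence. Isometry and
    the triangle inequality transfer the statement between the two. *)
Lemma jones_pi_Omega g :
  jones_pi g (Omega delta) = Omega delta <->
  lim_dist (pi_lim g (Omega_lim delta)) (Omega_lim delta) = 0.
Proof.
set O := Omega_lim delta; pose x := repr (Omega delta).
have xO : cauchy_equiv x (cst_seq O) by apply/cauchy_eqP; rewrite reprK.
have gx : is_cauchy (fun k => pi_lim g (val x k)).
  have /asboolP xC := valP x; move=> e /xC[N H]; exists N => i j Ni Nj.
  by rewrite (pi_lim_isometry w_gt0 deltaE) H.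
have gE : val (insubd (cst_seq O) (fun k => pi_lim g (val x k))) = fun k => pi_lim g (val x k).
  by rewrite insubdK //; apply/asboolP.
rewrite -[jones_pi g _]/(\pi_(jones_space delta) (insubd (cst_seq O) (fun k => pi_lim g (val x k)))).
split=> [/eqP/cauchy_eqP E|E]; last first.
  apply/eqP/cauchy_eqP => e e0; have [N H] := xO e e0; exists N => i /H h.
  rewrite gE; apply: le_lt_trans (triangle (pi_lim g O) _ _) _.
  by rewrite E addr0 (pi_lim_isometry w_gt0 deltaE).
apply/eqP; rewrite eq_le lim_dist_ge0 andbT; apply/ler_addgt0Pl => e e0.
have e2 : 0 < e / 2 by lra.
have [N H] := xO _ e2; have [M H'] := E _ e2.
have h := H (maxn N M) (leq_maxl N M); have h' := H' (maxn N M) (leq_maxr N M).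
rewrite gE in h'; apply: le_trans (triangle (pi_lim g (val x (maxn N M))) _ _) _.
rewrite (pi_lim_isometry w_gt0 deltaE) sym addr0.
by move: h h' => /=; rewrite -/O; lra.
Qed.

Lemma jones_pi_Omega_eq1 g : jones_pi g (Omega delta) = Omega delta <-> g = 1%g.
Proof.
have [n [r [s ->]]] := fracP g; rewrite jones_pi_Omega (lim_dist_Omega w_gt0 deltaE).
split=> [d0|E].
  suff -> : s = r by exact: frac_id.
  apply: (Phi_inj w_gt0 deltaE) => c sc; apply/eqP; rewrite -subr_eq0 -spinB.
  by apply/eqP; apply: (rnorm_eq0 w_gt0 deltaE) sc.
rewrite -(lim_dist_Omega w_gt0 deltaE) E -[1%g]/(Defs.frac (fid 1) (fid 1)).
by rewrite (lim_dist_Omega w_gt0 deltaE) subrr rnorm0.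
Qed.

End VacuumStabilizer.

(** w^2 is the larger root q of q + 1/q = delta. *)
Lemma loop_parameter (R : realType) (delta : R) : 2 <= delta ->
  exists2 w : R, 0 < w & delta = w ^+ 2 + w ^- 2.
Proof.
move=> d2; have D0 : 0 <= delta ^+ 2 - 4 by nra.
pose r := Num.sqrt (delta ^+ 2 - 4); have r2 : r ^+ 2 = delta ^+ 2 - 4 by rewrite sqr_sqrtr.
have r0 : 0 <= r := sqrtr_ge0 _.
pose q := (delta + r) / 2; have q0 : 0 < q by rewrite /q; lra.
exists (Num.sqrt q); first by rewrite sqrtr_gt0.
rewrite sqr_sqrtr ?ltW //; have -> : q^-1 = (delta - r) / 2.
  apply: (mulfI (lt0r_neq0 q0)); rewrite divff ?lt0r_neq0 // /q.
  have -> : (delta + r) / 2 * ((delta - r) / 2) = (delta ^+ 2 - r ^+ 2) / 4 by field.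
  by rewrite r2; field.
by rewrite /q; field.
Qed.

Lemma vacuum_stabilizer_trivial (R : realType) (t : R) : 4 <= t ->
  F_Omega t = [set 1%g]%classic.
Proof.
move=> t4; have d2 : 2 <= Num.sqrt t.
  have -> : 2 = Num.sqrt (4 : R) by rewrite (_ : 4 = 2 ^+ 2) ?sqrtr_sqr ?ger0_norm //; ring.
  exact: ler_wsqrtr.
have [w w0 dE] := loop_parameter d2.
apply/seteqP; split=> g; by move=> /(jones_pi_Omega_eq1 w0 dE).
Qed.

Theorem theorem5p6 (R : realType) (t : R) (ht : 463%:R / 100%:R < t) :
  (forall G : sgraph, planar R G -> connected_graph G ->
     `|(chromatic_poly R G).[t]| <= t * (t - 1) ^+ #|G|.-1 /\
     (~ is_tree G -> `|(chromatic_poly R G).[t]| < t * (t - 1) ^+ #|G|.-1)) /\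
  F_Omega t = [set 1%g]%classic.
Proof.
split=> [G pG cG|]; first exact: planar_chromatic_bound ht pG cG.
by apply: vacuum_stabilizer_trivial; lra.
Qed.
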